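(* Let the dimension $d=d_n$ depend on $n$ (and with it $R$ and $u$). Suppose that for some $\nu\in(2,3]$: (1) there is a constant $C<\infty$ with $M_{\mathrm{full};\nu}/\sigma_{\mathrm{full}}\le C$ and $M_{\mathrm{cond};\nu}/\sigma_{\mathrm{cond}}\le C$ uniformly in $n$ and $d$; (2) for every fixed $n$ and $d$ there are $\{\phi_k\}_{k\ge1},\{\lambda_k\}_{k\ge1}$ with $\varepsilon_{K;\nu}\to0$ as $K\to\infty$. Suppose also that the sequential limit in distribution $\bar U=\lim_{n\to\infty}\lim_{K\to\infty}\frac{\sqrt{n(n-1)}}{\sigma_{\max}}(U_n^K-D)$ exists. Then $$\frac{\sqrt{n(n-1)}}{\sigma_{\max}}(D_n-D)\xrightarrow{d}\bar U\qquad\text{as } n\to\infty.$$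
   Context: For each $n\ge2$ let $\mathbf X_1,\dots,\mathbf X_n$ be i.i.d. with law $R$ on $\mathbb R^d$, $u:\mathbb R^d\times\mathbb R^d\to\mathbb R$ symmetric measurable, $D=\mathbb E[u(\mathbf X_1,\mathbf X_2)]$, $D_n=\frac1{n(n-1)}\sum_{1\le i\ne j\le n}u(\mathbf X_i,\mathbf X_j)$. Write $\|Y\|_{L_\nu}=\mathbb E[|Y|^\nu]^{1/\nu}$. Define $M_{\mathrm{cond};\nu}=\|\mathbb E[u(\mathbf X_1,\mathbf X_2)|\mathbf X_2]-D\|_{L_\nu}$, $M_{\mathrm{full};\nu}=\|u(\mathbf X_1,\mathbf X_2)-D\|_{L_\nu}$, $\sigma_{\mathrm{cond}}=M_{\mathrm{cond};2}$, $\sigma_{\mathrm{full}}=M_{\mathrm{full};2}$, $\sigma_{\max}=\max\{\sigma_{\mathrm{full}},(n-1)^{1/2}\sigma_{\mathrm{cond}}\}$ (with $0<\sigma_{\max}<\infty$). For functions $\phi_k:\mathbb R^d\to\mathbb R$ (with $\mathbb E[\phi_k(\mathbf X_1)^2]<\infty$) and reals $\lambda_k$, let $\varepsilon_{K;\nu}=\big\|\sum_{k=1}^K\lambda_k\phi_k(\mathbf X_1)\phi_k(\mathbf X_2)-u(\mathbf X_1,\mathbf X_2)\big\|_{L_\nu}$. For $K\in\mathbb N$ let $\Lambda^K=\mathrm{diag}\{\lambda_1,\dots,\lambda_K\}$, $\phi^K(x)=(\phi_1(x),\dots,\phi_K(x))^\top$, $\mu^K=\mathbb E[\phi^K(\mathbf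 X_1)]$, $\Sigma^K=\mathrm{Cov}[\phi^K(\mathbf X_1)]$. With $\eta_i^K$ i.i.d. standard Gaussian vectors in $\mathbb R^K$, $$U_n^K=\frac1{n(n-1)}\sum_{1\le i\ne j\le n}(\eta_i^K)^\top(\Sigma^K)^{1/2}\Lambda^K(\Sigma^K)^{1/2}\eta_j^K+\frac2n\sum_{i=1}^n(\mu^K)^\top\Lambda^K(\Sigma^K)^{1/2}\eta_i^K+D.$$ The sequential limit means: for each $n$ the limit in distribution as $K\to\infty$, then the limit in distribution of these as $n\to\infty$. *)

(* Defs.v *)
From HB Require Import structures.
From mathcomp Require Import all_boot all_order all_algebra.
From mathcomp Require Import all_classical all_reals all_analysis.
From mathcomp Require Import measurable_realfun.

Set Implicit Arguments.
Unset Strict Implicit.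
Unset Printing Implicit Defensive.

Import Order.TTheory GRing.Theory Num.Theory.
Import numFieldNormedType.Exports.

Local Open Scope classical_set_scope.
Local Open Scope ring_scope.

(* Taking some of the A i equal to setT gives the product rule on every
   subfamily, so this is mutual independence. *)
Definition independent_rvs {R : realType} {d} {T : measurableType d}
    (P : probability T R) {I : finType} {d'} {T' : measurableType d'}
    (X : I -> T -> T') : Prop :=
  forall A : I -> set T', (forall i, measurable (A i)) ->
    P (\bigcap_(i in [set: I]) (X i @^-1` A i)) =
    (\prod_(i : I) P (X i @^-1` A i))%E.

Definition iid_with_law {R : realType} {d} {T : measurableType d}
    (P : probability T R) {I : finType} {d'} {T' : measurableType d'}
    (X : I -> T -> T') (mu : set T' -> \bar R) : Prop :=
  independent_rvs P X /\
  forall i A, measurable A -> P (X i @^-1` A) = mu A.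

Definition std_gaussian_vector {R : realType} {d} {T : measurableType d}
    (P : probability T R) {K : nat} (Y : T -> K.-tuple R) : Prop :=
  iid_with_law P (fun (k : 'I_K) w => tnth (Y w) k) (normal_prob 0 1).

(* V is a version of E[Y | sigma(Z)]. *)
Definition is_cond_exp {R : realType} {d} {T : measurableType d}
    (P : probability T R) {d'} {T' : measurableType d'}
    (Y : T -> R) (Z : T -> T') (V : T -> R) : Prop :=
  let sigmaZ : set (set T) := preimage_set_system [set: T] Z measurable in
  [/\ forall B : set R, measurable B -> sigmaZ (V @^-1` B),
      P.-integrable [set: T] (EFin \o V) &
      forall A, sigmaZ A ->
        (\int[P]_(w in A) (V w)%:E = \int[P]_(w in A) (Y w)%:E)%E].

(* An arbitrary version; the value 0 is only taken when there is none, which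
   cannot happen when Y is integrable and Z is measurable. *)
Definition cond_exp {R : realType} {d} {T : measurableType d}
    (P : probability T R) {d'} {T' : measurableType d'}
    (Y : T -> R) (Z : T -> T') : T -> R :=
  xget (cst 0) [set V | is_cond_exp P Y Z V].

Definition psd {R : realType} {K : nat} (A : 'M[R]_K) : Prop :=
  A^T = A /\ forall v : 'cV[R]_K, 0 <= (v^T *m A *m v) ord0 ord0.

(* The unique positive semidefinite A with A ^ 2 = S; the value 0 is only
   taken when there is none, that is, when S is not positive semidefinite. *)
Definition psd_sqrt {R : realType} {K : nat} (S : 'M[R]_K) : 'M[R]_K :=
  xget 0 [set A | psd A /\ A *m A = S].

Definition cvg_in_law {R : realType} (mu : nat -> probability R R)
    (nu : probability R R) : Prop :=
  forall f : R -> R, continuous f -> bounded_fun f ->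
    (\int[mu n]_x (f x)%:E)%E @[n --> \oo] --> (\int[nu]_x (f x)%:E)%E.

(* The law of a (Y - b). *)
Definition affine_rv {R : realType} {d} {T : measurableType d}
    (a b : R) (Y : T -> R) : T -> R := fun w => a * (Y w - b).

Lemma measurable_affine_rv {R : realType} {d} {T : measurableType d}
    (a b : R) (Y : {mfun T >-> R}) :
  measurable_fun [set: T] (affine_rv a b Y).
Proof. by apply: measurable_funM => //; exact: measurable_funB. Qed.

HB.instance Definition _ (R : realType) d (T : measurableType d)
    (a b : R) (Y : {mfun T >-> R}) :=
  isMeasurableFun.Build _ _ T R (affine_rv a b Y)
    (measurable_affine_rv a b Y).

(* In what follows the observations X_1, X_2, ..., X_n are indexed from 0, as
   X 0, X 1, ..., X n.-1, and E is the space R^d of the observations. *)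

Definition Dmean {R : realType} {d} {T : measurableType d}
    (P : probability T R) {d'} {E : measurableType d'}
    (u : E * E -> R) (X : nat -> T -> E) : R :=
  fine 'E_P[fun w => u (X 0%N w, X 1%N w)].

Definition Ustat {R : realType} {d} {T : measurableType d}
    {d'} {E : measurableType d'}
    (u : E * E -> R) (X : nat -> T -> E) (n : nat) : T -> R :=
  fun w => (n * n.-1)%:R^-1 *
    \sum_(i < n) \sum_(j < n | i != j) u (X i w, X j w).

Lemma measurable_Ustat {R : realType} {d} {T : measurableType d}
    {d'} {E : measurableType d'}
    (u : {mfun (E * E)%type >-> R}) (X : nat -> {mfun T >-> E}) (n : nat) :
  measurable_fun [set: T] (Ustat u X n).
Proof.
apply: measurable_funM => //; apply: measurable_sum => i.
under eq_fun do rewrite big_mkcond.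
apply: measurable_sum => j; case: (i != j) => //=.
by apply: measurableT_comp => //; exact: measurable_fun_pair.
Qed.

HB.instance Definition _ (R : realType) d (T : measurableType d)
    d' (E : measurableType d')
    (u : {mfun (E * E)%type >-> R}) (X : nat -> {mfun T >-> E}) (n : nat) :=
  isMeasurableFun.Build _ _ T R (Ustat u X n) (measurable_Ustat u X n).

Definition Mcond {R : realType} {d} {T : measurableType d}
    (P : probability T R) {d'} {E : measurableType d'}
    (u : E * E -> R) (X : nat -> T -> E) (nu : R) : \bar R :=
  let V := cond_exp P (fun w => u (X 0%N w, X 1%N w)) (X 1%N) in
  'N[P]_(nu%:E)[EFin \o (fun w => V w - Dmean P u X)%R]%E.

Definition Mfull {R : realType} {d} {T : measurableType d}
    (P : probability T R) {d'} {E : measurableType d'}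
    (u : E * E -> R) (X : nat -> T -> E) (nu : R) : \bar R :=
  'N[P]_(nu%:E)[EFin \o (fun w => u (X 0%N w, X 1%N w) - Dmean P u X)%R]%E.

(* sigma_cond may vanish (degenerate u).  Then Mcond P u X nu = 0 too, and the
   quotient Mcond P u X nu / sigma_cond P u X is 0 * +oo = 0 in \bar R. *)
Definition sigma_cond {R : realType} {d} {T : measurableType d}
    (P : probability T R) {d'} {E : measurableType d'}
    (u : E * E -> R) (X : nat -> T -> E) : \bar R := Mcond P u X 2.

Definition sigma_full {R : realType} {d} {T : measurableType d}
    (P : probability T R) {d'} {E : measurableType d'}
    (u : E * E -> R) (X : nat -> T -> E) : \bar R := Mfull P u X 2.

Definition sigma_max {R : realType} {d} {T : measurableType d}
    (P : probability T R) {d'} {E : measurableType d'}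
    (u : E * E -> R) (X : nat -> T -> E) (n : nat) : \bar R :=
  Order.max (sigma_full P u X)
            ((Num.sqrt n.-1%:R : R)%R%:E * sigma_cond P u X)%E.

(* The factor sqrt(n (n - 1)) / sigma_max, for sigma_max finite. *)
Definition scaling {R : realType} {d} {T : measurableType d}
    (P : probability T R) {d'} {E : measurableType d'}
    (u : E * E -> R) (X : nat -> T -> E) (n : nat) : R :=
  Num.sqrt (n * n.-1)%:R / fine (sigma_max P u X n).

(* phi k and lambda k stand for phi_(k+1) and lambda_(k+1). *)
Definition eps {R : realType} {d} {T : measurableType d}
    (P : probability T R) {d'} {E : measurableType d'}
    (u : E * E -> R) (X : nat -> T -> E)
    (phi : nat -> E -> R) (lambda : nat -> R) (K : nat) (nu : R) : \bar R :=
  'N[P]_(nu%:E)[EFin \o (fun w =>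
    \sum_(k < K) lambda k * phi k (X 0%N w) * phi k (X 1%N w)
      - u (X 0%N w, X 1%N w))%R]%E.

Definition Lambda {R : realType} (lambda : nat -> R) (K : nat) : 'M[R]_K :=
  diag_mx (\row_(k < K) lambda k).

Definition muK {R : realType} {d} {T : measurableType d}
    (P : probability T R) {d'} {E : measurableType d'}
    (X : nat -> T -> E) (phi : nat -> E -> R) (K : nat) : 'cV[R]_K :=
  \col_(k < K) fine 'E_P[phi k \o X 0%N].

Definition SigmaK {R : realType} {d} {T : measurableType d}
    (P : probability T R) {d'} {E : measurableType d'}
    (X : nat -> T -> E) (phi : nat -> E -> R) (K : nat) : 'M[R]_K :=
  \matrix_(k < K, l < K) fine (covariance P (phi k \o X 0%N) (phi l \o X 0%N)).

Definition gaussU {R : realType} {K : nat} (m : 'cV[R]_K) (S L : 'M[R]_K)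
    (D : R) {n : nat} {d} {T : measurableType d} (eta : 'I_n -> T -> K.-tuple R)
    : T -> R :=
  let z i w : 'cV[R]_K := \col_k tnth (eta i w) k in
  let A := psd_sqrt S in
  fun w =>
    (n * n.-1)%:R^-1 *
      (\sum_(i < n) \sum_(j < n | i != j)
         ((z i w)^T *m A *m L *m A *m z j w) ord0 ord0)
    + 2 / n%:R * (\sum_(i < n) (m^T *m L *m A *m z i w) ord0 ord0)
    + D.

Lemma measurable_mulmx {R : realType} {d} {T : measurableType d} {m n p : nat}
    (A : T -> 'M[R]_(m, n)) (B : T -> 'M[R]_(n, p)) :
  (forall i j, measurable_fun [set: T] (fun w => A w i j)) ->
  (forall i j, measurable_fun [set: T] (fun w => B w i j)) ->
  forall i j, measurable_fun [set: T] (fun w => (A w *m B w) i j).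
Proof.
move=> mA mB i j; under eq_fun do rewrite mxE.
by apply: measurable_sum => k; exact: measurable_funM.
Qed.

Lemma measurable_gaussU {R : realType} {K : nat} (m : 'cV[R]_K)
    (S L : 'M[R]_K) (D : R) {n : nat} {d} {T : measurableType d}
    (eta : 'I_n -> {mfun T >-> K.-tuple R}) :
  measurable_fun [set: T] (gaussU m S L D eta).
Proof.
have mz i k l : measurable_fun [set: T]
    (fun w => (\col_k tnth (eta i w) k : 'cV[R]_K) k l).
  under eq_fun do rewrite mxE.
  exact: measurableT_comp (measurable_tnth k) _.
rewrite /gaussU; apply: measurable_funD => //; apply: measurable_funD.
  apply: measurable_funM => //; apply: measurable_sum => i.
  under eq_fun do rewrite big_mkcond.
  apply: measurable_sum => j; case: (i != j) => //=.
  do 4!apply: measurable_mulmx => //.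
  by move=> k l; under eq_fun do rewrite mxE; exact: mz.
apply: measurable_funM => //; apply: measurable_sum => i.
by apply: measurable_mulmx => // k l; exact: mz.
Qed.

HB.instance Definition _ (R : realType) (K : nat) (m : 'cV[R]_K)
    (S L : 'M[R]_K) (D : R) (n : nat) d (T : measurableType d)
    (eta : 'I_n -> {mfun T >-> K.-tuple R}) :=
  isMeasurableFun.Build _ _ T R (gaussU m S L D eta)
    (measurable_gaussU m S L D eta).

(* Main.v *)
(* Fix [n] and [K].  Up to the factor [sqrt (n (n - 1)) / sigma_max], the
   U-statistic of the kernel [\sum_k lambda_k phi_k (x) phi_k (y)] is a quadratic
   polynomial in the independent centred vectors [phi^K (X_i) - mu^K], and [U_n^K]
   is the same polynomial in Gaussian vectors with the same covariance.  Lindeberg's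
   replacement, one vector at a time, compares their expectations under a test
   function with a second-order Taylor expansion.  Given the other vectors the
   increment is a linear form, whose second moments agree under both laws, so each
   step costs at most [E (min (w ^ 2, |w| ^ 3))] with [w] this linear form.  This is
   bounded by [delta * E (w ^ 2)] plus a constant times [E (q (w ^ 2))], where
   [q t = t ^ 2 / (1 + t)].  As [q] is convex, grows at most quadratically under
   scaling, and is dominated by powers of exponent [nu / 2], these quantities pass to
   conditional expectations and Gaussian vectors, and are bounded through the
   moments of order [nu] of [u] alone, uniformly in [K].  Letting [K] tend to
   infinity for fixed [n], the error is [O (delta) + O_delta (n ^ (1 - nu / 2))];
   then [n] tends to infinity and [delta] to 0.  Smooth steps suffice as test
   functions for convergence in law. *)
Require Import Defs.
From HB Require Import structures.
From mathcomp Require Import all_boot all_order all_algebra.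
From mathcomp Require Import ring lra.
From mathcomp Require Import spectral complex.
From mathcomp Require Import all_classical all_reals all_analysis.
From mathcomp Require Import measurable_realfun.

Set Implicit Arguments.
Unset Strict Implicit.
Unset Printing Implicit Defensive.

Import Order.TTheory GRing.Theory Num.Theory.
Import numFieldNormedType.Exports.

Local Open Scope classical_set_scope.
Local Open Scope ring_scope.

(** * The truncated square *)

(** The obstacle is that moments of order [nu] are available for [u] only: the features are merely
    square integrable, and their number is unbounded while [n] is fixed. For powers of order [nu],
    controlling the intermediate sums would call for an inequality of Rosenthal type; for [qtrunc] a
    single Taylor estimate does it, since its first-order term vanishes on centred increments. An
    approximation error inside [qtrunc] costs only its plain second moment, so [L^2] closeness of
    the finite-rank kernel to [u] is enough. Gaussian variables satisfy a reverse Jensen inequality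
    [E q(g^2) <= c q(E g^2)], and Jensen then returns to the features, which have the same
    covariance; every error term thus becomes an integral over the law of the data. The observations
    and the Gaussian vectors live on unrelated probability spaces. They are compared through laws of
    chains whose state holds the current value and the sum of the vectors absorbed so far; the
    linear term of the polynomial is encoded by a nonzero starting vector. Symmetry of the bilinear
    form makes the order of absorption immaterial, so the vector being replaced can always come
    last. *)

Section truncated_square.
Context {R : realType}.
Implicit Types s t c x y : R.

(** Concave with values in [[0, 1)] on the half-line; since [qtrunc t = t - satur t] there, its
    tangent lines yield those of the convex function [qtrunc]. *)
Definition satur t := t / (1 + t).
(* Comparable with [Num.min t (t ^+ 2)], but convex, hence stable under conditioning. *)
Definition qtrunc t := t * satur t.

Lemma satur_ge0 t : 0 <= t -> 0 <= satur t.
Proof. by move=> t0; rewrite divr_ge0// addr_ge0. Qed.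

Lemma satur_le1 t : 0 <= t -> satur t <= 1.
Proof. by move=> t0; rewrite ler_pdivrMr; lra. Qed.

Lemma satur_le t : 0 <= t -> satur t <= t.
Proof. by move=> t0; rewrite ler_pdivrMr; nra. Qed.

Lemma saturE t : 0 <= t -> satur t = 1 - (1 + t)^-1.
Proof. by move=> t0; rewrite /satur; field; lra. Qed.

Lemma ler_satur s t : 0 <= s -> s <= t -> satur s <= satur t.
Proof.
move=> s0 st; rewrite !saturE; [|lra|lra].
by rewrite lerD2l lerN2 lef_pV2 ?posrE; lra.
Qed.

Lemma satur_scale c t : 1 <= c -> 0 <= t -> satur (c * t) <= c * satur t.
Proof.
move=> c1 t0; rewrite /satur mulrA ler_pdivrMr; last by nra.
rewrite mulrAC ler_pdivlMr; last by lra.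
have := mulr_ge0 (mulr_ge0 (le_trans ler01 c1) t0) t0; nra.
Qed.

(** Concavity in the form consumed by Jensen's inequality: tangent minus function is the explicit
    square [(t - s)^2 / ((1 + t) (1 + s)^2)]. *)
Lemma satur_tangent s t : 0 <= s -> 0 <= t ->
  satur t <= satur s + (1 + s)^-2 * (t - s).
Proof.
move=> s0 t0; rewrite -subr_ge0.
have -> : satur s + (1 + s)^-2 * (t - s) - satur t =
          (t - s) ^+ 2 / ((1 + t) * (1 + s) ^+ 2).
  by rewrite /satur; field; rewrite !gt_eqF //=; lra.
by rewrite divr_ge0 ?sqr_ge0// mulr_ge0 ?sqr_ge0//; lra.
Qed.

Lemma qtruncE t : 0 <= t -> qtrunc t = t - satur t.
Proof. by move=> t0; rewrite /qtrunc /satur; field; lra. Qed.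

Lemma qtrunc_ge0 t : 0 <= t -> 0 <= qtrunc t.
Proof. by move=> t0; rewrite mulr_ge0// satur_ge0. Qed.

Lemma qtrunc_le t : 0 <= t -> qtrunc t <= t.
Proof. by move=> t0; rewrite /qtrunc ler_piMr// satur_le1. Qed.

Lemma qtrunc_le_sqr t : 0 <= t -> qtrunc t <= t ^+ 2.
Proof. by move=> t0; rewrite expr2 ler_wpM2l// satur_le. Qed.

Lemma ler_qtrunc s t : 0 <= s -> s <= t -> qtrunc s <= qtrunc t.
Proof.
by move=> s0 st; rewrite ler_pM// ?satur_ge0// ler_satur.
Qed.

Lemma qtrunc_scale c t : 1 <= c -> 0 <= t -> qtrunc (c * t) <= c ^+ 2 * qtrunc t.
Proof.
move=> c1 t0; have ct : 0 <= c * t by nra.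
have := ler_wpM2l ct (satur_scale c1 t0); rewrite /qtrunc; congr (_ <= _); ring.
Qed.

(** Lets the sum of the truncated moments of [N] increments be bounded by one truncated moment at
    scale [N]. *)
Lemma qtrunc_superlinear c t : 1 <= c -> 0 <= t -> c * qtrunc t <= qtrunc (c * t).
Proof.
move=> c1 t0; have ct : 0 <= c * t by nra.
by rewrite /qtrunc mulrA (ler_wpM2l ct)// ler_satur//; nra.
Qed.

Lemma qtrunc_tangent s t : 0 <= s -> 0 <= t ->
  qtrunc s + (1 - (1 + s)^-2) * (t - s) <= qtrunc t.
Proof.
by move=> s0 t0; rewrite !qtruncE//; have := satur_tangent s0 t0; lra.
Qed.

(** Midpoint convexity between [2 * s] and [2 * t]: the linear terms of the two tangents at [s + t]
    cancel, and doubling the argument costs a factor 4. *)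
Lemma qtruncD s t : 0 <= s -> 0 <= t -> qtrunc (s + t) <= 2 * (qtrunc s + qtrunc t).
Proof.
move=> s0 t0.
have st0 : 0 <= s + t by lra.
have s20 : 0 <= 2 * s by lra.
have t20 : 0 <= 2 * t by lra.
have h1 := qtrunc_tangent st0 s20; have h2 := qtrunc_tangent st0 t20.
have two : (1 : R) <= 2 by lra.
have h3 := qtrunc_scale two s0; have h4 := qtrunc_scale two t0.
suff : 2 * qtrunc (s + t) <= qtrunc (2 * s) + qtrunc (2 * t) by lra.
set k := 1 - (1 + (s + t))^-2 in h1 h2; nra.
Qed.

(** The constant is 2 from [qtruncD] times 4 from [qtrunc_scale], applied to
    [(x + y)^2 <= 2 x^2 + 2 y^2]. *)
Lemma qtrunc_sqrD x y : qtrunc ((x + y) ^+ 2) <= 8 * (qtrunc (x ^+ 2) + qtrunc (y ^+ 2)).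
Proof.
have two : (1 : R) <= 2 by lra.
have x0 := sqr_ge0 x; have y0 := sqr_ge0 y.
have h : qtrunc ((x + y) ^+ 2) <= qtrunc (2 * x ^+ 2 + 2 * y ^+ 2).
  by apply: ler_qtrunc; [exact: sqr_ge0|have := sqr_ge0 (x - y); nra].
apply: (le_trans h); apply: le_trans (qtruncD _ _) _; [lra|lra|].
have h3 := qtrunc_scale two x0; have h4 := qtrunc_scale two y0; lra.
Qed.

(** A converse to [qtrunc_le] and [qtrunc_le_sqr]: a quantity bounded both by a variance and by a
    multiple of its square, as for a Gaussian variable, is bounded by [qtrunc] of the variance. *)
Lemma qtrunc_min c t : 0 <= c -> 0 <= t ->
  Num.min t (c * t ^+ 2) <= 2 * (1 + c) * qtrunc t.
Proof.
move=> c0 t0; rewrite /qtrunc /satur !mulrA ler_pdivlMr; last lra.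
have [t1|t1] := leP t 1.
  apply: (@le_trans _ _ (c * t ^+ 2 * (1 + t))).
    by rewrite ler_wpM2r ?ge_min ?lexx ?orbT//; lra.
  have : 0 <= c * t ^+ 2 by rewrite mulr_ge0// sqr_ge0.
  rewrite expr2; nra.
apply: (@le_trans _ _ (t * (1 + t))).
  by rewrite ler_wpM2r ?ge_min ?lexx//; lra.
have : 0 <= c * t ^+ 2 by rewrite mulr_ge0// sqr_ge0.
rewrite expr2; nra.
Qed.

(* The coefficient of [y] is the derivative of [x |-> qtrunc (x ^+ 2)]. *)
Lemma qtrunc_sqr_taylor x y :
  qtrunc ((x + y) ^+ 2) <= qtrunc (x ^+ 2) + (2 * x - 2 * x / (1 + x ^+ 2) ^+ 2) * y
    + 16 * (y ^+ 2 * satur (x ^+ 2) + qtrunc (y ^+ 2)).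
Proof.
have x0 := sqr_ge0 x; have y0 := sqr_ge0 y; have s0 := sqr_ge0 (x + y).
pose p := 1 + x ^+ 2; pose r := 1 + (x + y) ^+ 2.
have p1 : 1 <= p by rewrite /p; lra.
have r1 : 1 <= r by rewrite /r; lra.
have two : (1 : R) <= 2 by lra.
(* Exact second-order remainder. It remains to see that the factor of [y ^+ 2] is small when [x] and
   [y] both are. *)
have E : qtrunc ((x + y) ^+ 2) - qtrunc (x ^+ 2) - (2 * x - 2 * x / p ^+ 2) * y
  = y ^+ 2 * (1 + (3 * x ^+ 2 + 2 * x * y - 1) / (p ^+ 2 * r)).
  rewrite /qtrunc /satur /p /r; field.
  by rewrite !gt_eqF //=; lra.
have hs : satur ((x + y) ^+ 2) <= 2 * (satur (x ^+ 2) + satur (y ^+ 2)) * 2.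
  apply: (@le_trans _ _ (satur (2 * (x ^+ 2 + y ^+ 2)))).
    by apply: ler_satur => //; have := sqr_ge0 (x - y); nra.
  apply: le_trans (satur_scale two _) _; first by lra.
  suff : satur (x ^+ 2 + y ^+ 2) <= satur (x ^+ 2) + satur (y ^+ 2).
    by have := satur_ge0 x0; have := satur_ge0 y0; lra.
  rewrite {1}/satur mulrDl lerD// ler_pdivrMr; try lra.
    rewrite /satur mulrAC ler_pdivlMr; nra.
  rewrite /satur mulrAC ler_pdivlMr; nra.
have pr0 : 0 < p ^+ 2 * r by rewrite mulr_gt0// ?exprn_gt0//; lra.
have key : 1 + (3 * x ^+ 2 + 2 * x * y - 1) / (p ^+ 2 * r) <=
    16 * (satur (x ^+ 2) + satur (y ^+ 2)).
  (* Here [p^-1] and [r^-1] are the complements to 1 of [satur (x ^+ 2)] and [satur ((x + y) ^+ 2)]: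
     one minus a product of numbers in [[0, 1]] is at most the sum of their complements. *)
  have a1 : 1 - (p ^+ 2 * r)^-1 <= 2 * satur (x ^+ 2) + satur ((x + y) ^+ 2).
    rewrite /satur -/p -/r -subr_ge0.
    have -> : 2 * (x ^+ 2 / p) + (x + y) ^+ 2 / r - (1 - (p ^+ 2 * r)^-1) =
      (r * (p - 1) ^+ 2 + (p ^+ 2 - 1) * (r - 1)) / (p ^+ 2 * r).
      by rewrite /p /r; field; rewrite !gt_eqF //=; lra.
    rewrite divr_ge0 ?(ltW pr0)// addr_ge0//.
      by rewrite mulr_ge0 ?sqr_ge0//; lra.
    by rewrite mulr_ge0//; nra.
  have a2 : 4 * x ^+ 2 / (p ^+ 2 * r) <= 4 * satur (x ^+ 2).
    rewrite /satur -/p mulrA ler_wpM2l//; first lra.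
    rewrite lef_pV2 ?posrE//; [nra|lra].
  (* As [y = (x + y) - x], the quantity [1 + y ^+ 2] is at most [2 * (p * r)]. *)
  have a3 : y ^+ 2 / (p ^+ 2 * r) <= 2 * satur (y ^+ 2).
    rewrite /satur mulrCA ler_wpM2l// -[2]invrK -invfM lef_pV2 ?posrE; [|lra|lra].
    have : 1 + y ^+ 2 <= 2 * (p * r) by rewrite /p /r; nra.
    have : p * r <= p ^+ 2 * r by nra.
    lra.
  have a4 : (3 * x ^+ 2 + 2 * x * y) / (p ^+ 2 * r) <=
      (4 * x ^+ 2 + y ^+ 2) / (p ^+ 2 * r).
    rewrite ler_wpM2r// ?invr_ge0 ?(ltW pr0)//.
    by have := sqr_ge0 (x - y); nra.
  have := satur_ge0 x0; have := satur_ge0 y0.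
  set Z := (p ^+ 2 * r)^-1 in a1 a2 a3 a4 *; lra.
have := ler_wpM2l y0 key; rewrite -E -/p /qtrunc; lra.
Qed.

(** Split at [|w| = d]: below, the cube is at most [d * w ^+ 2]; above, [satur (w ^+ 2)] is at least
    [d^2 / (1 + d^2)], the inverse of the second constant. *)
Lemma min_sqr_cube (d w : R) : 0 < d ->
  Num.min (w ^+ 2) (`|w| ^+ 3) <= d * w ^+ 2 + (1 + d ^- 2) * qtrunc (w ^+ 2).
Proof.
move=> d0; have w0 := sqr_ge0 w; have q0 := qtrunc_ge0 w0.
have d2 : 0 < d ^- 2 by rewrite invr_gt0 exprn_gt0.
have [wd|wd] := leP `|w| d.
  apply: (@le_trans _ _ (`|w| ^+ 3)); first by rewrite ge_min lexx orbT.
  apply: (@le_trans _ _ (d * w ^+ 2)); last by rewrite lerDl mulr_ge0//; lra.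
  by rewrite exprS real_normK ?num_real// ler_wpM2r.
apply: (@le_trans _ _ (w ^+ 2)); first by rewrite ge_min lexx.
apply: (@le_trans _ _ ((1 + d ^- 2) * qtrunc (w ^+ 2))); last first.
  by rewrite lerDr mulr_ge0// ltW.
rewrite /qtrunc /satur mulrCA ler_peMr// mulrA ler_pdivlMr; last lra.
rewrite mul1r mulrDl mul1r addrC lerD2l mulrC ler_pdivlMr ?exprn_gt0// mul1r.
by rewrite -(real_normK (num_real w)) ler_pXn2r ?nnegrE ?normr_ge0 ?ltW.
Qed.

(** The range of [nu] is that between the two growth rates of [qtrunc (x ^+ 2)]: at most [x^4] near
    0 and at most [x^2] far away. *)
Lemma qtrunc_le_powR (nu x : R) : 2 <= nu -> nu <= 4 -> qtrunc (x ^+ 2) <= `|x| `^ nu.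
Proof.
move=> nu2 nu4; have x0 := sqr_ge0 x.
have E : x ^+ 2 = `|x| ^+ 2 by rewrite real_normK// num_real.
have [x1|x1] := leP `|x| 1.
  apply: le_trans (qtrunc_le_sqr x0) _.
  rewrite E -exprM -powR_mulrn ?normr_ge0//.
  have [->|xn0] := eqVneq `|x| 0; first by rewrite !powR0//; lra.
  by rewrite ger_powR ?normr_ge0 ?x1 ?andbT//= lt_neqAle eq_sym xn0 normr_ge0.
apply: le_trans (qtrunc_le x0) _; rewrite E -powR_mulrn ?normr_ge0//.
by apply: ler_powR => //; exact: ltW.
Qed.

End truncated_square.

(** * Smooth steps *)

Section smooth_step.
Context {R : realType}.
Implicit Types a h w x y : R.

Definition pos_part x := Num.max x 0.

Definition bspline3 (f : R -> R) x := f x - 3 * f (x - 1) + 3 * f (x - 2) - f (x - 3).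

(* The integral of the quadratic B-spline: a C^2 step from 0 to 1 whose second
   derivative is Lipschitz. *)
Definition smooth_step x := bspline3 (fun t => pos_part t ^+ 3) x / 6.
Definition smooth_step1 x := bspline3 (fun t => pos_part t ^+ 2) x / 2.
(** Half of the second derivative, hence the Taylor coefficient of [w ^+ 2]. *)
Definition smooth_step2 x := bspline3 pos_part x / 2.

Lemma pos_part_cases x : (x <= 0 /\ pos_part x = 0) \/ (0 <= x /\ pos_part x = x).
Proof.
rewrite /pos_part; have [h|h] := leP x 0; [left|right]; split => //.
exact: ltW.
Qed.

(** In the four sign patterns of [a] and [a + w] the remainder is 0, [(a + w)^3], [w^3 - (a + w)^3]
    or [w^3]. In the two mixed patterns 0 lies between [a] and [a + w], so [|a + w| <= |w|]. *)
Lemma pos_part_cube_taylor a w :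
  `|pos_part (a + w) ^+ 3 - pos_part a ^+ 3 - 3 * pos_part a ^+ 2 * w
    - 3 * pos_part a * w ^+ 2| <= `|w| ^+ 3.
Proof.
rewrite -normrX.
have [[h1 ->]|[h1 ->]] := pos_part_cases a; have [[h2 ->]|[h2 ->]] := pos_part_cases (a + w).
- by rewrite [leLHS](_ : _ = 0) ?normr_ge0//; apply/eqP; rewrite normr_eq0; apply/eqP; ring.
- have w0 : 0 <= w by lra.
  rewrite [X in `|X|](_ : _ = (a + w) ^+ 3); last by ring.
  rewrite !ger0_norm ?exprn_ge0//.
  by rewrite lerXn2r ?nnegrE//; lra.
- have w0 : 0 <= - w by lra.
  rewrite [X in `|X|](_ : _ = (- (a + w)) ^+ 3 - (- w) ^+ 3); last by ring.
  rewrite -[in leRHS]normrN -[- w ^+ 3](_ : (- w) ^+ 3 = _); last by ring.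
  have : (- (a + w)) ^+ 3 <= (- w) ^+ 3 by rewrite lerXn2r ?nnegrE//; lra.
  have : 0 <= (- (a + w)) ^+ 3 by rewrite exprn_ge0//; lra.
  have : 0 <= (- w) ^+ 3 by rewrite exprn_ge0.
  move=> e1 e2 e3; rewrite (ger0_norm e1) ler0_norm; lra.
- by rewrite [X in `|X|](_ : _ = w ^+ 3)//; ring.
Qed.

(** The weights of [bspline3] have absolute sum 8, divided by 6. *)
Lemma smooth_step_taylor3 a w :
  `|smooth_step (a + w) - smooth_step a - smooth_step1 a * w - smooth_step2 a * w ^+ 2|
    <= 2 * `|w| ^+ 3.
Proof.
have T0 := pos_part_cube_taylor a w.
have T1 := pos_part_cube_taylor (a - 1) w.
have T2 := pos_part_cube_taylor (a - 2) w.
have T3 := pos_part_cube_taylor (a - 3) w.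
rewrite /smooth_step /smooth_step1 /smooth_step2 /bspline3.
rewrite !(addrAC a w).
have := exprn_ge0 3 (normr_ge0 w).
move: T0 T1 T2 T3; set W := `|w| ^+ 3.
rewrite !ler_norml; lra.
Qed.

(** Nonnegativity of the cubic Bernstein polynomials: on each unit interval [smooth_step] and its
    complement to 1 are nonnegative combinations of them, which makes the bounds linear for
    [lra]. *)
Let bernstein3 (t : R) : 0 <= t -> t <= 1 ->
  [/\ 0 <= t ^+ 3, 0 <= t ^+ 2 * (1 - t), 0 <= t * (1 - t) ^+ 2 & 0 <= (1 - t) ^+ 3].
Proof.
move=> t0 t1; have u0 : 0 <= 1 - t by lra.
by split; rewrite ?mulr_ge0 ?exprn_ge0.
Qed.

Lemma smooth_step_bounds x : 0 <= smooth_step x <= 1.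
Proof.
rewrite /smooth_step /bspline3 ler_pdivlMr// ler_pdivrMr// mul0r mul1r.
have [[h0 ->]|[h0 ->]] := pos_part_cases x;
have [[h1 ->]|[h1 ->]] := pos_part_cases (x - 1);
have [[h2 ->]|[h2 ->]] := pos_part_cases (x - 2);
have [[h3 ->]|[h3 ->]] := pos_part_cases (x - 3); try lra.
- have [] := @bernstein3 x; lra.
- have [] := @bernstein3 (x - 1); lra.
- have [] := @bernstein3 (x - 2); lra.
Qed.

Lemma smooth_step_eq0 x : x <= 0 -> smooth_step x = 0.
Proof.
move=> x0; rewrite /smooth_step /bspline3 /pos_part.
by rewrite !max_r; [ring|lra..].
Qed.

Lemma smooth_step_eq1 x : 3 <= x -> smooth_step x = 1.
Proof.
move=> x0; rewrite /smooth_step /bspline3 /pos_part.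
by rewrite !max_l; [field|lra..].
Qed.

Lemma normr_smooth_step1 x : `|smooth_step1 x| <= 1.
Proof.
rewrite /smooth_step1 /bspline3.
have [[h0 ->]|[h0 ->]] := pos_part_cases x;
have [[h1 ->]|[h1 ->]] := pos_part_cases (x - 1);
have [[h2 ->]|[h2 ->]] := pos_part_cases (x - 2);
have [[h3 ->]|[h3 ->]] := pos_part_cases (x - 3); rewrite ler_norml; try lra; try nra.
Qed.

Lemma normr_smooth_step2 x : `|smooth_step2 x| <= 1.
Proof.
rewrite /smooth_step2 /bspline3.
have [[h0 ->]|[h0 ->]] := pos_part_cases x;
have [[h1 ->]|[h1 ->]] := pos_part_cases (x - 1);
have [[h2 ->]|[h2 ->]] := pos_part_cases (x - 2);
have [[h3 ->]|[h3 ->]] := pos_part_cases (x - 3); rewrite ler_norml; try lra; try nra.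
Qed.

End smooth_step.

Section smooth_step_taylor.
Context {R : realType}.
Implicit Types a h w x y : R.

(** For [|w| <= 1] the cubic remainder is the smaller bound. For [|w| > 1] the increment and the two
    Taylor terms are each at most [w ^+ 2]. *)
Lemma smooth_step_taylor a w :
  `|smooth_step (a + w) - smooth_step a - smooth_step1 a * w - smooth_step2 a * w ^+ 2|
    <= 4 * Num.min (w ^+ 2) (`|w| ^+ 3).
Proof.
have T := smooth_step_taylor3 a w.
have W2 : w ^+ 2 = `|w| ^+ 2 by rewrite real_normK ?num_real.
have w0 := normr_ge0 w.
have [w1|w1] := leP `|w| 1.
  have : `|w| ^+ 3 <= w ^+ 2 by rewrite W2 (exprS _ 2) ler_piMl// exprn_ge0.
  by move/min_r => ->; have := exprn_ge0 3 w0; lra.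
have : w ^+ 2 <= `|w| ^+ 3 by rewrite W2 (exprS _ 2) ler_peMl ?exprn_ge0// ltW.
move/min_l => ->.
have h0 : `|smooth_step (a + w) - smooth_step a| <= 1.
  rewrite ler_norml.
  have := smooth_step_bounds (a + w); have := smooth_step_bounds a.
  by move=> /andP[? ?] /andP[? ?]; lra.
have h1 : `|smooth_step1 a * w| <= `|w|.
  by rewrite normrM ler_piMl// normr_smooth_step1.
have h2 : `|smooth_step2 a * w ^+ 2| <= w ^+ 2.
  by rewrite normrM (ger0_norm (sqr_ge0 w)) ler_piMl ?sqr_ge0// normr_smooth_step2.
have h3 : `|w| <= w ^+ 2 by rewrite W2 expr2 ler_peMl// ltW.
move: h0 h1 h2; rewrite !ler_norml => /andP[? ?] /andP[? ?] /andP[? ?]; lra.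
Qed.

(** For increments at most 1 the Taylor bound gives [1 + 1 + 4 = 6]; for larger ones the values in
    [[0, 1]] suffice. *)
Lemma smooth_step_lip x y : `|smooth_step x - smooth_step y| <= 6 * `|x - y|.
Proof.
have T := smooth_step_taylor y (x - y).
rewrite (_ : y + (x - y) = x) in T; last by ring.
set w := x - y in T *; have w0 := normr_ge0 w.
have [w1|w1] := leP `|w| 1; last first.
  rewrite ler_norml.
  have := smooth_step_bounds x; have := smooth_step_bounds y.
  by move=> /andP[? ?] /andP[? ?]; lra.
have W2 : w ^+ 2 = `|w| ^+ 2 by rewrite real_normK ?num_real.
have h1 : `|smooth_step1 y * w| <= `|w|.
  by rewrite normrM ler_piMl// normr_smooth_step1.
have h2 : `|smooth_step2 y * w ^+ 2| <= w ^+ 2.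
  by rewrite normrM (ger0_norm (sqr_ge0 w)) ler_piMl ?sqr_ge0// normr_smooth_step2.
have h3 : w ^+ 2 <= `|w| by rewrite W2 expr2 ler_piMl.
have h4 : Num.min (w ^+ 2) (`|w| ^+ 3) <= w ^+ 2 by rewrite ge_min lexx.
move: T h1 h2; rewrite !ler_norml => /andP[? ?] /andP[? ?] /andP[? ?]; lra.
Qed.

(* [f] admits uniform second-order Taylor expansions; this is all that the
   Lindeberg replacement needs of a test function. *)
Definition taylor2_fun (f : R -> R) (C : R) :=
  exists f1 f2 : R -> R, forall a w,
    `|f (a + w) - f a - f1 a * w - f2 a * w ^+ 2| <= C * Num.min (w ^+ 2) (`|w| ^+ 3).

Definition step_at a h x := smooth_step ((x - a) / h).

Lemma step_at_bounds a h x : 0 <= step_at a h x <= 1.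
Proof. exact: smooth_step_bounds. Qed.

Lemma step_at_lip a h x y : 0 < h ->
  `|step_at a h x - step_at a h y| <= 6 / h * `|x - y|.
Proof.
move=> h0; apply: le_trans (smooth_step_lip _ _) _.
rewrite -mulrBl (_ : x - a - (y - a) = x - y); last by ring.
by rewrite normrM normfV (gtr0_norm h0) mulrA mulrAC.
Qed.

Lemma step_at_taylor2 a h : 0 < h ->
  taylor2_fun (step_at a h) (4 * (h ^- 2 + h ^- 3)).
Proof.
move=> h0; exists (fun x => smooth_step1 ((x - a) / h) / h),
  (fun x => smooth_step2 ((x - a) / h) / h ^+ 2) => x w.
have := smooth_step_taylor ((x - a) / h) (w / h).
rewrite /step_at (_ : (x - a) / h + w / h = (x + w - a) / h); last by field; rewrite gt_eqF.
rewrite [X in `|X| <= _ -> _](_ : _ = smooth_step ((x + w - a) / h) - smooth_step ((x - a) / h) -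
  smooth_step1 ((x - a) / h) / h * w - smooth_step2 ((x - a) / h) / h ^+ 2 * w ^+ 2); last first.
  by field; rewrite gt_eqF.
move=> /le_trans; apply; rewrite -mulrA ler_wpM2l//.
rewrite normrM normfV (gtr0_norm h0) !expr_div_n mulrDl.
have w2 := sqr_ge0 w; have w3 := exprn_ge0 3 (normr_ge0 w).
have hp n : 0 < h ^- n by rewrite invr_gt0 exprn_gt0.
have h2 := hp 2; have h3 := hp 3.
have [c|c] := leP (w ^+ 2) (`|w| ^+ 3).
  apply: (@le_trans _ _ (w ^+ 2 / h ^+ 2)); first by rewrite ge_min lexx.
  nra.
apply: (@le_trans _ _ (`|w| ^+ 3 / h ^+ 3)); first by rewrite ge_min lexx orbT.
nra.
Qed.

Lemma continuous_step_at a h : 0 < h -> continuous (step_at a h).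
Proof.
move=> h0 x; apply/cvgrPdist_le => e e0; near=> y.
apply: le_trans (step_at_lip a _ _ h0) _.
rewrite -ler_pdivlMl ?divr_gt0//; near: y.
exists ((6 / h)^-1 * e) => /=; first by rewrite mulr_gt0 ?invr_gt0 ?divr_gt0.
by move=> y /= /ltW.
Unshelve. all: by end_near. Qed.

Lemma measurable_step_at a h : 0 < h -> measurable_fun setT (step_at a h).
Proof. by move=> h0; apply: continuous_measurable_fun; exact: continuous_step_at. Qed.

End smooth_step_taylor.

(** * Convergence in law *)

Section bounded_integrals.
Context {R : realType} {d} {T : measurableType d} (mu : probability T R).

Lemma bounded_integrable (f : T -> R) (M : R) :
  measurable_fun setT f -> (forall x, `|f x| <= M) -> mu.-integrable setT (EFin \o f).
Proof.
move=> mf fM; apply: measurable_bounded_integrable => //.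
  by rewrite (le_lt_trans (probability_le1 mu measurableT))// ltry.
by exists M; split => [|x Mx y _ /=]; [exact: num_real|exact: le_trans (fM y) (ltW Mx)].
Qed.

Implicit Types f g : T -> R.

Lemma integrableZlR (c : R) f : mu.-integrable setT (EFin \o f) ->
  mu.-integrable setT (EFin \o (fun x => c * f x)).
Proof. by move=> fi; exact: (integrableZl measurableT c fi). Qed.

Lemma integrableDR f g : mu.-integrable setT (EFin \o f) ->
  mu.-integrable setT (EFin \o g) -> mu.-integrable setT (EFin \o (fun x => f x + g x)).
Proof. by move=> fi gi; exact: (integrableD measurableT fi gi). Qed.

Lemma integrableBR f g : mu.-integrable setT (EFin \o f) ->
  mu.-integrable setT (EFin \o g) -> mu.-integrable setT (EFin \o (fun x => f x - g x)).
Proof. by move=> fi gi; exact: (integrableB measurableT fi gi). Qed.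

Lemma integrable_cstR (c : R) : mu.-integrable setT (EFin \o (fun=> c)).
Proof. exact: (@finite_measure_integrable_cst _ _ _ mu setT c measurableT). Qed.

Lemma Rintegral_cstT (c : R) : \int[mu]_x (c : R) = c.
Proof.
by rewrite [LHS](Rintegral_cst mu measurableT c) /= probability_setT mulr1.
Qed.

Lemma le_integrableR f g : measurable_fun setT f ->
  (forall x, `|f x| <= g x) -> mu.-integrable setT (EFin \o g) ->
  mu.-integrable setT (EFin \o f).
Proof.
move=> mf fg; apply: le_integrable => //; first exact/measurable_EFinP.
by move=> x _ /=; rewrite lee_fin (le_trans (fg x))// ler_norm.
Qed.

Lemma EFin_Rintegral (f : T -> R) : mu.-integrable setT (EFin \o f) ->
  (\int[mu]_x f x)%:E = (\int[mu]_x (f x)%:E)%E.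
Proof. by move=> fi; rewrite fineK//; exact: integrable_fin_num. Qed.

Lemma integrable_EFin_sum (I : Type) (s : seq I) (f : I -> T -> R) :
  (forall i, mu.-integrable setT (EFin \o f i)) ->
  mu.-integrable setT (EFin \o (fun x => \sum_(i <- s) f i x)).
Proof.
move=> fi; elim: s => [|i s IH].
  apply: (eq_integrable measurableT (cst 0%E)); last exact: integrable0.
  by move=> x _ /=; rewrite big_nil.
apply: (eq_integrable measurableT _ _ _ (integrableD measurableT (fi i) IH)).
by move=> x _ /=; rewrite big_cons.
Qed.

Lemma Rintegral_sum (I : Type) (s : seq I) (f : I -> T -> R) :
  (forall i, mu.-integrable setT (EFin \o f i)) ->
  \int[mu]_x (\sum_(i <- s) f i x) = \sum_(i <- s) \int[mu]_x f i x.
Proof.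
move=> fi; elim: s => [|i s IH].
  under eq_Rintegral do rewrite big_nil.
  by rewrite big_nil Rintegral_cst// mul0r.
under eq_Rintegral do rewrite big_cons.
by rewrite big_cons RintegralD ?IH//; exact: integrable_EFin_sum.
Qed.

End bounded_integrals.

Section portmanteau.
Context {R : realType}.
Implicit Types (nu : probability R R) (f : R -> R).

Let cvg_for (mu : nat -> probability R R) nu f :=
  (\int[mu n]_x f x) @[n --> \oo] --> (\int[nu]_x f x).

(** Uniform continuity with only the first point confined to the compact interval. Compactness is
    applied as a covering property against the filter of small positive radii. *)
Let continuous_unif f (A e : R) : continuous f -> 0 < e ->
  exists2 g, 0 < g & forall x y, `|x| <= A -> `|x - y| <= g -> `|f x - f y| <= e.
Proof.
move=> cf e0; have A0 := @segment_compact R (- A) A.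
have /compact_near_coveringP/(_ R 0^'+ (fun g x => forall y, `|x - y| <= g ->
    `|f x - f y| <= e)) := A0.
have H x : `[- A, A]%classic x -> \forall x' \near x & g \near 0^'+,
    forall y, `|x' - y| <= g -> `|f x' - f y| <= e.
  move=> _; have e2 : 0 < e / 2 by rewrite divr_gt0.
  have /cvgrPdist_le/(_ _ e2) := cf x; rewrite -filter_from_ballE => -[r r0 Hr].
  have r2 : 0 < r / 2 by rewrite divr_gt0.
  exists (ball x (r / 2), [set g | g < r / 2]) => /=.
    split; first exact: nbhsx_ballx.
    exact: nbhs_right_lt.
  move=> [x' g] /= [Bx' gr] y xy.
  have hx' := Hr x'; have hy := Hr y; rewrite /ball/= in Bx' hx' hy.
  have b1 : `|x - x'| < r by lra.
  have b2 : `|x - y| < r.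
    by have := ler_distD x' x y; lra.
  have := hx' b1; have := hy b2; rewrite distrC => h1 h2.
  rewrite distrC; have := ler_distD (f x) (f y) (f x'); lra.
move=> /(_ _ H); rewrite /= => N.
near (0 : R)^'+ => g; exists g => // x y xA; apply: (near N g) => //=.
by rewrite in_itv/= -ler_norml.
Unshelve. all: by end_near. Qed.

(** Tightness of a single law, by continuity from below. It is invoked for the limit only; the
    converging laws inherit it through the test functions. *)
Let tight nu (e : R) : 0 < e ->
  exists2 A : R, 0 <= A & (nu (~` `[(- A)%R, A]%classic) <= e%:E)%E.
Proof.
move=> e0; pose F n : set R := `[- n%:R, n%:R]%classic.
have mF n : measurable (F n) by exact: measurable_itv.
have FT : \bigcup_n F n = setT.
  rewrite -subTset => x _; exists (Num.truncn `|x|).+1 => //.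
  by rewrite /F/= in_itv/= -ler_norml ltW// truncnS_gt.
have : nu (F n) @[n --> \oo] --> nu (\bigcup_n F n).
  apply: nondecreasing_cvg_mu => //; first exact: bigcup_measurable.
  move=> n m nm; apply/subsetPset => x; rewrite /F/= !in_itv/= -!ler_norml => /le_trans.
  by apply; rewrite ler_nat.
rewrite FT probability_setT => /fine_cvgP[_] /cvgrPdist_le/(_ e e0)[n _ /(_ n (leqnn n))] /=.
move=> h; exists n%:R => //.
rewrite probability_setC// -[nu _]fineK ?fin_num_measure// -EFinB lee_fin.
by apply: le_trans h; exact: ler_norm.
Qed.

Let integrable_step (m : probability R R) a h : 0 < h ->
  m.-integrable setT (EFin \o step_at a h).
Proof.
move=> h0; apply: (@bounded_integrable _ _ _ _ _ 1); first exact: measurable_step_at.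
by move=> x; have /andP[? ?] := step_at_bounds a h x; rewrite ger0_norm.
Qed.

Let integrable_bump (m : probability R R) a b h c : 0 < h ->
  m.-integrable setT (EFin \o (fun x => c * (step_at a h x - step_at b h x))).
Proof.
move=> h0; exact: (integrableZlR c (integrableBR (integrable_step m a h0) (integrable_step m b h0))).
Qed.

Let cvg_bumps (mu : nat -> probability R R) nu (c b : nat -> R) (h : R) n :
  0 < h ->
  (forall a, cvg_for mu nu (step_at a h)) ->
  cvg_for mu nu (fun x => \sum_(i < n) c i * (step_at (b i) h x - step_at (b i.+1) h x)).
Proof.
move=> h0 H.
have ib m a := @integrable_step m a h h0.
have E (m : probability R R) :
    \int[m]_x (\sum_(i < n) c i * (step_at (b i) h x - step_at (b i.+1) h x)) =
    \sum_(i < n) c i * (\int[m]_x step_at (b i) h x - \int[m]_x step_at (b i.+1) h x).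
  rewrite Rintegral_sum; last by move=> i; exact: integrable_bump.
  apply: eq_bigr => i _; rewrite -(RintegralB measurableT (ib m _) (ib m _)).
  exact: (RintegralZl _ measurableT (integrableBR (ib m _) (ib m _))).
rewrite /cvg_for E; under eq_fun do rewrite E.
apply: (@cvg_big R _ +%R 0) => // [|i _]; [exact: add_continuous|].
by apply: cvgMl_tmp; apply: cvgB; exact: H.
Qed.

(** Differences of consecutive steps on a fine grid form a partition of unity on a large interval. A
    bounded continuous [f] is close there to the combination [fh] of these bumps weighted by its
    grid values, and the mass outside is measured by [1 - W], itself built from steps, so both
    integrals converge by hypothesis. *)
Lemma cvg_in_law_step_at (mu : nat -> probability R R) nu :
  (forall a h, 0 < h -> (\int[mu n]_x step_at a h x) @[n --> \oo] -->
                        (\int[nu]_x step_at a h x)) ->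
  cvg_in_law mu nu.
Proof.
move=> H f cf [M0 [_ /(_ (`|M0| + 1))]].
rewrite (lt_le_trans (ltr_pwDr ltr01 (ler_norm M0)))//= => /(_ isT) bf.
set M := `|M0| + 1 in bf; have M1 : 0 < M by rewrite ltr_wpDl.
have fM x : `|f x| <= M by exact: bf.
have mf : measurable_fun setT f by exact: continuous_measurable_fun.
have fi (m : probability R R) := bounded_integrable m mf fM.
rewrite -EFin_Rintegral//; under eq_fun do rewrite -EFin_Rintegral//.
apply: cvg_EFin; first exact: nearW.
suff : cvg_for mu nu f by [].
apply/cvgrPdist_le => e e0.
have e8 : 0 < e / 8 by rewrite divr_gt0.
have e8M : 0 < e / 8 / M by rewrite divr_gt0.
have [A A0 nuA] := tight nu e8M.
have [g g0 fg] := continuous_unif (A + 1) cf e8.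
pose g' := Num.min (g / 2) 1.
have g'0 : 0 < g' by rewrite lt_min divr_gt0/=.
have g'1 : g' <= 1 by rewrite ge_min lexx orbT.
have g'2 : g' + g' <= g.
  have : g' <= g / 2 by rewrite ge_min lexx.
  lra.
(* A step rises from 0 to 1 over a length [3 * h], so the one at [b i] is complete exactly when the
   next one starts. *)
pose h := g' / 3; have h0 : 0 < h by rewrite divr_gt0.
(* The grid starts one mesh before [- A] and ends between [A] and [A + 1]. *)
pose N := (Num.truncn ((2 * A + g') / g')).+1.
pose b (i : nat) : R := - A - g' + i%:R * g'.
have bS i : b i.+1 = b i + g' by rewrite /b -natr1; ring.
have bN1 : A <= b N.
  have := truncnS_gt ((2 * A + g') / g').
  rewrite ltr_pdivrMr// -/N /b; lra.
have bN2 : b N <= A + 1.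
  have : (Num.truncn ((2 * A + g') / g'))%:R <= (2 * A + g') / g'.
    by rewrite truncn_le// divr_ge0//; lra.
  rewrite ler_pdivlMr// /N bS /b; lra.
have nb i j : (i <= j)%N -> b i <= b j.
  by move=> ij; rewrite /b lerD2l ler_pM2r// ler_nat.
have bB i : (i < N)%N -> `|b i| <= A + 1.
  move=> iN; rewrite ler_norml; apply/andP; split.
    have := nb 0 i (leq0n _); rewrite {1}/b mul0r; lra.
  exact: le_trans (nb _ _ (ltnW iN)) _.
pose w i x := step_at (b i) h x - step_at (b i.+1) h x.
have s0 i x : x <= b i -> step_at (b i) h x = 0.
  move=> xb; apply: smooth_step_eq0.
  by rewrite pmulr_lle0 ?invr_gt0//; lra.
have s1 i x : b i.+1 <= x -> step_at (b i) h x = 1.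
  rewrite bS => xb; apply: smooth_step_eq1.
  by rewrite ler_pdivlMr// /h; lra.
have w0 i x : 0 <= w i x.
  rewrite /w; have [xb|xb] := leP x (b i.+1).
    by rewrite (s0 _ _ xb) subr0; case/andP: (step_at_bounds (b i) h x).
  rewrite (s1 _ _ (ltW xb)) subr_ge0; case/andP: (step_at_bounds (b i.+1) h x) => //.
have wsupp i x : w i x != 0 -> `|b i - x| <= g.
  move=> wx; rewrite ler_norml.
  have [xb|xb] := leP x (b i).
    move: wx; rewrite /w !s0 ?subrr ?eqxx//.
    by rewrite (le_trans xb)// nb.
  have [xb2|xb2] := leP (b i.+2) x.
    move: wx; rewrite /w !s1 ?subrr ?eqxx//.
    by rewrite (le_trans _ xb2)// nb.
  rewrite !bS in xb2; apply/andP; split; lra.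
(* The factor 1 gives [W] the shape required by [cvg_bumps], with constant coefficients. *)
pose W x := \sum_(i < N) 1 * w i x.
pose fh x := \sum_(i < N) f (b i) * w i x.
have WE x : W x = step_at (b 0) h x - step_at (b N) h x.
  rewrite /W; under eq_bigr do rewrite mul1r.
  rewrite -(big_mkord xpredT (fun i => w i x)) -[RHS]opprB.
  rewrite -(telescope_sumr (fun i => step_at (b i) h x) (leq0n N)).
  by rewrite -sumrN; apply: eq_bigr => i _; rewrite opprB.
have W1 x : 0 <= 1 - W x.
  rewrite WE; case/andP: (step_at_bounds (b 0) h x) => ? ?.
  case/andP: (step_at_bounds (b N) h x) => ? ?; lra.
have WA x : `|x| <= A -> W x = 1.
  rewrite ler_norml => /andP[x1 x2]; rewrite WE s1; last first.
    by rewrite bS /b mul0r; lra.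
  by rewrite s0 ?subr0//; lra.
have ffh x : `|f x - fh x| <= e / 8 + M * (1 - W x).
  have -> : f x - fh x = \sum_(i < N) (f x - f (b i)) * w i x + f x * (1 - W x).
    rewrite mulrBr mulr1 /W /fh mulr_sumr addrCA; congr (_ + _).
    by rewrite -!sumrB -sumrN; apply: eq_bigr => i _; ring.
  apply: le_trans (ler_normD _ _) _; rewrite lerD//; last first.
    by rewrite normrM (ger0_norm (W1 x)) ler_wpM2r.
  apply: le_trans (ler_norm_sum _ _ _) _.
  apply: (@le_trans _ _ (\sum_(i < N) e / 8 * (1 * w i x))).
    apply: ler_sum => i _; rewrite mul1r normrM (ger0_norm (w0 _ _)).
    have [->|wn0] := eqVneq (w i x) 0; first by rewrite !mulr0.
    rewrite ler_wpM2r// distrC; apply: fg; first exact: bB.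
    exact: wsupp.
  rewrite -mulr_sumr ler_piMr ?(ltW e8)//; have := W1 x; rewrite /W; lra.
have iW (m : probability R R) : m.-integrable setT (EFin \o W).
  by apply: integrable_EFin_sum => i; exact: integrable_bump.
have ifh (m : probability R R) : m.-integrable setT (EFin \o fh).
  by apply: integrable_EFin_sum => i; exact: integrable_bump.
have i1 (m : probability R R) : m.-integrable setT (EFin \o (fun=> 1)).
  by apply: (@bounded_integrable _ _ _ _ _ 1) => // x; rewrite normr1.
have i1W (m : probability R R) : m.-integrable setT (EFin \o (fun x => 1 - W x)).
  exact: (integrableBR (i1 m) (iW m)).
have I1 (m : probability R R) : \int[m]_x (1 - W x) = 1 - \int[m]_x W x.
  by rewrite (RintegralB measurableT (i1 m) (iW m)) Rintegral_cstT.
have If (m : probability R R) :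
    `|\int[m]_x f x - \int[m]_x fh x| <= e / 8 + M * (1 - \int[m]_x W x).
  rewrite -(RintegralB measurableT (fi m) (ifh m)).
  have i2 := integrableBR (fi m) (ifh m).
  apply: le_trans (le_normr_Rintegral measurableT i2) _.
  have i3 := integrableZlR M (i1W m).
  rewrite -I1 -(RintegralZl _ measurableT (i1W m)) -{1}[e / 8](Rintegral_cstT m).
  rewrite -(RintegralD measurableT (integrable_cstR m (e / 8)) i3).
  apply: le_Rintegral => //.
  - exact: (integrable_norm i2).
  - exact: (integrableDR (integrable_cstR m (e / 8)) i3).
have nuW : 1 - \int[nu]_x W x <= e / 8 / M.
  rewrite -I1 -lee_fin; apply: le_trans nuA; rewrite EFin_Rintegral//.
  have mA : measurable (~` `[- A, A]%classic : set R) by exact: measurableC.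
  rewrite -[X in (_ <= nu X)%E]setIT -integral_indic//.
  apply: ge0_le_integral => //.
  - by move=> x _; rewrite lee_fin.
  - by have /integrableP[] := i1W nu.
  - exact/measurable_EFinP/measurable_indic.
  move=> x _; rewrite lee_fin indicE.
  have [|/negP xA] := boolP (x \in ~` _).
    by rewrite lerBlDr lerDl sumr_ge0// => i _; rewrite mul1r.
  rewrite WA ?subrr// leNgt; apply/negP => Ax; apply: xA.
  by rewrite inE /= in_itv/= -ler_norml leNgt Ax.
have cW := @cvg_bumps mu nu (fun=> 1) b h N h0 (fun a => H a h h0).
have cf' := @cvg_bumps mu nu (f \o b) b h N h0 (fun a => H a h h0).
move/cvgrPdist_le/(_ _ e8M) : cW => cW.
move/cvgrPdist_le/(_ _ e8) : cf' => cf'.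
near=> n.
have h1 : `|\int[nu]_x W x - \int[mu n]_x W x| <= e / 8 / M by near: n.
have h2 : `|\int[nu]_x fh x - \int[mu n]_x fh x| <= e / 8 by near: n.
have h3 := If nu; have h4 := If (mu n).
have h5 : M * (1 - \int[nu]_x W x) <= e / 8 by rewrite -ler_pdivlMl// mulrC.
(* The mass of the approximating law outside the interval is controlled here, through the
   convergence of the integrals of [W]. *)
have h6 : M * (1 - \int[mu n]_x W x) <= e / 8 + e / 8.
  rewrite -ler_pdivlMl// mulrC mulrDl.
  by move: h1; rewrite ler_norml => /andP[? ?]; lra.
by move: h2 h3 h4; rewrite !ler_norml => /andP[? ?] /andP[? ?] /andP[? ?]; lra.
Unshelve. all: by end_near. Qed.
End portmanteau.

(** * Square roots of positive semidefinite matrices *)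

Section interpolation.
(** Newton's scheme: a new node is handled by adding a multiple of the polynomial vanishing at the
    previous ones, which is nonzero at the new node by [uniq]. *)
Lemma interpolation (F : fieldType) (s : seq F) (g : F -> F) : uniq s ->
  exists p : {poly F}, forall x, x \in s -> p.[x] = g x.
Proof.
elim: s => [_|y s IH /= /andP[ys /IH[p Hp]]]; first by exists 0.
pose r : {poly F} := \prod_(z <- s) ('X - z%:P).
have ry : r.[y] != 0 by rewrite -[_ == _]/(root r y) root_prod_XsubC.
exists (p + ((g y - p.[y]) / r.[y])%:P * r) => x.
rewrite inE => /orP[/eqP->|xs]; first by rewrite !hornerE divfK// addrC subrK.
have /eqP rx : root r x by rewrite root_prod_XsubC.
by rewrite !hornerE rx mulr0 addr0 Hp.
Qed.
End interpolation.

Lemma horner_mx_diagonalized (F : fieldType) n (M U : 'M[F]_n.+1) (D : 'rV[F]_n.+1)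
    (q : {poly F}) : U \in unitmx -> M = invmx U *m diag_mx D *m U ->
  horner_mx M q = invmx U *m diag_mx (map_mx (horner q) D) *m U.
Proof. by move=> Uu ->; rewrite horner_mx_uconjC// horner_mx_diag. Qed.

Section psd_square_root.
Context {R : realType}.
Local Notation C := (R[i])%C.
Local Notation toC := (real_complex R).
Local Open Scope sesquilinear_scope.

Let conj_toC (x : R) : (toC x)^* = toC x.
Proof. exact: conjc_real. Qed.

Let conj_map_toC m n (A : 'M[R]_(m, n)) : map_mx Num.conj (map_mx toC A) = map_mx toC A.
Proof. by apply/matrixP => i j; rewrite !mxE conj_toC. Qed.

(** For real symmetric [S] the cross terms between real and imaginary parts cancel, so Hermitian
    values of [S] are real, and nonnegative when [S] is positive semidefinite. This serves to locate
    the eigenvalues. *)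
Let quad_toC n (S : 'M[R]_n) (x : 'rV[C]_n) : S^T = S ->
  exists a b : 'rV[R]_n,
    x *m map_mx toC S *m x ^t* = map_mx toC (a *m S *m a^T + b *m S *m b^T).
Proof.
move=> symS; exists (map_mx (@complex.Re R) x), (map_mx (@complex.Im R) x).
set a := map_mx _ x; set b := map_mx _ x.
pose I : C := 'i.
have xE : x = map_mx toC a + I *: map_mx toC b.
  by apply/matrixP => i j; rewrite !mxE; exact: complexE.
have xE' : x ^t* = map_mx toC a^T - I *: map_mx toC b^T.
  rewrite {1}xE linearD/= linearZ/= map_mxD map_mxZ/=.
  rewrite -!map_trmx !conj_map_toC.
  by rewrite conjCi scaleNr.
rewrite xE' xE.
have sab : b *m S *m a^T = a *m S *m b^T.
  rewrite -[RHS](_ : (a *m S *m b^T)^T = _); last first.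
    by rewrite [a *m S *m b^T]mx11_scalar tr_scalar_mx.
  by rewrite !trmx_mul trmxK symS mulmxA.
rewrite !mulmxDl !mulmxBr !map_mxD !map_mxM/= -!scalemxAl -!scalemxAr scalerA.
rewrite -!map_mxM/= sab.
rewrite (_ : I * I = - 1); last by rewrite -expr2 sqrCi.
by rewrite scaleN1r opprK addrA subrK.
Qed.

Let toC_inj m n : injective (@map_mx _ _ toC m n).
Proof. by apply: map_mx_inj; exact: complexI. Qed.

Let psd_row n (S : 'M[R]_n) (a : 'rV[R]_n) : psd S -> 0 <= (a *m S *m a^T) 0 0.
Proof. by move=> [_ /(_ a^T)]; rewrite trmxK. Qed.

(** A witness suffices, as [psd_sqrt] is an [xget]. The eigenvalues are the values of the Hermitian
    form of [S] at the rows of the unitary matrix of its diagonalization over [R[i]], hence real and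
    nonnegative, and the root is obtained by taking their square roots. *)
Lemma psd_sqrtP n (S : 'M[R]_n.+1) : psd S -> psd (psd_sqrt S) /\ psd_sqrt S *m psd_sqrt S = S.
Proof.
move=> Spsd; apply: (@xgetPex _ 0 [set A | psd A /\ A *m A = S]).
have [symS _] := Spsd.
pose Sc := map_mx toC S.
have ScE : Sc ^t* = Sc by rewrite /Sc map_trmx symS conj_map_toC.
have /orthomx_spectralP ScD : Sc \is normalmx by apply/normalmxP; rewrite ScE.
move: ScD; set U := spectralmx Sc; set D := spectral_diag Sc => ScD.
have Uu : U \is unitarymx by exact: spectral_unitarymx.
have Uunit := unitarymx_unit Uu; have UV := invmx_unitary Uu.
have DE : diag_mx D = U *m Sc *m U ^t*.
  by rewrite ScD -UV !mulmxA mulmxV// mul1mx -mulmxA mulmxV// mulmx1.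
have [dd Dd] : exists dd : 'I_n.+1 -> R, forall k, 0 <= dd k /\ D 0 k = toC (dd k).
  suff H k : exists x : R, 0 <= x /\ D 0 k = toC x.
    by exists (fun k => projT1 (cid (H k))) => k; case: cid.
  have [a [b E]] := quad_toC (row k U) symS.
  exists ((a *m S *m a^T + b *m S *m b^T) 0 0); split.
    by rewrite mxE addr_ge0//; exact: psd_row.
  have -> : D 0 k = diag_mx D k k by rewrite mxE eqxx mulr1n.
  rewrite DE; have := congr1 (fun M : 'M[C]_1 => M 0 0) E.
  rewrite [in RHS]mxE => <-.
  rewrite -row_mul tr_row map_col.
  by rewrite !mxE; apply: eq_bigr => j _; rewrite !mxE.
(* The root is a real polynomial in [S]: this makes it real, although [S] is diagonalized
   over [R[i]]. *)
have [p Hp] := @interpolation R (undup [seq dd k | k : 'I_n.+1]) Num.sqrt (undup_uniq _).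
have pd k : p.[dd k] = Num.sqrt (dd k).
  by apply: Hp; rewrite mem_undup; apply/mapP; exists k; rewrite ?mem_enum.
exists (horner_mx S p).
pose sd : 'rV[C]_n.+1 := \row_k toC (Num.sqrt (dd k)).
have AE : map_mx toC (horner_mx S p) = U ^t* *m diag_mx sd *m U.
  rewrite map_horner_mx -/Sc (horner_mx_diagonalized _ Uunit ScD) UV.
  have -> : map_mx (horner (map_poly toC p)) D = sd; last by [].
  by apply/rowP => k; rewrite mxE (Dd k).2 [RHS]mxE horner_map pd.
have sdC : map_mx Num.conj sd = sd.
  by apply/rowP => k; rewrite !mxE conj_toC.
have symA : (horner_mx S p)^T = horner_mx S p.
  apply: toC_inj; rewrite -[LHS]conj_map_toC -map_trmx AE.
  rewrite !trmx_mul !map_mxM tr_diag_mx map_diag_mx sdC mulmxA.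
  congr (_ *m _); rewrite -map_trmx trmxK -map_mx_comp map_mx_id// => x.
  exact: conjCK.
split; first split => //.
- move=> v; rewrite -lecR.
  pose w := U *m map_mx toC v.
  have -> : (toC ((v^T *m horner_mx S p *m v) 0 0)) = (w ^t* *m diag_mx sd *m w) 0 0.
    have -> : toC ((v^T *m horner_mx S p *m v) 0 0) =
        (map_mx toC (v^T *m horner_mx S p *m v)) 0 0 by rewrite [RHS]mxE.
    congr (fun_of_matrix _ 0 0).
    have vE : (map_mx toC v) ^t* = map_mx toC v^T by rewrite map_trmx conj_map_toC.
    have wE : w ^t* = map_mx toC v^T *m U ^t* by rewrite /w trmx_mul map_mxM vE.
    by rewrite map_mxM map_mxM AE wE /w !mulmxA.
  rewrite mxE sumr_ge0// => k _.
  rewrite mul_mx_diag !mxE -mulrA mulrC -mulrA mulr_ge0//.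
    by rewrite lecR sqrtr_ge0.
  by rewrite mul_conjC_ge0.
- apply: toC_inj; transitivity (invmx U *m diag_mx D *m U); last exact: esym ScD.
  rewrite map_mxM AE -UV !mulmxA (mulmxK Uunit).
  congr (_ *m _); rewrite -!mulmxA; congr (_ *m _); rewrite mulmx_diag; congr diag_mx.
  apply/rowP => k; rewrite !mxE (Dd k).2 -rmorphM -expr2 sqr_sqrtr//.
  by have [] := Dd k.
Qed.

End psd_square_root.

(** * Gaussian integrals *)

Section density.
Context {R : realType} {d} {T : measurableType d}.
Variables (mu nu : {measure set T -> \bar R}) (g : T -> R).
Hypotheses (mg : measurable_fun setT g) (g0 : forall x, 0 <= g x).
Hypothesis nuE : forall A, measurable A -> nu A = (\int[mu]_(x in A) (g x)%:E)%E.

Let mgE : measurable_fun setT (EFin \o g).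
Proof. exact/measurable_EFinP. Qed.

Let density_indic A : measurable A ->
  (\int[nu]_x (\1_A x)%:E = \int[mu]_x ((\1_A x)%:E * (g x)%:E))%E.
Proof.
move=> mA; rewrite integral_indic//= setIT nuE// [LHS]integral_mkcond.
apply: eq_integral => x _; rewrite patchE indicE.
by case: ifPn => // xA; rewrite ?mul1e ?mul0e.
Qed.

Import HBNNSimple.

Let density_nnsfun (f : {nnsfun T >-> R}) :
  (\int[nu]_x (f x)%:E = \int[mu]_x ((f x)%:E * (g x)%:E))%E.
Proof.
under [LHS]eq_integral do rewrite fimfunE -fsumEFin//.
rewrite [LHS]ge0_integral_fsum//; last 2 first.
  - by move=> r; exact/measurable_EFinP/measurableT_comp.
  - by move=> n x _; rewrite EFinM nnfun_muleindic_ge0.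
under [RHS]eq_integral.
  move=> x xD; rewrite fimfunE -fsumEFin// ge0_mule_fsuml; last first.
    by move=> r; rewrite EFinM nnfun_muleindic_ge0.
  over.
rewrite [RHS]ge0_integral_fsum//; last 2 first.
  - move=> r; apply: emeasurable_funM => //.
    by apply/measurable_EFinP; do 2 apply/measurableT_comp => //.
  - move=> n x _; rewrite EFinM mule_ge0//; last by rewrite lee_fin.
    by rewrite nnfun_muleindic_ge0.
apply: eq_fsbigr => r rf.
have r0 : (0 <= r)%R.
  by move: rf; rewrite inE => -[x _ <-].
under eq_integral do rewrite EFinM.
under [RHS]eq_integral do rewrite EFinM -muleA.
rewrite ge0_integralZl_EFin//; last first.
  by apply/measurable_EFinP; exact: measurable_indic.
rewrite density_indic// ge0_integralZl_EFin//.
- by move=> x _; rewrite mule_ge0// lee_fin.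
- by apply: emeasurable_funM => //; exact/measurable_EFinP/measurable_indic.
Qed.

Lemma ge0_integral_density (f : T -> \bar R) :
  measurable_fun setT f -> (forall x, 0 <= f x)%E ->
  (\int[nu]_x f x = \int[mu]_x (f x * (g x)%:E))%E.
Proof.
move=> mf f0.
pose f_ := nnsfun_approx measurableT mf.
have nd x : {homo f_^~ x : n m / (n <= m)%N >-> n <= m}.
  by move=> m n mn; exact/lefP/nd_nnsfun_approx.
transitivity (lim (\int[nu]_x (f_ n x)%:E @[n --> \oo])%E).
  rewrite -monotone_convergence//=.
  - apply: eq_integral => ? /[!inE] xD; apply/esym/cvg_lim => //=.
    exact: cvg_nnsfun_approx.
  - by move=> n; exact/measurable_EFinP/measurable_funTS.
  - by move=> n ? _; rewrite lee_fin.
  - by move=> ? _ ? ? mn; rewrite lee_fin nd.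
transitivity (lim (\int[mu]_x ((f_ n x)%:E * (g x)%:E) @[n --> \oo])%E).
  by apply: congr_lim; apply/funext => n /=; exact: density_nnsfun.
rewrite -monotone_convergence//=.
- apply: eq_integral => x /[!inE] xD; apply/cvg_lim => //.
  under eq_fun do rewrite muleC; rewrite muleC.
  by apply: cvgeZl => //; exact: cvg_nnsfun_approx.
- by move=> n; apply: emeasurable_funM => //; exact/measurable_EFinP/measurable_funTS.
- by move=> n x _; rewrite mule_ge0// lee_fin.
- by move=> x _ m n mn; rewrite lee_wpmul2r ?lee_fin// nd.
Qed.

End density.

Section normal_moments.
Context {R : realType}.

(* [normal_prob] lives on the measurable type generated by half-open intervals, which
   has the same measurable sets as [R] but is a different canonical structure. *)
Definition to_real (x : measurableTypeR R) : R := x.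

Lemma measurable_to_real : measurable_fun setT to_real.
Proof. by move=> _ A mA; rewrite setTI. Qed.

HB.instance Definition _ := isMeasurableFun.Build _ _ _ _ to_real measurable_to_real.

Definition std_normal : probability R R :=
  distribution (normal_prob 0 1 : probability (measurableTypeR R) R) to_real.
Local Notation N01 := std_normal.

Lemma integral_normal_prob (f : R -> \bar R) :
  measurable_fun setT f -> (forall x, 0 <= f x)%E ->
  (\int[N01]_x f x = \int[lebesgue_measure]_x (f x * (normal_pdf 0 1 x)%:E))%E.
Proof.
move=> mf f0; rewrite ge0_integral_distribution//.
apply: ge0_integral_density => //; first exact: measurable_normal_pdf.
by move=> x; exact: normal_pdf_ge0.
Qed.

(** Exponential tilting. The moment generating function is then read off from the total mass 1 of
    the shifted density; [normal_pdfZ] plays the same role for changes of variance. *)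
Let normal_pdfM m x :
  normal_pdf m 1 x = expR (m * x - m ^+ 2 / 2) * normal_pdf 0 (1 : R) x.
Proof.
rewrite !normal_pdfE// mulrCA; congr (_ * _); rewrite /normal_fun -expRD; congr expR.
by field.
Qed.

Let normal_pdfZ s x : 0 < s ->
  normal_pdf 0 s x = expR (- ((s ^- 2 - 1) * x ^+ 2 / 2)) / s * normal_pdf 0 (1 : R) x.
Proof.
move=> s0; rewrite !normal_pdfE ?gt_eqF//.
have -> : normal_peak s = s^-1 * normal_peak (1 : R).
  rewrite /normal_peak -mulrnAr sqrtrM ?sqr_ge0// sqrtr_sqr gtr0_norm//.
  by rewrite expr1n mul1r invfM.
have -> : normal_fun 0 s x = expR (- ((s ^- 2 - 1) * x ^+ 2 / 2)) * normal_fun 0 1 x.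
  by rewrite /normal_fun -expRD; congr expR; field; rewrite gt_eqF.
by field; rewrite gt_eqF.
Qed.

Let mexp (f : R -> R) : measurable_fun setT f ->
  measurable_fun setT (fun x => (expR (f x))%:E).
Proof. by move=> mf; apply/measurable_EFinP; exact: measurableT_comp. Qed.

Let integral_scaled_pdf (m s k : R) : 0 <= k ->
  (\int[lebesgue_measure]_x (k%:E * (normal_pdf m s x)%:E) = k%:E)%E.
Proof.
move=> k0.
have mpdf : measurable_fun setT (EFin \o normal_pdf m s).
  by apply/measurable_EFinP; exact: measurable_normal_pdf.
have pdf0 x : setT x -> (0 <= (EFin \o normal_pdf m s) x)%E.
  by rewrite /= lee_fin normal_pdf_ge0.
rewrite -[RHS]mule1 -(integral_normal_pdf m s).
exact: (ge0_integralZl_EFin lebesgue_measure measurableT pdf0 mpdf k0).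
Qed.

Lemma normal_mgf m : (\int[N01]_x (expR (m * x))%:E = (expR (m ^+ 2 / 2))%:E)%E.
Proof.
have mm : measurable_fun setT (fun x : R => m * x) by exact: measurable_funM.
rewrite (integral_normal_prob (mexp mm)); last by move=> x; rewrite lee_fin expR_ge0.
rewrite -(integral_scaled_pdf m 1 (expR_ge0 (m ^+ 2 / 2))).
apply: eq_integral => x _; rewrite (normal_pdfM m) -!EFinM mulrA -expRD.
by congr (expR _ * _)%:E; ring.
Qed.

(** Total mass of the normal density of standard deviation [s]. For [s > 1] the integrand grows,
    which gives finite moments; for [s] slightly below 1 it encodes the variance. *)
Lemma normal_sqr_mgf s : 0 < s ->
  (\int[N01]_x (expR (- ((s ^- 2 - 1) * x ^+ 2 / 2)))%:E = s%:E)%E.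
Proof.
move=> s0.
have mm : measurable_fun setT (fun x : R => - ((s ^- 2 - 1) * x ^+ 2 / 2)).
  apply: measurableT_comp => //; apply: measurable_funM => //.
  by apply: measurable_funM => //; exact: measurable_funX.
rewrite (integral_normal_prob (mexp mm)); last by move=> x; rewrite lee_fin expR_ge0.
rewrite -[RHS](integral_scaled_pdf 0 s (ltW s0)).
apply: eq_integral => x _; rewrite (normal_pdfZ _ s0) -!EFinM; congr (_%:E).
by field; rewrite gt_eqF.
Qed.

Lemma normal_moment4_lty : (\int[N01]_x (x ^+ 4)%:E < +oo)%E.
Proof.
(* With [s = sqrt 2] the exponent is [x^2 / 4], and the square of [1 + x^2 / 8 <= exp (x^2 / 8)]
   dominates [x^4 / 64]. *)
have s20 : 0 < Num.sqrt (2 : R) by rewrite sqrtr_gt0.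
apply: (@le_lt_trans _ _ (64 * (Num.sqrt 2))%:E); last exact: ltry.
rewrite EFinM -(normal_sqr_mgf s20) -ge0_integralZl_EFin//=; last first.
  apply: mexp; apply: measurableT_comp => //; apply: measurable_funM => //.
  by apply: measurable_funM => //; exact: measurable_funX.
apply: ge0_le_integral => //=.
- by move=> x _; rewrite lee_fin exprn_even_ge0.
- by apply/measurable_EFinP; exact: measurable_funX.
- apply/measurable_EFinP; apply: measurable_funM => //; apply: measurableT_comp => //.
  apply: measurableT_comp => //; apply: measurable_funM => //.
  by apply: measurable_funM => //; exact: measurable_funX.
move=> x _; rewrite lee_fin sqr_sqrtr//.
rewrite (_ : - _ = x ^+ 2 / 8 + x ^+ 2 / 8); last by field.
rewrite expRD -expr2.
have h : 1 + x ^+ 2 / 8 <= expR (x ^+ 2 / 8) by exact: expR_ge1Dx.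
have x2 := sqr_ge0 x.
apply: (@le_trans _ _ (64 * (x ^+ 2 / 8) ^+ 2)).
  by rewrite (_ : x ^+ 4 = 64 * (x ^+ 2 / 8) ^+ 2)//; field.
by rewrite ler_wpM2l// lerXn2r ?nnegrE ?expR_ge0//; lra.
Qed.

Lemma integrable_normal_X4 : N01.-integrable setT (EFin \o (fun x : R => x ^+ 4)).
Proof.
apply/integrableP; split; first by apply/measurable_EFinP; exact: measurable_funX.
under eq_integral do rewrite /= ger0_norm ?exprn_even_ge0//.
exact: normal_moment4_lty.
Qed.

Lemma integrable_normal_X2 : N01.-integrable setT (EFin \o (fun x : R => x ^+ 2)).
Proof.
apply: (le_integrableR (mu := N01) (g := fun x => 1 + x ^+ 4)); first exact: measurable_funX.
  move=> x; rewrite ger0_norm ?sqr_ge0//.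
  have := sqr_ge0 (x ^+ 2 - 1); have := sqr_ge0 x.
  rewrite (_ : x ^+ 4 = x ^+ 2 * x ^+ 2); last by ring.
  set y := x ^+ 2; nra.
exact: (integrableDR (integrable_cstR N01 1) integrable_normal_X4).
Qed.

Lemma integrable_normal_X : N01.-integrable setT (EFin \o (fun x : R => x)).
Proof.
apply: (le_integrableR (mu := N01) (g := fun x => 1 + x ^+ 2)) => //.
  move=> x; have := sqr_ge0 (`|x| - 1); rewrite -(real_normK (num_real x)).
  have := normr_ge0 x; set y := `|x|; nra.
exact: (integrableDR (integrable_cstR N01 1) integrable_normal_X2).
Qed.

Let Rint_fin (f : R -> R) (c : R) : (\int[N01]_x (f x)%:E = c%:E)%E -> \int[N01]_x f x = c.
Proof. by move=> h; rewrite /Rintegral h. Qed.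

(** Integrating [1 + t x <= exp (t x)] gives [t * c <= t^2] for small [t] of either sign; dividing
    by [t] and letting it tend to 0 leaves [c = 0]. *)
Lemma normal_mean : \int[N01]_x (x : R) = 0.
Proof.
set c := \int[N01]_x _.
have key t : `|t| <= 1 -> t * c <= t ^+ 2.
  move=> t1.
  have t2 : t ^+ 2 <= 1 by rewrite -(real_normK (num_real t)) exprn_ile1.
  have t20 := sqr_ge0 t.
  have e2 : expR (t ^+ 2 / 2) <= 1 + t ^+ 2.
    have h : 1 + (- (t ^+ 2 / 2)) <= expR (- (t ^+ 2 / 2)) by exact: expR_ge1Dx.
    rewrite expRN in h; have e0 := expR_gt0 (t ^+ 2 / 2).
    have : (1 - t ^+ 2 / 2) * expR (t ^+ 2 / 2) <= 1.
      by rewrite -ler_pdivlMr// div1r.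
    nra.
  have : 1 + t * c <= expR (t ^+ 2 / 2).
    have i1 := integrableDR (integrable_cstR N01 1) (integrableZlR t integrable_normal_X).
    rewrite -(Rint_fin (normal_mgf t)) /c -(RintegralZl t measurableT integrable_normal_X).
    rewrite -{1}(@Rintegral_cstT _ _ _ N01 1).
    rewrite -(RintegralD measurableT (integrable_cstR N01 1) (integrableZlR t integrable_normal_X)).
    apply: le_Rintegral => //.
      apply/integrableP; split; first by apply: mexp; exact: measurable_funM.
      under eq_integral do rewrite /= ger0_norm ?expR_ge0//.
      by rewrite normal_mgf ltry.
    by move=> x _; exact: expR_ge1Dx.
  lra.
apply/eqP; rewrite eq_le; apply/andP; split; apply/ler_addgt0Pr => e e0.
  pose t := Num.min e 1; have t0 : 0 < t by rewrite lt_min e0 ltr01.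
  have te : t <= e by rewrite ge_min lexx.
  have := key t; rewrite gtr0_norm// ge_min lexx orbT => /(_ isT).
  by rewrite expr2 ler_pM2l//; lra.
pose t := Num.min e 1; have t0 : 0 < t by rewrite lt_min e0 ltr01.
have te : t <= e by rewrite ge_min lexx.
have := key (- t); rewrite normrN gtr0_norm// ge_min lexx orbT => /(_ isT).
by rewrite mulNr sqrrN expr2 -mulrN ler_pM2l//; lra.
Qed.

(** [exp (- h x^2)] lies between [1 - h x^2] and [1 - h x^2 + h^2 x^4], and by [normal_sqr_mgf] its
    integral is exactly [s = 1 - t]. Letting [t] tend to 0 squeezes the second moment. *)
Lemma normal_variance : \int[N01]_x (x ^+ 2 : R) = 1.
Proof.
set c := \int[N01]_x _.
set c4 := \int[N01]_x (x ^+ 4).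
have c40 : 0 <= c4 by apply: Rintegral_ge0 => x _; rewrite exprn_even_ge0.
have key t : 0 < t -> t <= 1 / 2 -> 1 - 3 * t <= c /\ c <= 1 + 8 * t * c4.
  move=> t0 t2; pose s := 1 - t; have s0 : 0 < s by rewrite /s; lra.
  have s1 : s < 1 by rewrite /s; lra.
  pose h := (s ^- 2 - 1) / 2.
  have hE : h = (1 - s) * (1 + s) / (2 * s ^+ 2) by rewrite /h; field; rewrite gt_eqF.
  have s2 : 0 < s ^+ 2 by rewrite exprn_gt0.
  have h0 : 0 < h by rewrite hE divr_gt0// mulr_gt0//; lra.
  have i2 := integrableZlR h integrable_normal_X2.
  have i4 := integrableZlR (h ^+ 2) integrable_normal_X4.
  have ie : N01.-integrable setT (EFin \o (fun x : R => expR (- ((s ^- 2 - 1) * x ^+ 2 / 2)))).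
    apply/integrableP; split.
      apply: mexp; apply: measurableT_comp => //; apply: measurable_funM => //.
      by apply: measurable_funM => //; exact: measurable_funX.
    under eq_integral do rewrite /= ger0_norm ?expR_ge0//.
    by rewrite normal_sqr_mgf ?ltry.
  have i12 := integrableBR (integrable_cstR N01 1) i2.
  have E2 : 1 - h * c = \int[N01]_x (1 - h * x ^+ 2).
    rewrite (RintegralB measurableT (integrable_cstR N01 1) i2) Rintegral_cstT.
    by rewrite (RintegralZl h measurableT integrable_normal_X2).
  have E4 : 1 - h * c + h ^+ 2 * c4 = \int[N01]_x (1 - h * x ^+ 2 + h ^+ 2 * x ^+ 4).
    by rewrite (RintegralD measurableT i12 i4) -E2 (RintegralZl _ measurableT integrable_normal_X4).
  have l1 : 1 - h * c <= s.
    rewrite -(Rint_fin (normal_sqr_mgf s0)) E2; apply: le_Rintegral => // x _.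
    rewrite (_ : 1 - h * x ^+ 2 = 1 + - ((s ^- 2 - 1) * x ^+ 2 / 2)); last first.
      by rewrite /h; field; rewrite gt_eqF.
    exact: expR_ge1Dx.
  have l2 : s <= 1 - h * c + h ^+ 2 * c4.
    rewrite -(Rint_fin (normal_sqr_mgf s0)) E4; apply: le_Rintegral => //.
      exact: (integrableDR i12 i4).
    move=> x _; set y := h * x ^+ 2.
    have y0 : 0 <= y by rewrite mulr_ge0 ?sqr_ge0// ltW.
    rewrite (_ : - _ = - y); last by rewrite /y /h; field; rewrite gt_eqF.
    rewrite (_ : h ^+ 2 * x ^+ 4 = y ^+ 2); last by rewrite /y; ring.
    (* [exp (- y) <= 1 / (1 + y) <= 1 - y + y^2], since [(1 - y + y^2) (1 + y) = 1 + y^3]. *)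
    have : 1 + y <= expR y by exact: expR_ge1Dx.
    rewrite expRN => ey; apply: (@le_trans _ _ (1 + y)^-1).
      by rewrite lef_pV2 ?posrE ?expR_gt0//; lra.
    rewrite -div1r ler_pdivrMr; last lra.
    by have := mulr_ge0 (sqr_ge0 y) y0; rewrite expr2; nra.
  have hs : h * s ^+ 2 * 2 = t * (2 - t).
    by rewrite hE /s; field; rewrite -/s gt_eqF.
  have u0 : 0 < 2 - t by lra.
  have tu : 0 < t * (2 - t) by rewrite mulr_gt0.
  have l1' : t <= h * c by rewrite /s in l1; lra.
  have l2' : h * c <= t + h ^+ 2 * c4 by rewrite /s in l2; lra.
  have h8 : h <= 8 * t by rewrite hE ler_pdivrMr ?mulr_gt0// /s; nra.
  split.
    have : 2 * s ^+ 2 * t <= c * (t * (2 - t)).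
      rewrite -hs; have := ler_wpM2l (ltW s2) l1'; lra.
    have -> : c * (t * (2 - t)) = (c * (2 - t)) * t by ring.
    rewrite ler_pM2r// => hc; rewrite -(ler_pM2r u0); apply: le_trans hc.
    rewrite /s; nra.
  have : c * (t * (2 - t)) <= (2 * s ^+ 2 + h * c4 * (2 - t)) * t.
    have -> : (2 * s ^+ 2 + h * c4 * (2 - t)) * t = 2 * s ^+ 2 * t + h * c4 * (t * (2 - t)) by ring.
    rewrite -hs; have := ler_wpM2l (ltW s2) l2'; lra.
  have -> : c * (t * (2 - t)) = (c * (2 - t)) * t by ring.
  rewrite ler_pM2r// => hc; rewrite -(ler_pM2r u0); apply: (le_trans hc).
  have := ler_wpM2r c40 h8 => hc4; have := ler_wpM2r (ltW u0) hc4.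
  rewrite /s; nra.
apply/eqP; rewrite eq_le; apply/andP; split; apply/ler_addgt0Pr => e e0.
  pose t := Num.min (e / (8 * c4 + 1)) (1 / 2).
  have t0 : 0 < t by rewrite lt_min !divr_gt0//; lra.
  have te : t <= e / (8 * c4 + 1) by rewrite ge_min lexx.
  have [|_] := key t t0; first by rewrite ge_min lexx orbT.
  move: te; rewrite ler_pdivlMr; last lra.
  nra.
pose t := Num.min (e / 3) (1 / 2).
have t0 : 0 < t by rewrite lt_min !divr_gt0//; lra.
have te : t <= e / 3 by rewrite ge_min lexx.
have [|? _] := key t t0; first by rewrite ge_min lexx orbT.
lra.
Qed.

End normal_moments.

(** * Folds of independent variables *)

Section product_rule.
Context {R : realType} {d} {T : measurableType d} {d1} {T1 : measurableType d1}
  {d2} {T2 : measurableType d2}.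
Variables (P : probability T R) (m1 : probability T1 R) (m2 : probability T2 R).

(** Uniqueness of product measures, applied to the law of [Z] conditioned on [D]. The event [D]
    carries the coordinates still to be used; the case [P D = 0], where conditioning fails, is
    settled directly. *)
Lemma product_rule_extend (Z : {mfun T >-> (T1 * T2)%type}) (D : set T) (c : \bar R) :
  measurable D -> P D = c ->
  (forall A B, measurable A -> measurable B ->
    P (Z @^-1` (A `*` B) `&` D) = m1 A * m2 B * c)%E ->
  forall M, measurable M -> P (Z @^-1` M `&` D) = ((m1 \x m2)%E M * c)%E.
Proof.
move=> mD PD H M mM.
have mZ M' : measurable M' -> measurable (Z @^-1` M').
  by move=> mM'; rewrite -[_ @^-1` _]setTI; exact: measurable_funPT.
have c0 : (0 <= c)%E by rewrite -PD.
have cfin : c \is a fin_num by rewrite -PD fin_num_measure.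
have [c00|cn0] := eqVneq c 0%E.
  rewrite c00 mule0; apply/eqP; rewrite eq_le measure_ge0 andbT.
  by rewrite -c00 -PD le_measure ?inE//; exact: measurableI (mZ _ mM) mD.
have cpos : (0 <= (fine c)^-1)%R by rewrite invr_ge0 fine_ge0.
pose m0 := mscale (NngNum cpos) (pushforward (mrestr P mD) Z).
pose m' := m0 (measurable_funPT Z).
have m'E A : m' A = ((fine c)^-1%:E * P (Z @^-1` A `&` D))%E by [].
have fc0 : fine c != 0 by rewrite fine_eq0.
have -> : ((m1 \x m2)%E M * c)%E = (m' M * c)%E.
  congr (_ * _)%E; apply: (product_measure_unique (m1 := m1) (m2 := m2)) => //.
  move=> A B mA mB.
  rewrite [LHS]m'E H// muleC -muleA [X in (_ * X)%E](_ : _ = 1%E) ?mule1//.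
  by rewrite -{1}(fineK cfin) -EFinM divff.
rewrite m'E muleAC [X in (X * _)%E](_ : _ = 1%E) ?mul1e//.
by rewrite -{2}(fineK cfin) -EFinM mulVf.
Qed.

End product_rule.

Section fold_law.
Context {R : realType} {d} {T : measurableType d} {dV} {V : measurableType dV}
  {dY} {Y : measurableType dY}.

Fixpoint rfold (op : nat -> Y * V -> Y) (y0 : Y) (X : nat -> T -> V) n (w : T) : Y :=
  if n is m.+1 then op m (rfold op y0 X m w, X m w) else y0.

(** Refers to no underlying probability space, so folds over unrelated families of variables can be
    compared, and each step is one application of Tonelli's theorem. *)
Fixpoint fold_law (op : nat -> {mfun (Y * V)%type >-> Y}) (rho : probability V R)
    (y0 : Y) n : probability Y R :=
  if n is m.+1 then distribution (fold_law op rho y0 m \x rho)%E (op m) else \d_ y0.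

Variables (P : probability T R) (op : nat -> {mfun (Y * V)%type >-> Y}).
Variables (rho : probability V R) (y0 : Y) (X : nat -> {mfun T >-> V}) (N : nat).
Hypothesis X_indep : independent_rvs P (fun i : 'I_N => X i).
Hypothesis X_law : forall i A, (i < N)%N -> measurable A -> P (X i @^-1` A) = rho A.

Lemma measurable_rfold n : measurable_fun setT (rfold op y0 X n).
Proof.
elim: n => [|n IH] /=; first exact: measurable_cst.
apply: (measurableT_comp (f := op n)) => //.
exact: measurable_fun_pair.
Qed.

Let future n (B : nat -> set V) : set T :=
  \bigcap_(j in [set j | (n <= j < N)%N]) X j @^-1` B j.

Let mX j A : measurable A -> measurable (X j @^-1` A).
Proof. by move=> mA; rewrite -[_ @^-1` _]setTI; exact: measurable_funPT. Qed.

Let measurable_future n B : (forall j, measurable (B j)) -> measurable (future n B).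
Proof.
move=> mB; rewrite /future bigcap_mkcond; apply: bigcapT_measurable => j.
by case: ifPn => // _; exact: mX.
Qed.

Let futureS n B : (n < N)%N -> future n B = X n @^-1` B n `&` future n.+1 B.
Proof.
move=> nN; apply/seteqP; split => [w h|w [h1 h2] j /= /andP[nj jN]].
  split=> [|j /= /andP[nj jN]]; apply: h => /=; first by rewrite leqnn.
  by rewrite (ltnW nj).
move: nj; rewrite leq_eqVlt => /predU1P[<-//|nj].
by apply: h2 => /=; rewrite nj.
Qed.

Let prodS n (B : nat -> set V) : (n < N)%N ->
  (\prod_(n <= j < N) rho (B j) = rho (B n) * \prod_(n.+1 <= j < N) rho (B j))%E.
Proof. by move=> nN; rewrite big_ltn. Qed.

(** The induction must carry the unseen coordinates along: independence is given as a product rule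
    for the whole family, and independence of the fold from the next variable is extracted from it
    here. *)
Let rfold_future n C B : (n <= N)%N -> measurable C -> (forall j, measurable (B j)) ->
  P (rfold op y0 X n @^-1` C `&` future n B) =
  (fold_law op rho y0 n C * \prod_(n <= j < N) rho (B j))%E.
Proof.
move=> + mC mB; elim: n C B mC mB => [|n IH] C B mC mB nN.
  rewrite /= preimage_cst /dirac indicE.
  case: ifPn => [_|_]; last by rewrite set0I measure0 mul0e.
  rewrite setTI mul1e.
  have -> : future 0 B = \bigcap_(i in [set: 'I_N]) (X i @^-1` B i).
    apply/seteqP; split=> w h i => [_|/= iN]; first exact: (h i (ltn_ord i)).
    exact: (h (Ordinal iN)).
  rewrite X_indep// big_mkord; apply: eq_bigr => i _; exact: X_law.
have mr : measurable_fun setT (fun w => (rfold op y0 X n w, X n w)).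
  by apply: measurable_fun_pair => //; exact: measurable_rfold.
pose Z : {mfun T >-> (Y * V)%type} := HB.pack (fun w => (rfold op y0 X n w, X n w))
  (isMeasurableFun.Build _ _ _ _ _ mr).
have -> : rfold op y0 X n.+1 @^-1` C = Z @^-1` (op n @^-1` C) by [].
have mopC : measurable (op n @^-1` C).
  by rewrite -[_ @^-1` _]setTI; exact: measurable_funPT.
have sub B' : (forall j, measurable (B' j)) ->
    P (future n B') = (\prod_(n <= j < N) rho (B' j))%E.
  move=> mB'; have := IH setT B' measurableT mB' (ltnW nN).
  by rewrite preimage_setT setTI probability_setT mul1e.
(* Changing the [n]-th set only: [setT] there gives the probability of the later coordinates, [B']
   gives the rectangle rule for the pair of the state and [X n]. *)
pose upd (A : set V) j := if j == n then A else B j.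
have mupd A : measurable A -> forall j, measurable (upd A j).
  by move=> mA j; rewrite /upd; case: ifP.
have futE A : future n.+1 (upd A) = future n.+1 B.
  rewrite /future; apply: eq_bigcapr => j /= /andP[nj _].
  by rewrite /upd gtn_eqF.
have prodE A : (\prod_(n.+1 <= j < N) rho (upd A j) = \prod_(n.+1 <= j < N) rho (B j))%E.
  by apply: eq_big_nat => j /andP[nj _]; rewrite /upd gtn_eqF.
apply: product_rule_extend => //.
- exact: measurable_future.
- have := sub (upd setT) (mupd _ measurableT).
  rewrite futureS// prodS// futE prodE /upd eqxx preimage_setT setTI.
  by rewrite probability_setT mul1e.
- move=> A B' mA mB'.
  have := IH A (upd B') mA (mupd _ mB') (ltnW nN).
  rewrite futureS// prodS// futE prodE /upd eqxx muleA => <-.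
  by congr (P _); rewrite setIA; congr (_ `&` _).
Qed.

Lemma rfold_fold_law C : measurable C ->
  P (rfold op y0 X N @^-1` C) = fold_law op rho y0 N C.
Proof.
move=> mC; have := @rfold_future N C (fun=> setT) (leqnn N) mC (fun=> measurableT).
rewrite big_geq// mule1 => <-; congr (P _).
by rewrite (_ : future N _ = setT) ?setIT// -subTset.
Qed.

Lemma ge0_integral_rfold (f : Y -> \bar R) : measurable_fun setT f ->
  (forall y, 0 <= f y)%E ->
  (\int[P]_w f (rfold op y0 X N w) = \int[fold_law op rho y0 N]_y f y)%E.
Proof.
move=> mf f0.
pose Z : {mfun T >-> Y} := HB.pack (rfold op y0 X N)
  (isMeasurableFun.Build _ _ _ _ _ (measurable_rfold N)).
rewrite -(ge0_integral_distribution Z)//.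
by apply: eq_measure_integral => A mA _; exact: rfold_fold_law.
Qed.

End fold_law.

Section fold_law_integral.
Context {R : realType} {dV} {V : measurableType dV} {dY} {Y : measurableType dY}.
Variables (op : nat -> {mfun (Y * V)%type >-> Y}) (rho : probability V R) (y0 : Y).
Variable f : Y -> \bar R.
Hypotheses (mf : measurable_fun setT f) (f0 : forall y, (0 <= f y)%E).

Lemma integral_fold_law0 : (\int[fold_law op rho y0 0]_y f y = f y0)%E.
Proof. by rewrite integral_dirac//= diracT mul1e. Qed.

Lemma integral_fold_lawS n :
  (\int[fold_law op rho y0 n.+1]_y f y =
   \int[fold_law op rho y0 n]_y \int[rho]_v f (op n (y, v)))%E.
Proof.
rewrite /= ge0_integral_distribution// fubini_tonelli1//; last by move=> ?; exact: f0.
by apply: measurableT_comp.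
Qed.

End fold_law_integral.

(** * Lindeberg replacement for quadratic polynomials *)

Section integrability.
Context {R : realType} {d} {T : measurableType d} (mu : probability T R).
Implicit Types f g t : T -> R.

Lemma integrable_of_sqr f : measurable_fun setT f ->
  mu.-integrable setT (EFin \o (fun x => f x ^+ 2)) -> mu.-integrable setT (EFin \o f).
Proof.
move=> mf f2; apply: (le_integrableR (g := fun x => 1 + f x ^+ 2)) => //.
  move=> x; have := sqr_ge0 (`|f x| - 1); rewrite -(real_normK (num_real (f x))).
  have := normr_ge0 (f x); set y := `|f x|; nra.
exact: (integrableDR (integrable_cstR mu 1) f2).
Qed.

Lemma measurable_satur t : measurable_fun setT t -> (forall x, 0 <= t x) ->
  measurable_fun setT (fun x => satur (t x)).
Proof.
move=> mt t0.
have -> : (fun x => satur (t x)) = (fun x => 1 - (1 + t x)^-1).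
  by apply/funext => x; rewrite saturE.
apply: measurable_funB => //.
have -> : (fun x => (1 + t x)^-1) = (fun x => powR (1 + t x) (-1)).
  by apply/funext => x; rewrite powR_inv1// addr_ge0.
apply: (measurableT_comp (measurable_powR (-1))).
exact: measurable_funD.
Qed.

Lemma measurable_qtrunc t : measurable_fun setT t -> (forall x, 0 <= t x) ->
  measurable_fun setT (fun x => qtrunc (t x)).
Proof. by move=> mt t0; apply: measurable_funM => //; exact: measurable_satur. Qed.

Lemma integrable_satur t : measurable_fun setT t -> (forall x, 0 <= t x) ->
  mu.-integrable setT (EFin \o (fun x => satur (t x))).
Proof.
move=> mt t0; apply: (@bounded_integrable _ _ _ _ _ 1); first exact: measurable_satur.
by move=> x; rewrite ger0_norm ?satur_le1// satur_ge0.
Qed.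

Lemma integrable_qtrunc t : (forall x, 0 <= t x) ->
  mu.-integrable setT (EFin \o t) ->
  mu.-integrable setT (EFin \o (fun x => qtrunc (t x))).
Proof.
move=> t0 it; have mt : measurable_fun setT t by apply/measurable_EFinP; exact: measurable_int it.
apply: (le_integrableR (g := t)) => //; first exact: measurable_qtrunc.
by move=> x; rewrite ger0_norm ?qtrunc_le// qtrunc_ge0.
Qed.

(** The tangent at the mean integrates to the value at the mean. *)
Lemma jensen_satur t : (forall x, 0 <= t x) -> mu.-integrable setT (EFin \o t) ->
  \int[mu]_x satur (t x) <= satur (\int[mu]_x t x).
Proof.
move=> t0 it; have mt : measurable_fun setT t by apply/measurable_EFinP; exact: measurable_int it.
set s := \int[mu]_x t x; have s0 : 0 <= s by exact: Rintegral_ge0.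
have i1 := integrableBR it (integrable_cstR mu s).
have i2 := integrableZlR ((1 + s) ^- 2) i1.
apply: (@le_trans _ _ (\int[mu]_x (satur s + (1 + s)^-2 * (t x - s)))).
  apply: le_Rintegral => //; first exact: integrable_satur.
    exact: (integrableDR (integrable_cstR mu (satur s)) i2).
  by move=> x _; exact: satur_tangent.
rewrite (RintegralD measurableT (integrable_cstR mu (satur s)) i2) Rintegral_cstT.
rewrite (RintegralZl _ measurableT i1) (RintegralB measurableT it (integrable_cstR mu s)).
by rewrite Rintegral_cstT subrr mulr0 addr0.
Qed.

Lemma jensen_qtrunc t : (forall x, 0 <= t x) -> mu.-integrable setT (EFin \o t) ->
  qtrunc (\int[mu]_x t x) <= \int[mu]_x qtrunc (t x).
Proof.
move=> t0 it; set s := \int[mu]_x t x; have s0 : 0 <= s by exact: Rintegral_ge0.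
have i1 := integrableBR it (integrable_cstR mu s).
have i2 := integrableZlR (1 - (1 + s) ^- 2) i1.
apply: (@le_trans _ _ (\int[mu]_x (qtrunc s + (1 - (1 + s)^-2) * (t x - s)))).
  rewrite (RintegralD measurableT (integrable_cstR mu (qtrunc s)) i2) Rintegral_cstT.
  rewrite (RintegralZl _ measurableT i1) (RintegralB measurableT it (integrable_cstR mu s)).
  by rewrite Rintegral_cstT subrr mulr0 addr0.
apply: le_Rintegral => //; last by move=> x _; exact: qtrunc_tangent.
  exact: (integrableDR (integrable_cstR mu (qtrunc s)) i2).
exact: integrable_qtrunc.
Qed.

Lemma jensen_sqr f : measurable_fun setT f ->
  mu.-integrable setT (EFin \o (fun x => f x ^+ 2)) ->
  (\int[mu]_x f x) ^+ 2 <= \int[mu]_x (f x ^+ 2).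
Proof.
move=> mf if2; have if1 := integrable_of_sqr mf if2.
set s := \int[mu]_x f x.
have i1 := integrableZlR (2 * s) if1.
have : \int[mu]_x (2 * s * f x - s ^+ 2) <= \int[mu]_x (f x ^+ 2).
  apply: le_Rintegral => //.
    exact: (integrableBR i1 (integrable_cstR mu (s ^+ 2))).
  by move=> x _; have := sqr_ge0 (f x - s); nra.
rewrite (RintegralB measurableT i1 (integrable_cstR mu (s ^+ 2))) Rintegral_cstT.
rewrite (RintegralZl _ measurableT if1) -/s; lra.
Qed.

End integrability.

(** * Linear and bilinear forms on tuples, and the absorption of one vector *)

Section linear_forms.
Context {R : realType} {K : nat}.
Local Notation V := (K.-tuple R).
Implicit Types (a kappa : 'I_K -> R) (b v : V).

Definition lin a v : R := \sum_(k < K) a k * tnth v k.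
Definition weight kappa b : 'I_K -> R := fun k => kappa k * tnth b k.
Definition bilin kappa b v : R := lin (weight kappa b) v.
Definition addt b v : V := [tuple tnth b k + tnth v k | k < K].

Lemma bilinC kappa b v : bilin kappa b v = bilin kappa v b.
Proof. by apply: eq_bigr => k _; rewrite /weight mulrAC. Qed.

Lemma lin_addt a b v : lin a (addt b v) = lin a b + lin a v.
Proof. by rewrite -big_split; apply: eq_bigr => k _; rewrite tnth_mktuple mulrDr. Qed.

Lemma bilinDl kappa b b' v : bilin kappa (addt b b') v = bilin kappa b v + bilin kappa b' v.
Proof. by rewrite bilinC {1}/bilin lin_addt -!/(bilin _ _ _) !(bilinC _ v). Qed.

Lemma addtAC b v w : addt (addt b v) w = addt (addt b w) v.
Proof. by apply: eq_from_tnth => k; rewrite !tnth_mktuple addrAC. Qed.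

Lemma measurable_lin a : measurable_fun setT (lin a).
Proof.
apply: measurable_sum => k; apply: measurable_funM => //.
exact: measurable_tnth.
Qed.

Lemma measurable_bilin d (T : measurableType d) kappa (f g : T -> V) :
  measurable_fun setT f -> measurable_fun setT g ->
  measurable_fun setT (fun x => bilin kappa (f x) (g x)).
Proof.
move=> mf mg; apply: measurable_sum => k; apply: measurable_funM.
  by apply: measurable_funM => //; exact: measurableT_comp (measurable_tnth k) _.
exact: measurableT_comp (measurable_tnth k) _.
Qed.

Lemma measurable_addt d (T : measurableType d) (f g : T -> V) :
  measurable_fun setT f -> measurable_fun setT g ->
  measurable_fun setT (fun x => addt (f x) (g x)).
Proof.
move=> mf mg; apply/measurable_fun_tnthP => k.
rewrite (_ : _ \o _ = fun x => tnth (f x) k + tnth (g x) k); last first.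
  by apply/funext => x /=; rewrite tnth_mktuple.
by apply: measurable_funD; exact: measurableT_comp (measurable_tnth k) _.
Qed.

(* The state [(c, b)] records the current value [c] of the quadratic form and
   the sum [b] of the vectors absorbed so far. *)
Definition absorb kappa (p : (R * V) * V) : R * V :=
  (p.1.1 + bilin kappa p.1.2 p.2, addt p.1.2 p.2).

Lemma measurable_absorb kappa : measurable_fun setT (absorb kappa).
Proof.
apply: measurable_fun_pair.
  apply: measurable_funD; first exact: measurableT_comp measurable_fst measurable_fst.
  by apply: measurable_bilin => //; exact: measurableT_comp measurable_snd measurable_fst.
by apply: measurable_addt => //; exact: measurableT_comp measurable_snd measurable_fst.
Qed.

HB.instance Definition _ kappa :=
  isMeasurableFun.Build _ _ _ _ (absorb kappa) (measurable_absorb kappa).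

(** Rests on the symmetry of [bilin]; it is what makes the draws of the chain exchangeable. *)
Lemma absorbAC kappa y v w :
  absorb kappa (absorb kappa (y, v), w) = absorb kappa (absorb kappa (y, w), v).
Proof.
rewrite /absorb/= addtAC !bilinDl; congr (_, _).
by rewrite (bilinC kappa v w); ring.
Qed.

End linear_forms.

(** * Chains whose increments follow one of two laws *)

Section mixed_laws.
Context {R : realType} {K : nat}.
Local Notation V := (K.-tuple R).
Local Notation Y := (R * V)%type.
Variables (kappa : 'I_K -> R) (rho : bool -> probability V R) (y0 : Y).
Implicit Types (l : seq bool) (f : Y -> \bar R).

(** The list tells which law each vector is drawn from; its head is the vector absorbed last. *)
Fixpoint mixed_law l : probability Y R :=
  if l is i :: l' then distribution (mixed_law l' \x rho i)%E (absorb kappa) else \d_ y0.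

Lemma mixed_law_nseq i n :
  mixed_law (nseq n i) = fold_law (fun=> absorb kappa) (rho i) y0 n.
Proof. by elim: n => //= n ->. Qed.

Lemma integral_mixed0 f : measurable_fun setT f ->
  (\int[mixed_law [::]]_y f y = f y0)%E.
Proof. by move=> mf; rewrite integral_dirac//= diracT mul1e. Qed.

Let inner i f y := (\int[rho i]_v f (absorb kappa (y, v)))%E.

Lemma integral_mixed_cons i l f : measurable_fun setT f -> (forall y, 0 <= f y)%E ->
  (\int[mixed_law (i :: l)]_y f y = \int[mixed_law l]_y inner i f y)%E.
Proof.
move=> mf f0; rewrite /= ge0_integral_distribution// fubini_tonelli1//.
  by apply: measurableT_comp.
by move=> ?; exact: f0.
Qed.

Let measurable_inner i f : measurable_fun setT f -> (forall y, 0 <= f y)%E ->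
  measurable_fun setT (inner i f).
Proof.
move=> mf f0; apply: (@measurable_fun_fubini_tonelli_F _ _ _ _ _ (rho i)
  (fun p => f (absorb kappa p))) => //.
by apply: (measurableT_comp (f := f)).
Qed.

Let inner_ge0 i f : (forall y, 0 <= f y)%E -> forall y, (0 <= inner i f y)%E.
Proof. by move=> f0 y; exact: integral_ge0. Qed.

Lemma integral_mixed_swap i j l f : measurable_fun setT f -> (forall y, 0 <= f y)%E ->
  (\int[mixed_law (i :: j :: l)]_y f y = \int[mixed_law (j :: i :: l)]_y f y)%E.
Proof.
move=> mf f0.
transitivity (\int[mixed_law l]_y inner j (inner i f) y)%E.
  rewrite -(integral_mixed_cons j l (measurable_inner i mf f0) (inner_ge0 i f0)).
  exact: (integral_mixed_cons i (j :: l) mf f0).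
transitivity (\int[mixed_law l]_y inner i (inner j f) y)%E; last first.
  rewrite -(integral_mixed_cons i l (measurable_inner j mf f0) (inner_ge0 j f0)).
  exact/esym/(integral_mixed_cons j (i :: l) mf f0).
apply: eq_integral => y _; rewrite /inner.
have mg : measurable_fun setT (fun p : V * V => absorb kappa (absorb kappa (y, p.1), p.2)).
  apply: (measurableT_comp (measurable_absorb kappa)).
  apply: measurable_fun_pair => //; apply: (measurableT_comp (measurable_absorb kappa)).
  exact: measurable_fun_pair.
transitivity (\int[rho i]_w \int[rho j]_v f (absorb kappa (absorb kappa (y, v), w)))%E.
  exact: (@fubini_tonelli _ _ _ _ _ (rho j) (rho i) _ (measurableT_comp mf mg) (fun=> f0 _)).
by apply: eq_integral => v _; apply: eq_integral => w _; rewrite /= absorbAC.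
Qed.

(** Brings the vector to be replaced to the last position, where conditionally on the state the
    value changes by a linear form in it. *)
Lemma integral_mixed_cat l1 i l2 f : measurable_fun setT f -> (forall y, 0 <= f y)%E ->
  (\int[mixed_law (l1 ++ i :: l2)]_y f y = \int[mixed_law (i :: l1 ++ l2)]_y f y)%E.
Proof.
move: f; elim: l1 => [//|j l1 IH] f mf f0.
rewrite -[RHS](integral_mixed_swap j i (l1 ++ l2) mf f0).
rewrite (integral_mixed_cons j (i :: l1 ++ l2) mf f0).
rewrite -(IH _ (measurable_inner j mf f0) (inner_ge0 j f0)).
exact: (integral_mixed_cons j (l1 ++ i :: l2) mf f0).
Qed.

End mixed_laws.

Lemma integral_cstT {R : realType} {d} {T : measurableType d} (mu : probability T R) (c : R) :
  (\int[mu]_x c%:E = c%:E)%E.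
Proof. by rewrite -(EFin_Rintegral (integrable_cstR mu c)) Rintegral_cstT. Qed.

Lemma measurable_inner_integral {R : realType} {d d'} {T : measurableType d}
    {T' : measurableType d'} (mu : probability T' R) (g : T * T' -> \bar R) :
  measurable_fun setT g -> (forall p, 0 <= g p)%E ->
  measurable_fun setT (fun x => \int[mu]_y g (x, y))%E.
Proof. by move=> mg g0; exact: measurable_fun_fubini_tonelli_F. Qed.

Lemma measurable_outer_integral {R : realType} {d d'} {T : measurableType d}
    {T' : measurableType d'} (mu : probability T R) (g : T * T' -> \bar R) :
  measurable_fun setT g -> (forall p, 0 <= g p)%E ->
  measurable_fun setT (fun y => \int[mu]_x g (x, y))%E.
Proof. by move=> mg g0; exact: measurable_fun_fubini_tonelli_G. Qed.

(** * One replacement, and the sum of all of them *)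

Section lindeberg.
Context {R : realType} {K : nat}.
Local Notation V := (K.-tuple R).
Local Notation Y := (R * V)%type.
Variables (kappa : 'I_K -> R) (rho : bool -> probability V R) (b0 : V).
Local Notation mixed := (mixed_law kappa rho (0, b0)).
Hypothesis int2 : forall i a, (rho i).-integrable setT (EFin \o (fun v => lin a v ^+ 2)).
Hypothesis mean0 : forall i a, \int[rho i]_v lin a v = 0.
Hypothesis eqvar : forall a,
  \int[rho true]_v (lin a v ^+ 2) = \int[rho false]_v (lin a v ^+ 2).
Variable c : R.
Hypothesis c1 : 1 <= c.
(** Deliberately asymmetric: every error term is expressed with the law [false], that of the
    features, and this domination transfers it to the Gaussian law [true]. *)
Hypothesis qdom : forall a,
  \int[rho true]_v qtrunc (lin a v ^+ 2) <= c * \int[rho false]_v qtrunc (lin a v ^+ 2).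

Let tau a := \int[rho false]_v (lin a v ^+ 2).
Let gam a := \int[rho false]_v qtrunc (lin a v ^+ 2).

Let tauE i a : \int[rho i]_v (lin a v ^+ 2) = tau a.
Proof. by case: i. Qed.

Let tau_ge0 a : 0 <= tau a.
Proof. by apply: Rintegral_ge0 => v _; exact: sqr_ge0. Qed.

Let gam_ge0 a : 0 <= gam a.
Proof. by apply: Rintegral_ge0 => v _; apply: qtrunc_ge0; exact: sqr_ge0. Qed.

Let gamE i a : \int[rho i]_v qtrunc (lin a v ^+ 2) <= c * gam a.
Proof. by case: i; [exact: qdom|rewrite ler_peMl ?gam_ge0]. Qed.

Let tau_EFin a : (tau a)%:E = (\int[rho false]_v (lin a v ^+ 2)%:E)%E.
Proof. exact: (EFin_Rintegral (int2 false a)). Qed.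

Let int1 i a : (rho i).-integrable setT (EFin \o lin a).
Proof. exact: integrable_of_sqr (measurable_lin a) (int2 i a). Qed.

Let intq i a : (rho i).-integrable setT (EFin \o (fun v => qtrunc (lin a v ^+ 2))).
Proof. by apply: integrable_qtrunc => // v; exact: sqr_ge0. Qed.

Let gam_EFin a : (gam a)%:E = (\int[rho false]_v (qtrunc (lin a v ^+ 2))%:E)%E.
Proof. exact: (EFin_Rintegral (intq false a)). Qed.

Let intA2 i A a :
  (rho i).-integrable setT (EFin \o (fun v => A ^+ 2 + 2 * A * lin a v + lin a v ^+ 2)).
Proof.
have h := integrableDR (integrable_cstR (rho i) (A ^+ 2)) (integrableZlR (2 * A) (int1 i a)).
exact: (integrableDR h (int2 i a)).
Qed.

Let sqrE A x : (A + x) ^+ 2 = A ^+ 2 + 2 * A * x + x ^+ 2 :> R.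
Proof. by ring. Qed.

Let intAs i A a : (rho i).-integrable setT (EFin \o (fun v => (A + lin a v) ^+ 2)).
Proof.
by apply: (eq_integrable measurableT _ _ _ (intA2 i A a)) => v _ /=; rewrite sqrE.
Qed.

Let step_sqr i A a : \int[rho i]_v ((A + lin a v) ^+ 2) = A ^+ 2 + tau a.
Proof.
under eq_Rintegral do rewrite sqrE.
have h1 := integrableZlR (2 * A) (int1 i a).
have h := integrableDR (integrable_cstR (rho i) (A ^+ 2)) h1.
rewrite (RintegralD measurableT h (int2 i a)) tauE; congr (_ + _).
rewrite (RintegralD measurableT (integrable_cstR (rho i) (A ^+ 2)) h1) Rintegral_cstT.
by rewrite (RintegralZl _ measurableT (int1 i a)) mean0 mulr0 addr0.
Qed.

(** Integrates [qtrunc_sqr_taylor]; the first-order term drops out because the increment is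
    centred. *)
Let step_q i A a : \int[rho i]_v qtrunc ((A + lin a v) ^+ 2) <=
  qtrunc (A ^+ 2) + 16 * (tau a * satur (A ^+ 2) + c * gam a).
Proof.
pose D := 2 * A - 2 * A / (1 + A ^+ 2) ^+ 2.
have h1 := integrableZlR D (int1 i a).
have h2 := integrableZlR (satur (A ^+ 2)) (int2 i a).
have h3 := integrableZlR 16 (integrableDR h2 (intq i a)).
have h4 := integrableDR (integrable_cstR (rho i) (qtrunc (A ^+ 2))) h1.
apply: (@le_trans _ _ (\int[rho i]_v (qtrunc (A ^+ 2) + D * lin a v +
    16 * (satur (A ^+ 2) * lin a v ^+ 2 + qtrunc (lin a v ^+ 2))))).
  apply: le_Rintegral => //.
  - by apply: integrable_qtrunc => // v; exact: sqr_ge0.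
  - exact: (integrableDR h4 h3).
  - by move=> v _; rewrite [satur _ * _]mulrC; exact: qtrunc_sqr_taylor.
rewrite (RintegralD measurableT h4 h3).
rewrite (RintegralD measurableT (integrable_cstR (rho i) _) h1) Rintegral_cstT.
rewrite (RintegralZl _ measurableT (int1 i a)) mean0 mulr0 addr0.
rewrite (RintegralZl _ measurableT (integrableDR h2 (intq i a))).
rewrite (RintegralD measurableT h2 (intq i a)) (RintegralZl _ measurableT (int2 i a)).
rewrite tauE [satur _ * _]mulrC lerD2l ler_wpM2l// lerD2l; exact: gamE.
Qed.

Let mlin2 a : measurable_fun setT (fun y : Y => lin a y.2).
Proof. exact: measurableT_comp (measurable_lin a) measurable_snd. Qed.

Let mixed_sqr l a :
  (\int[mixed l]_y ((lin a y.2) ^+ 2)%:E = ((lin a b0) ^+ 2 + (size l)%:R * tau a)%:E)%E.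
Proof.
have mf : measurable_fun setT (fun y : Y => ((lin a y.2) ^+ 2)%:E).
  by apply/measurable_EFinP; apply: measurable_funX; exact: mlin2.
have f0 (y : Y) : (0 <= ((lin a y.2) ^+ 2)%:E)%E by rewrite lee_fin sqr_ge0.
elim: l => [|i l IH]; first by rewrite integral_mixed0// mul0r addr0.
rewrite (integral_mixed_cons _ _ _ i l mf f0).
under eq_integral => y _.
  rewrite /= (_ : (\int[rho i]_v _)%E = ((lin a y.2) ^+ 2 + tau a)%:E); last first.
    rewrite -(step_sqr i) (EFin_Rintegral (intAs i _ a)).
    by apply: eq_integral => v _; rewrite lin_addt.
  rewrite EFinD.
  over.
rewrite ge0_integralD//; [|by move=> y _; rewrite lee_fin].
rewrite IH integral_cstT -EFinD; congr (_%:E).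
by rewrite /= -natr1; ring.
Qed.

Let int_mixed l a : (mixed l).-integrable setT (EFin \o (fun y : Y => (lin a y.2) ^+ 2)).
Proof.
apply/integrableP; split.
  by apply/measurable_EFinP; apply: measurable_funX; exact: mlin2.
under eq_integral do rewrite /= ger0_norm ?sqr_ge0//.
by rewrite mixed_sqr ltry.
Qed.

Let mixed_sqrR l a :
  \int[mixed l]_y ((lin a y.2) ^+ 2) = (lin a b0) ^+ 2 + (size l)%:R * tau a.
Proof. by apply: EFin_inj; rewrite (EFin_Rintegral (int_mixed l a)) mixed_sqr. Qed.

(** Sums [step_q] along the chain. The saturation of the random state is replaced by that of its
    second moment, by concavity, and the latter only grows with the number of steps. *)
Let mixed_q l a : \int[mixed l]_y qtrunc ((lin a y.2) ^+ 2) <=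
  qtrunc ((lin a b0) ^+ 2) + (size l)%:R *
    (16 * (tau a * satur ((lin a b0) ^+ 2 + (size l)%:R * tau a) + c * gam a)).
Proof.
have intqm l' : (mixed l').-integrable setT (EFin \o (fun y : Y => qtrunc ((lin a y.2) ^+ 2))).
  by apply: integrable_qtrunc; [move=> y; exact: sqr_ge0|exact: int_mixed].
have ints l' : (mixed l').-integrable setT (EFin \o (fun y : Y => satur ((lin a y.2) ^+ 2))).
  by apply: integrable_satur; [apply: measurable_funX; exact: mlin2|move=> y; exact: sqr_ge0].
have q0 (y : Y) : (0 <= (qtrunc ((lin a y.2) ^+ 2))%:E)%E.
  by rewrite lee_fin qtrunc_ge0// sqr_ge0.
have mq := measurable_int _ (intqm [::]).
elim: l => [|i l IH].
  rewrite mul0r addr0 -lee_fin (EFin_Rintegral (intqm [::])) integral_mixed0//.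
set s := (lin a b0) ^+ 2 + (size (i :: l))%:R * tau a.
have sl : (lin a b0) ^+ 2 + (size l)%:R * tau a <= s.
  by rewrite /s lerD2l ler_wpM2r// ler_nat.
have s0 : 0 <= (lin a b0) ^+ 2 + (size l)%:R * tau a.
  by rewrite addr_ge0 ?sqr_ge0// mulr_ge0.
pose C1 := 16 * tau a; pose C2 := 16 * (c * gam a).
have h1 := integrableZlR C1 (ints l).
have h2 := integrableDR (intqm l) h1.
have h3 := integrableDR h2 (integrable_cstR (mixed l) C2).
apply: (@le_trans _ _ (\int[mixed l]_y (qtrunc ((lin a y.2) ^+ 2) +
    C1 * satur ((lin a y.2) ^+ 2) + C2))).
  rewrite -lee_fin (EFin_Rintegral (intqm (i :: l))) (EFin_Rintegral h3).
  rewrite (integral_mixed_cons _ _ _ i l mq q0).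
  apply: ge0_le_integral => //.
  - by move=> y _; apply: integral_ge0 => v _; exact: q0.
  - apply: (@measurable_fun_fubini_tonelli_F _ _ _ _ _ (rho i)
      (fun p => (qtrunc ((lin a (absorb kappa p).2) ^+ 2))%:E)) => //.
    exact: (measurableT_comp mq).
  - exact: measurable_int h3.
  - move=> y _ /=.
    under eq_integral do rewrite lin_addt.
    rewrite -EFin_Rintegral; last first.
      by apply: integrable_qtrunc => // v; exact: sqr_ge0.
    rewrite lee_fin; apply: le_trans (step_q i (lin a y.2) a) _.
    rewrite /C1 /C2; lra.
rewrite (RintegralD measurableT h2 (integrable_cstR (mixed l) C2)) Rintegral_cstT.
rewrite (RintegralD measurableT (intqm l) h1) (RintegralZl _ measurableT (ints l)).
have js : \int[mixed l]_y satur ((lin a y.2) ^+ 2) <= satur s.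
  apply: (@le_trans _ _ (satur (\int[mixed l]_y ((lin a y.2) ^+ 2)))).
    by apply: jensen_satur; [move=> y; exact: sqr_ge0|exact: int_mixed].
  by rewrite mixed_sqrR; exact: ler_satur.
have ss := ler_satur s0 sl.
have t0 := tau_ge0 a; have n0 := ler0n R (size l).
have e1 := ler_wpM2l t0 js.
have e2 : (size l)%:R * (tau a * satur (lin a b0 ^+ 2 + (size l)%:R * tau a))
    <= (size l)%:R * (tau a * satur s) by rewrite ler_wpM2l// ler_wpM2l.
have -> : (size (i :: l))%:R = (size l)%:R + 1 :> R by rewrite /= -natr1.
rewrite /C1 /C2; lra.
Qed.

(** Reduces the whole sum to a single vector at scale [N]: the variance part by convexity and
    Jensen, the truncated part by [qtrunc_superlinear]. Before [1 <= c] is used the coefficients are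
    [33] and [32 + 16 c], both at most [50 c]. *)
Let mixed_q_le l a (N : nat) : (0 < N)%N -> (size l <= N)%N ->
  \int[mixed l]_y qtrunc ((lin a y.2) ^+ 2) <=
    50 * c * (qtrunc ((lin a b0) ^+ 2) + \int[rho false]_v qtrunc (N%:R * lin a v ^+ 2)).
Proof.
move=> N0 lN; apply: le_trans (mixed_q l a) _.
set t := (lin a b0) ^+ 2; have t0 : 0 <= t by exact: sqr_ge0.
set n : R := (size l)%:R; set M : R := N%:R.
have n0 : 0 <= n by exact: ler0n.
have nM : n <= M by rewrite ler_nat.
have M1 : 1 <= M by rewrite ler1n.
have tau0 := tau_ge0 a.
have iM := integrableZlR M (int2 false a).
have M0 v : 0 <= M * lin a v ^+ 2 by rewrite mulr_ge0 ?sqr_ge0//; lra.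
set J := \int[rho false]_v qtrunc (M * lin a v ^+ 2).
have J1 : qtrunc (M * tau a) <= J.
  by rewrite /tau -(RintegralZl _ measurableT (int2 false a)); exact: jensen_qtrunc.
have J2 : M * gam a <= J.
  rewrite /gam -(RintegralZl _ measurableT (intq false a)); apply: le_Rintegral => //.
  - exact: (integrableZlR M (intq false a)).
  - exact: integrable_qtrunc.
  - by move=> v _; apply: qtrunc_superlinear => //; exact: sqr_ge0.
have nt0 : 0 <= n * tau a by rewrite mulr_ge0.
have Mt0 : 0 <= M * tau a by rewrite mulr_ge0//; lra.
have nMt : n * tau a <= M * tau a by rewrite ler_wpM2r.
have s1 : n * tau a * satur (t + n * tau a) <= qtrunc (t + M * tau a).
  rewrite /qtrunc ler_pM ?satur_ge0//; [by rewrite addr_ge0|lra|].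
  by apply: ler_satur; [rewrite addr_ge0|lra].
have s2 := qtruncD t0 Mt0.
have qt := qtrunc_ge0 t0; have qM := qtrunc_ge0 Mt0.
have g0 := gam_ge0 a.
have s3 : n * (c * gam a) <= c * J.
  have c0 : 0 <= c by exact: le_trans ler01 c1.
  have h : n * gam a <= J by apply: le_trans J2; rewrite ler_wpM2r.
  by rewrite mulrCA ler_wpM2l.
have J0 : 0 <= J by lra.
have cq := ler_wpM2r qt c1; have cJ := ler_wpM2r J0 c1.
lra.
Qed.

Section test_function.
Variables (f : R -> R) (Cf : R).
Hypotheses (mf : measurable_fun setT f) (fb : forall x, 0 <= f x <= 1).
Hypotheses (Cf0 : 0 <= Cf) (ft : taylor2_fun f Cf).
Variable delta : R.
Hypothesis delta0 : 0 < delta.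
Let cd : R := 1 + delta ^- 2.

Let cd0 : 0 <= cd.
Proof. by rewrite addr_ge0// invr_ge0 exprn_ge0// ltW. Qed.

Let intf d (T : measurableType d) (mu : probability T R) (g : T -> R) :
  measurable_fun setT g -> mu.-integrable setT (EFin \o (fun x => f (g x))).
Proof.
move=> mg; apply: (@bounded_integrable _ _ _ _ _ 1); first exact: measurableT_comp.
by move=> x; have /andP[? ?] := fb (g x); rewrite ger0_norm.
Qed.

Let mAlin A (a : 'I_K -> R) : measurable_fun setT (fun v => A + lin a v).
Proof. by apply: measurable_funD => //; exact: measurable_lin. Qed.

(** Both expectations are compared with [f A + f2 A * tau a], the second-order expansion common to
    the two laws. *)
Let taylor_swap A a :
  `|\int[rho false]_v f (A + lin a v) - \int[rho true]_v f (A + lin a v)| <=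
    2 * Cf * delta * tau a + Cf * cd * (1 + c) * gam a.
Proof.
have [f1 [f2 H]] := ft.
have key i : `|\int[rho i]_v f (A + lin a v) - (f A + f2 A * tau a)| <=
    Cf * (delta * tau a + cd * \int[rho i]_v qtrunc (lin a v ^+ 2)).
  have h1 := integrableZlR (f1 A) (int1 i a).
  have h2 := integrableZlR (f2 A) (int2 i a).
  have h3 := integrableDR (integrable_cstR (rho i) (f A)) h1.
  have h4 := integrableDR h3 h2.
  have -> : f A + f2 A * tau a = \int[rho i]_v (f A + f1 A * lin a v + f2 A * lin a v ^+ 2).
    rewrite (RintegralD measurableT h3 h2).
    rewrite (RintegralD measurableT (integrable_cstR (rho i) (f A)) h1) Rintegral_cstT.
    rewrite (RintegralZl _ measurableT (int1 i a)) (RintegralZl _ measurableT (int2 i a)).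
    by rewrite mean0 mulr0 addr0 tauE.
  have h0 := intf (rho i) (mAlin A a).
  rewrite -(RintegralB measurableT h0 h4).
  have h5 := integrableBR h0 h4.
  apply: le_trans (le_normr_Rintegral measurableT h5) _.
  have k1 := integrableZlR delta (int2 i a); have k2 := integrableZlR cd (intq i a).
  have k3 := integrableDR k1 k2.
  apply: (@le_trans _ _ (\int[rho i]_v (Cf * (delta * lin a v ^+ 2 + cd * qtrunc (lin a v ^+ 2))))).
    apply: le_Rintegral => //.
    - exact: (integrable_norm h5).
    - exact: (integrableZlR Cf k3).
    move=> v _; apply: (@le_trans _ _ (Cf * Num.min (lin a v ^+ 2) (`|lin a v| ^+ 3))).
      apply: le_trans (H A (lin a v)); rewrite le_eqVlt; apply/orP; left; apply/eqP.
      by congr `|_|; ring.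
    by rewrite ler_wpM2l//; exact: min_sqr_cube.
  rewrite (RintegralZl _ measurableT k3) (RintegralD measurableT k1 k2).
  rewrite (RintegralZl _ measurableT (int2 i a)) (RintegralZl _ measurableT (intq i a)).
  by rewrite tauE.
have k0 := key false; have k1 := key true.
have e1 : Cf * (cd * \int[rho true]_v qtrunc (lin a v ^+ 2)) <= Cf * (cd * (c * gam a)).
  by rewrite ler_wpM2l// ler_wpM2l.
have g0 := gam_ge0 a.
move: k0 k1; rewrite -/(gam a) !ler_norml => /andP[? ?] /andP[? ?]; lra.
Qed.

Let Fint l := \int[mixed l]_y f y.1.

Let intF l : (mixed l).-integrable setT (EFin \o (fun y : Y => f y.1)).
Proof. exact: intf. Qed.

(** [T] bounds second moments and [Q] truncated ones; index 1 pairs the starting vector with a draw,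
    index 2 pairs two independent draws. *)
Variables (N : nat) (T1 T2 Q1 Q2 : R).
Hypothesis N0 : (0 < N)%N.
Hypothesis HT1 : (\int[rho false]_v (bilin kappa b0 v ^+ 2)%:E <= T1%:E)%E.
Hypothesis HT2 : (\int[rho false]_v \int[rho false]_w (bilin kappa v w ^+ 2)%:E <= T2%:E)%E.
Hypothesis HQ1 : (\int[rho false]_v (qtrunc (bilin kappa b0 v ^+ 2))%:E <= Q1%:E)%E.
Hypothesis HQ2 : (\int[rho false]_v \int[rho false]_w
  (qtrunc (N%:R * bilin kappa v w ^+ 2))%:E <= Q2%:E)%E.

Let mB : measurable_fun setT (fun p : Y * V => bilin kappa p.1.2 p.2).
Proof.
by apply: measurable_bilin => //; exact: measurableT_comp measurable_snd measurable_fst.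
Qed.

Let mB2 : measurable_fun setT (fun p : Y * V => (bilin kappa p.1.2 p.2 ^+ 2)%:E).
Proof. by apply/measurable_EFinP; apply: measurable_funX; exact: mB. Qed.

Let mBq : measurable_fun setT (fun p : Y * V => (qtrunc (bilin kappa p.1.2 p.2 ^+ 2))%:E).
Proof.
apply/measurable_EFinP; apply: measurable_qtrunc; last by move=> p; exact: sqr_ge0.
by apply: measurable_funX; exact: mB.
Qed.

Let mBB2 : measurable_fun setT (fun p : V * V => (bilin kappa p.1 p.2 ^+ 2)%:E).
Proof. by apply/measurable_EFinP; apply: measurable_funX; exact: measurable_bilin. Qed.

Let mBBq : measurable_fun setT (fun p : V * V => (qtrunc (N%:R * bilin kappa p.1 p.2 ^+ 2))%:E).
Proof.
apply/measurable_EFinP; apply: measurable_qtrunc.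
  apply: measurable_funM => //.
  by apply: measurable_funX; exact: measurable_bilin.
by move=> p; rewrite mulr_ge0 ?sqr_ge0.
Qed.

(** Tonelli integrates the state first. For a fixed fresh vector the pairing is a linear form in the
    accumulated sum, to which [mixed_sqr] applies. *)
Let mixed_T l : (size l <= N)%N ->
  (\int[mixed l]_y \int[rho false]_v (bilin kappa y.2 v ^+ 2)%:E <= (T1 + N%:R * T2)%:E)%E.
Proof.
move=> lN.
rewrite (fubini_tonelli _ mB2); last by move=> p; rewrite lee_fin sqr_ge0.
have E v : (\int[mixed l]_y (bilin kappa y.2 v ^+ 2)%:E =
    (bilin kappa b0 v ^+ 2)%:E + (size l)%:R%:E * \int[rho false]_w (bilin kappa v w ^+ 2)%:E)%E.
  under eq_integral do rewrite bilinC.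
  by rewrite mixed_sqr -/(bilin kappa v b0) bilinC EFinD (EFinM (size l)%:R) tau_EFin.
under eq_integral do rewrite /= E.
have mb0 : measurable_fun setT (fun v : V => (bilin kappa b0 v ^+ 2)%:E).
  by apply/measurable_EFinP; apply: measurable_funX; exact: measurable_lin.
have n0 : 0 <= (size l)%:R :> R by exact: ler0n.
have I0 v : (0 <= \int[rho false]_w (bilin kappa v w ^+ 2)%:E)%E.
  by apply: integral_ge0 => w _; rewrite lee_fin sqr_ge0.
have mI : measurable_fun setT (fun v => \int[rho false]_w (bilin kappa v w ^+ 2)%:E)%E.
  by apply: (measurable_inner_integral (rho false) mBB2) => p; rewrite lee_fin sqr_ge0.
rewrite ge0_integralD//; first last.
- by apply: emeasurable_funM.
- by move=> v _; rewrite mule_ge0.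
- by move=> v _; rewrite lee_fin sqr_ge0.
rewrite ge0_integralZl_EFin// EFinD (EFinM N%:R); apply: leeD => //.
by apply: lee_pmul => //; [exact: integral_ge0|rewrite lee_fin ler_nat].
Qed.

(** Same exchange as in [mixed_T], with [mixed_q_le] for the inner integral. *)
Let mixed_Q l : (size l <= N)%N ->
  (\int[mixed l]_y \int[rho false]_v (qtrunc (bilin kappa y.2 v ^+ 2))%:E <=
   (50 * c * (Q1 + Q2))%:E)%E.
Proof.
move=> lN.
have q0 (x : R) : 0 <= qtrunc (x ^+ 2) by rewrite qtrunc_ge0// sqr_ge0.
rewrite (fubini_tonelli _ mBq); last by move=> p; rewrite lee_fin.
have c0 : 0 <= 50 * c by rewrite mulr_ge0//; exact: le_trans c1.
have Nq0 v w : (0 <= (qtrunc (N%:R * bilin kappa v w ^+ 2))%:E)%E.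
  by rewrite lee_fin qtrunc_ge0// mulr_ge0 ?sqr_ge0.
have I0 v : (0 <= \int[rho false]_w (qtrunc (N%:R * bilin kappa v w ^+ 2))%:E)%E.
  by apply: integral_ge0 => w _.
have mI : measurable_fun setT (fun v =>
    \int[rho false]_w (qtrunc (N%:R * bilin kappa v w ^+ 2))%:E)%E.
  exact: (measurable_inner_integral (rho false) mBBq (fun=> Nq0 _ _)).
have mb0 : measurable_fun setT (fun v : V => (qtrunc (bilin kappa b0 v ^+ 2))%:E).
  apply/measurable_EFinP; apply: measurable_qtrunc; last by move=> v; exact: sqr_ge0.
  by apply: measurable_funX; exact: measurable_lin.
apply: (@le_trans _ _ (\int[rho false]_v ((50 * c)%:E * ((qtrunc (bilin kappa b0 v ^+ 2))%:E +
   \int[rho false]_w (qtrunc (N%:R * bilin kappa v w ^+ 2))%:E)))%E).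
  apply: ge0_le_integral => //.
  - by move=> v _; apply: integral_ge0 => y _; rewrite lee_fin.
  - by apply: (measurable_outer_integral (mixed l) mBq) => p; rewrite lee_fin.
  - apply: emeasurable_funM => //; exact: emeasurable_funD.
  - move=> v _ /=.
    have iq : (mixed l).-integrable setT
        (EFin \o (fun y : Y => qtrunc ((lin (weight kappa v) y.2) ^+ 2))).
      by apply: integrable_qtrunc; [move=> y; exact: sqr_ge0|exact: int_mixed].
    have iN : (rho false).-integrable setT
        (EFin \o (fun w => qtrunc (N%:R * lin (weight kappa v) w ^+ 2))).
      apply: integrable_qtrunc; last exact: (integrableZlR N%:R (int2 _ _)).
      by move=> w; rewrite mulr_ge0 ?sqr_ge0.
    under eq_integral do rewrite bilinC.
    rewrite -[leLHS](EFin_Rintegral iq) -[X in (_ + X)%E](EFin_Rintegral iN).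
    rewrite -EFinD -EFinM lee_fin bilinC; exact: mixed_q_le.
rewrite ge0_integralZl_EFin//; first last.
- exact: emeasurable_funD.
- by move=> v _; rewrite adde_ge0// lee_fin.
rewrite ge0_integralD//; last by move=> v _; rewrite lee_fin.
by rewrite [leRHS]EFinM EFinD; apply: lee_wpmul2l => //; exact: leeD.
Qed.

Let swap_error := 2 * Cf * delta * (T1 + N%:R * T2) + Cf * cd * (1 + c) * (50 * c * (Q1 + Q2)).

(** One-sided, but for both values of [i], which together bound the absolute difference. The error
    is [taylor_swap] averaged over the state. *)
Let swap_le i l : (size l <= N)%N ->
  (\int[mixed (i :: l)]_y (f y.1)%:E <= \int[mixed (~~ i :: l)]_y (f y.1)%:E + swap_error%:E)%E.
Proof.
move=> lN.
have F0 (y : Y) : (0 <= (f y.1)%:E)%E by rewrite lee_fin; case/andP: (fb y.1).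
have mF : measurable_fun setT (fun y : Y => (f y.1)%:E).
  by apply/measurable_EFinP; exact: measurableT_comp.
have p1 : 0 <= 2 * Cf * delta by rewrite !mulr_ge0// ltW.
have c0 : 0 <= 1 + c by rewrite addr_ge0//; exact: le_trans c1.
have p2 : 0 <= Cf * cd * (1 + c) by rewrite !mulr_ge0.
pose h (y : Y) := ((2 * Cf * delta)%:E * \int[rho false]_v (bilin kappa y.2 v ^+ 2)%:E +
  (Cf * cd * (1 + c))%:E * \int[rho false]_v (qtrunc (bilin kappa y.2 v ^+ 2))%:E)%E.
have s0 (x : R) : (0 <= (x ^+ 2)%:E)%E by rewrite lee_fin sqr_ge0.
have q0 (x : R) : (0 <= (qtrunc (x ^+ 2))%:E)%E by rewrite lee_fin qtrunc_ge0// sqr_ge0.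
have m1 : measurable_fun setT (fun y : Y => \int[rho false]_v (bilin kappa y.2 v ^+ 2)%:E)%E.
  exact: (measurable_inner_integral (rho false) mB2 (fun=> s0 _)).
have m2 : measurable_fun setT (fun y : Y =>
    \int[rho false]_v (qtrunc (bilin kappa y.2 v ^+ 2))%:E)%E.
  exact: (measurable_inner_integral (rho false) mBq (fun=> q0 _)).
have h1 (y : Y) : (0 <= (2 * Cf * delta)%:E * \int[rho false]_v (bilin kappa y.2 v ^+ 2)%:E)%E.
  by rewrite mule_ge0// integral_ge0.
have h2 (y : Y) : (0 <= (Cf * cd * (1 + c))%:E *
    \int[rho false]_v (qtrunc (bilin kappa y.2 v ^+ 2))%:E)%E.
  by rewrite mule_ge0// integral_ge0.
have mh1 : measurable_fun setT (fun y : Y => (2 * Cf * delta)%:E *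
    \int[rho false]_v (bilin kappa y.2 v ^+ 2)%:E)%E by exact: emeasurable_funM.
have mh2 : measurable_fun setT (fun y : Y => (Cf * cd * (1 + c))%:E *
    \int[rho false]_v (qtrunc (bilin kappa y.2 v ^+ 2))%:E)%E by exact: emeasurable_funM.
have mh : measurable_fun setT h by exact: emeasurable_funD.
have Ih : (\int[mixed l]_y h y <= swap_error%:E)%E.
  rewrite ge0_integralD// !ge0_integralZl_EFin//.
  - rewrite /swap_error EFinD (EFinM (2 * Cf * delta)) (EFinM (Cf * cd * (1 + c))).
    by apply: leeD; apply: lee_wpmul2l => //; [exact: mixed_T|exact: mixed_Q].
  - by move=> y _; exact: integral_ge0.
  - by move=> y _; exact: integral_ge0.
have mFa : measurable_fun setT (fun p : Y * V => (f (absorb kappa p).1)%:E).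
  by apply: (measurableT_comp mF).
have mI j := measurable_inner_integral (rho j) mFa (fun p => F0 (absorb kappa p)).
have I0 j y : (0 <= \int[rho j]_v (f (absorb kappa (y, v)).1)%:E)%E.
  by apply: integral_ge0 => v _.
rewrite (integral_mixed_cons _ _ _ i l mF F0) (integral_mixed_cons _ _ _ (~~ i) l mF F0).
apply: le_trans (leeD (lexx _) Ih).
rewrite -ge0_integralD//; last by move=> y _; rewrite /h adde_ge0.
apply: ge0_le_integral => //; first by apply: emeasurable_funD => //; exact: mI.
move=> y _; rewrite /h /=.
have mfa := mAlin y.1 (weight kappa y.2).
have fE j : (\int[rho j]_v (f (y.1 + bilin kappa y.2 v))%:E =
    (\int[rho j]_v f (y.1 + lin (weight kappa y.2) v))%:E)%E.
  exact/esym/(EFin_Rintegral (intf (rho j) mfa)).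
rewrite !fE /bilin -tau_EFin -gam_EFin.
rewrite -!EFinM -!EFinD lee_fin.
have := taylor_swap y.1 (weight kappa y.2); rewrite /bilin /tau /gam ler_norml => /andP[u1 u2].
by case: (i) => /=; lra.
Qed.

Lemma lindeberg_swapping :
  `|\int[mixed (nseq N false)]_y f y.1 - \int[mixed (nseq N true)]_y f y.1| <=
  N%:R * swap_error.
Proof.
have F0 (y : Y) : (0 <= (f y.1)%:E)%E by rewrite lee_fin; case/andP: (fb y.1).
have mF : measurable_fun setT (fun y : Y => (f y.1)%:E).
  by apply/measurable_EFinP; exact: measurableT_comp.
(* [path 0] and [path N] are the two pure chains; consecutive paths differ in one entry, moved to
   the head by [integral_mixed_cat]. *)
pose path k := nseq k true ++ nseq (N - k) false.
have step k : (k < N)%N -> `|Fint (path k) - Fint (path k.+1)| <= swap_error.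
  move=> kN; pose l := nseq k true ++ nseq (N - k.+1) false.
  have sl : (size l <= N)%N.
    by rewrite size_cat !size_nseq -[leqRHS](subnKC (ltnW kN)) leq_add2l leq_sub2l.
  have E i : (\int[mixed (nseq k true ++ i :: nseq (N - k.+1) false)]_y (f y.1)%:E =
      \int[mixed (i :: l)]_y (f y.1)%:E)%E by exact: integral_mixed_cat.
  have p0 : path k = nseq k true ++ false :: nseq (N - k.+1) false.
    by rewrite /path subnS; case: (N - k)%N (subn_gt0 k N) => //; rewrite kN.
  have p1 : path k.+1 = nseq k true ++ true :: nseq (N - k.+1) false.
    have rn j : rcons (nseq j true) true = nseq j.+1 true by elim: j => //= j ->.
    by rewrite /path -rn cat_rcons.
  have := swap_le false sl; have := swap_le true sl.
  rewrite /= -!E -p0 -p1 -!(EFin_Rintegral (intF _)) -!EFinD !lee_fin -!/(Fint _) ler_norml.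
  by move=> ? ?; apply/andP; split; lra.
have tele k : (k <= N)%N -> `|Fint (path 0) - Fint (path k)| <= k%:R * swap_error.
  elim: k => [_|k IH kN]; first by rewrite subrr normr0 mul0r.
  rewrite -natr1 mulrDl mul1r.
  have -> : Fint (path 0) - Fint (path k.+1) =
    (Fint (path 0) - Fint (path k)) + (Fint (path k) - Fint (path k.+1)) by ring.
  by apply: le_trans (ler_normD _ _) _; rewrite lerD ?step// IH// ltnW.
have := tele N (leqnn N); rewrite /path subn0 subnn cats0; exact.
Qed.

End test_function.
End lindeberg.

(** * Gaussian vectors *)

Section gaussian_image.
Context {R : realType} {K' : nat}.
Local Notation K := K'.+1.
Local Notation V := (K.-tuple R).
Local Notation N01 := (@std_normal R).
Variable A : 'M[R]_K.

(* [A *m z] is the sum over [k] of [z k] times the [k]-th column of [A]. *)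
Definition add_column (k : nat) (p : V * R) : V :=
  addt p.1 [tuple A l (inord k) * p.2 | l < K].

Lemma measurable_add_column k : measurable_fun setT (add_column k).
Proof.
apply: measurable_addt => //; apply/measurable_fun_tnthP => l.
rewrite (_ : _ \o _ = fun p : V * R => A l (inord k) * p.2); last first.
  by apply/funext => p /=; rewrite tnth_mktuple.
exact: measurable_funM.
Qed.

HB.instance Definition _ k :=
  isMeasurableFun.Build _ _ _ _ (add_column k) (measurable_add_column k).

Definition zero_tuple : V := [tuple 0 | _ < K].

Definition gaussian_image : probability V R :=
  fold_law add_column N01 zero_tuple K.

Let s (a : 'I_K -> R) k : R := \sum_(l < K) a l * A l (inord k).

Let lin_add_column a k y x : lin a (add_column k (y, x)) = lin a y + s a k * x.
Proof.
rewrite lin_addt; congr (_ + _); rewrite mulr_suml; apply: eq_bigr => l _.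
by rewrite tnth_mktuple mulrA.
Qed.

Let lin0 a : lin a zero_tuple = 0.
Proof. by rewrite /lin big1// => l _; rewrite tnth_mktuple mulr0. Qed.

Let M k := fold_law add_column N01 zero_tuple k.
Let S2 a k := \sum_(j < k) (s a j) ^+ 2.

Let S2_ge0 a k : 0 <= S2 a k.
Proof. by apply: sumr_ge0 => j _; exact: sqr_ge0. Qed.

(** The shift [t] is there to recover the mean: the cases [t = 0] and [t = 1] differ by 1 plus twice
    the first moment. *)
Let sqr_moment t a k : (\int[M k]_y ((t + lin a y) ^+ 2)%:E = (t ^+ 2 + S2 a k)%:E)%E.
Proof.
have mf : measurable_fun setT (fun y : V => ((t + lin a y) ^+ 2)%:E).
  apply/measurable_EFinP; apply: measurable_funX; apply: measurable_funD => //.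
  exact: measurable_lin.
have f0 (y : V) : (0 <= ((t + lin a y) ^+ 2)%:E)%E by rewrite lee_fin sqr_ge0.
elim: k => [|k IH].
  by rewrite integral_fold_law0// lin0 /S2 big_ord0 !addr0.
rewrite integral_fold_lawS//.
under eq_integral => y _.
  rewrite (_ : (\int[N01]_x _)%E = ((t + lin a y) ^+ 2 + (s a k) ^+ 2)%:E); last first.
    set B := t + lin a y.
    have h1 := integrableZlR (2 * B * s a k) (@integrable_normal_X R).
    have h2 := integrableZlR ((s a k) ^+ 2) (@integrable_normal_X2 R).
    have h3 := integrableDR (integrable_cstR N01 (B ^+ 2)) h1.
    transitivity (\int[N01]_x (B ^+ 2 + 2 * B * s a k * x + (s a k) ^+ 2 * x ^+ 2)%:E)%E.
      apply: eq_integral => x _; rewrite lin_add_column addrA -/B; congr (_%:E); ring.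
    rewrite -(EFin_Rintegral (integrableDR h3 h2)); congr (_%:E).
    rewrite (RintegralD measurableT h3 h2).
    rewrite (RintegralD measurableT (integrable_cstR N01 (B ^+ 2)) h1) Rintegral_cstT.
    rewrite (RintegralZl _ measurableT (@integrable_normal_X R)).
    rewrite (RintegralZl _ measurableT (@integrable_normal_X2 R)).
    by rewrite normal_mean normal_variance mulr0 addr0 mulr1.
  rewrite EFinD; over.
rewrite ge0_integralD//; last by move=> y _; rewrite lee_fin sqr_ge0.
by rewrite -/(M k) IH integral_cstT -EFinD /S2 big_ord_recr /= addrA.
Qed.

Let sqr_moment0 a k : (\int[M k]_y ((lin a y) ^+ 2)%:E = (S2 a k)%:E)%E.
Proof.
have := sqr_moment 0 a k; rewrite expr0n add0r => <-.
by apply: eq_integral => y _; rewrite add0r.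
Qed.

(** Chosen so that [c4 v^2 + 8 u v + 3 m u^2 <= c4 (v + u)^2], where [m] is the fourth moment of the
    standard normal law: the induction step of [moment4]. *)
Let c4 : R := 8 + 3 * \int[N01]_x (x ^+ 4).

Let m4_ge0 : 0 <= \int[N01]_x (x ^+ 4 : R).
Proof. by apply: Rintegral_ge0 => x _; rewrite exprn_even_ge0. Qed.

Let moment4 a k : (\int[M k]_y ((lin a y) ^+ 4)%:E <= (c4 * (S2 a k) ^+ 2)%:E)%E.
Proof.
have mf : measurable_fun setT (fun y : V => ((lin a y) ^+ 4)%:E).
  apply/measurable_EFinP; apply: measurable_funX; exact: measurable_lin.
have f0 (y : V) : (0 <= ((lin a y) ^+ 4)%:E)%E by rewrite lee_fin exprn_even_ge0.
have m20 := S2_ge0 a.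
elim: k => [|k IH].
  by rewrite integral_fold_law0// lin0 /S2 big_ord0 !expr0n mulr0.
rewrite integral_fold_lawS//.
set m4 := \int[N01]_x (x ^+ 4).
pose C := 8 * (s a k) ^+ 2; pose D := 3 * (s a k) ^+ 4 * m4.
have C0 : 0 <= C by rewrite mulr_ge0// sqr_ge0.
have s4 : 0 <= (s a k) ^+ 4 by rewrite exprn_even_ge0.
have D0 : 0 <= D by rewrite mulr_ge0// mulr_ge0.
have mg : measurable_fun setT (fun y : V => ((lin a y) ^+ 2)%:E).
  apply/measurable_EFinP; apply: measurable_funX; exact: measurable_lin.
have mfa : measurable_fun setT (fun p : V * R => ((lin a (add_column k p)) ^+ 4)%:E).
  exact: (measurableT_comp mf).
apply: (@le_trans _ _ (\int[M k]_y (((lin a y) ^+ 4)%:E + (C%:E * ((lin a y) ^+ 2)%:E + D%:E)))%E).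
  apply: ge0_le_integral => //.
  - by move=> y _; exact: integral_ge0.
  - exact: (measurable_inner_integral N01 mfa).
  - by apply: emeasurable_funD => //; apply: emeasurable_funD => //; exact: emeasurable_funM.
  move=> y _; set B := lin a y; set t := s a k.
  have h1 := integrableZlR (4 * B ^+ 3 * t) (@integrable_normal_X R).
  have h2 := integrableZlR (8 * B ^+ 2 * t ^+ 2) (@integrable_normal_X2 R).
  have h3 := integrableZlR (3 * t ^+ 4) (@integrable_normal_X4 R).
  have k1 := integrableDR (integrable_cstR N01 (B ^+ 4)) h1.
  have k2 := integrableDR k1 h2.
  have k3 := integrableDR k2 h3.
  apply: (@le_trans _ _ (\int[N01]_x (B ^+ 4 + 4 * B ^+ 3 * t * x +
      8 * B ^+ 2 * t ^+ 2 * x ^+ 2 + 3 * t ^+ 4 * x ^+ 4)%:E)%E).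
    apply: ge0_le_integral => //.
    - exact: (measurableT_comp mfa).
    - exact: measurable_int k3.
    - move=> x _; rewrite lin_add_column lee_fin -/B -/t.
      (* Twice this square absorbs the odd term [4 B z^3] of [(B + z)^4], so the third moment never
         enters. *)
      have := sqr_ge0 (B * (t * x) - (t * x) ^+ 2); set z := t * x.
      rewrite (_ : 4 * B ^+ 3 * t * x = 4 * B ^+ 3 * z); last by rewrite /z; ring.
      rewrite (_ : 8 * B ^+ 2 * t ^+ 2 * x ^+ 2 = 8 * B ^+ 2 * z ^+ 2); last by rewrite /z; ring.
      rewrite (_ : 3 * t ^+ 4 * x ^+ 4 = 3 * z ^+ 4); last by rewrite /z; ring.
      rewrite -[_ <= B ^+ 4 + _ + _ + _]subr_ge0.
      rewrite [X in _ -> _ <= X](_ : _ = 2 * (B * z - z ^+ 2) ^+ 2); last by ring.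
      by move=> ?; rewrite mulr_ge0.
  rewrite -(EFin_Rintegral k3) -EFinM -!EFinD lee_fin.
  rewrite (RintegralD measurableT k2 h3) (RintegralD measurableT k1 h2).
  rewrite (RintegralD measurableT (integrable_cstR N01 (B ^+ 4)) h1) Rintegral_cstT.
  rewrite (RintegralZl _ measurableT (@integrable_normal_X R)).
  rewrite (RintegralZl _ measurableT (@integrable_normal_X2 R)).
  rewrite (RintegralZl _ measurableT (@integrable_normal_X4 R)).
  rewrite normal_mean normal_variance /C /D -/t -/m4; lra.
have g0 (y : V) : (0 <= ((lin a y) ^+ 2)%:E)%E by rewrite lee_fin sqr_ge0.
rewrite ge0_integralD//; first last.
- by apply: emeasurable_funD => //; exact: emeasurable_funM.
- by move=> y _; rewrite adde_ge0// mule_ge0.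
rewrite ge0_integralD//; first last.
- exact: emeasurable_funM.
- by move=> y _; rewrite mule_ge0.
rewrite ge0_integralZl_EFin// sqr_moment0 integral_cstT.
apply: (le_trans (leeD IH (lexx _))).
rewrite -EFinM -!EFinD lee_fin.
have -> : S2 a k.+1 = S2 a k + s a k ^+ 2 by rewrite /S2 big_ord_recr.
rewrite /C /D /c4 -/m4 (_ : s a k ^+ 4 = (s a k ^+ 2) ^+ 2); last by ring.
have := m20 k; have := sqr_ge0 (s a k); have m40 : 0 <= m4 := m4_ge0.
set u := s a k ^+ 2; set v := S2 a k => u0 v0.
have uv := mulr_ge0 u0 v0; have uu := mulr_ge0 u0 u0; have muv := mulr_ge0 m40 uv.
lra.
Qed.

Let Aa2 a : \sum_(j < K) (s a j) ^+ 2 = \sum_(l < K) \sum_(m < K) a l * a m * (A *m A^T) l m.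
Proof.
rewrite /s; under eq_bigr => j _.
  rewrite expr2 mulr_suml.
  under eq_bigr => l _.
    rewrite mulr_sumr.
    over.
  over.
rewrite exchange_big; apply: eq_bigr => l _.
rewrite exchange_big; apply: eq_bigr => m _.
rewrite mxE mulr_sumr; apply: eq_bigr => j _.
by rewrite mxE !inord_val; ring.
Qed.

Lemma gaussian_image_integrable a :
  gaussian_image.-integrable setT (EFin \o (fun v => lin a v ^+ 2)).
Proof.
apply/integrableP; split.
  by apply/measurable_EFinP; apply: measurable_funX; exact: measurable_lin.
apply: (@le_lt_trans _ _ (S2 a K)%:E); last exact: ltry.
rewrite -(sqr_moment0 a K) le_eqVlt; apply/orP; left; apply/eqP.
by apply: eq_integral => v _; rewrite /= ger0_norm ?sqr_ge0.
Qed.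

Lemma gaussian_image_variance a : \int[gaussian_image]_v (lin a v ^+ 2) =
  \sum_(l < K) \sum_(m < K) a l * a m * (A *m A^T) l m.
Proof.
rewrite -Aa2; apply: EFin_inj; rewrite (EFin_Rintegral (gaussian_image_integrable a)).
exact: (sqr_moment0 a K).
Qed.

Lemma gaussian_image_mean a : \int[gaussian_image]_v lin a v = 0.
Proof.
have i2 := gaussian_image_integrable a.
have i1 := integrable_of_sqr (measurable_lin a) i2.
have h1 := integrableZlR 2 i1.
have h2 := integrableDR (integrable_cstR gaussian_image 1) h1.
have h3 := integrableDR h2 i2.
have : \int[gaussian_image]_v (1 + 2 * lin a v + lin a v ^+ 2) = 1 + S2 a K.
  apply: EFin_inj; rewrite (EFin_Rintegral h3).
  rewrite -[1 in RHS](expr1n _ 2) -(sqr_moment 1 a K).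
  by apply: eq_integral => v _; congr (_%:E); ring.
rewrite (RintegralD measurableT h2 i2).
rewrite (RintegralD measurableT (integrable_cstR gaussian_image 1) h1) Rintegral_cstT.
rewrite (RintegralZl _ measurableT i1) gaussian_image_variance -Aa2 -/(S2 a K); lra.
Qed.

(** Reverse Jensen inequality: the left side is at most the variance and, through the fourth moment,
    at most [c4] times its square; [qtrunc_min] combines the two. *)
Lemma gaussian_image_qtrunc a : \int[gaussian_image]_v qtrunc (lin a v ^+ 2) <=
  2 * (1 + c4) * qtrunc (\int[gaussian_image]_v (lin a v ^+ 2)).
Proof.
have i2 := gaussian_image_integrable a.
have iq : gaussian_image.-integrable setT (EFin \o (fun v => qtrunc (lin a v ^+ 2))).
  by apply: integrable_qtrunc => // v; exact: sqr_ge0.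
have v2 : \int[gaussian_image]_v (lin a v ^+ 2) = S2 a K.
  by rewrite gaussian_image_variance -Aa2.
have c40 : 0 <= c4 by rewrite /c4 addr_ge0// mulr_ge0.
rewrite v2; apply: le_trans (qtrunc_min c40 (S2_ge0 a K)).
rewrite le_min; apply/andP; split.
  rewrite -v2; apply: le_Rintegral => // v _.
  by apply: qtrunc_le; exact: sqr_ge0.
rewrite -lee_fin (EFin_Rintegral iq); apply: le_trans (moment4 a K).
apply: ge0_le_integral => //.
- by move=> v _; rewrite lee_fin qtrunc_ge0// sqr_ge0.
- exact: measurable_int iq.
- apply/measurable_EFinP; apply: measurable_funX; exact: measurable_lin.
move=> v _; rewrite lee_fin; apply: le_trans (qtrunc_le_sqr (sqr_ge0 _)) _.
by rewrite -exprM.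
Qed.

Definition gaussian_qconst : R := 2 * (1 + c4).

Lemma gaussian_image_law d (S : measurableType d) (Q : probability S R)
    (eta : {RV Q >-> V}) :
  std_gaussian_vector Q eta -> forall C : set V, measurable C ->
  Q ((fun w => [tuple \sum_k A l k * tnth (eta w) k | l < K]) @^-1` C) = gaussian_image C.
Proof.
move=> [ind law] C mC.
have mX k : measurable_fun setT (fun w => tnth (eta w) (inord k : 'I_K)).
  exact: measurableT_comp (measurable_tnth _) _.
pose X k : {mfun S >-> R} := HB.pack (fun w => tnth (eta w) (inord k : 'I_K))
  (isMeasurableFun.Build _ _ _ _ _ (mX k)).
have XE (k : 'I_K) : (X k : S -> R) = (fun w => tnth (eta w) k).
  by apply/funext => w /=; rewrite inord_val.
have ind' : independent_rvs Q (fun i : 'I_K => X i).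
  by move=> B mB; under eq_bigcapr do rewrite XE; under eq_bigr do rewrite XE; exact: ind.
have law' i B : (i < K)%N -> measurable B -> Q (X i @^-1` B) = N01 B.
  by move=> iK mB; have := law (Ordinal iK) B mB; rewrite -XE.
have E w : [tuple \sum_k A l k * tnth (eta w) k | l < K] = rfold add_column zero_tuple X K w.
  apply: eq_from_tnth => l; rewrite tnth_mktuple.
  have H n : tnth (rfold add_column zero_tuple X n w) l =
      \sum_(k < n) A l (inord k) * tnth (eta w) (inord k).
    elim: n => [|n IH]; first by rewrite big_ord0 /= tnth_mktuple.
    by rewrite big_ord_recr /= !tnth_mktuple /= IH.
  by rewrite H; apply: eq_bigr => k _; rewrite inord_val.
rewrite -[RHS](rfold_fold_law add_column zero_tuple ind' law' mC).
by congr (Q _); apply/seteqP; split => w /=; rewrite E.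
Qed.

End gaussian_image.

(** * Pairs of observations and conditional expectations *)

Section pair_law.
Context {R : realType} {d} {T : measurableType d} {d'} {E : measurableType d'}.
Variables (P : probability T R) (I : finType) (X : I -> {mfun T >-> E}).
Variable rho : probability E R.
Hypothesis X_indep : independent_rvs P (fun i => X i).
Hypothesis X_law : forall i A, measurable A -> P (X i @^-1` A) = rho A.
Variables (i j : I).
Hypothesis ij : i != j.

Let mX k A : measurable A -> measurable (X k @^-1` A).
Proof. by move=> mA; rewrite -[_ @^-1` _]setTI; exact: measurable_funPT. Qed.

Let mpair : measurable_fun setT (fun w => (X i w, X j w)).
Proof. exact: measurable_fun_pair. Qed.

Let Z : {mfun T >-> (E * E)%type} := HB.pack (fun w => (X i w, X j w))
  (isMeasurableFun.Build _ _ _ _ _ mpair).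

Let joint A B : measurable A -> measurable B ->
  P (X i @^-1` A `&` X j @^-1` B) = (rho A * rho B)%E.
Proof.
move=> mA mB.
pose F k := if k == i then A else if k == j then B else setT.
have mF k : measurable (F k) by rewrite /F; do 2 case: ifP => // _.
have := X_indep mF; under [in RHS]eq_bigr do rewrite X_law//.
rewrite (bigD1 i)//= (bigD1 j) 1?eq_sym//= big1 ?mule1; last first.
  by move=> k /andP[ki kj]; rewrite /F (negbTE ki) (negbTE kj) probability_setT.
rewrite {2 3}/F eqxx eq_sym (negbTE ij) eqxx => <-.
congr (P _); apply/seteqP; split => [w [wi wj] k _ /=|w h]; last first.
  by split; [have := h i Logic.I; rewrite /F/= eqxx
    |have := h j Logic.I; rewrite /F/= eq_sym (negbTE ij) eqxx].
by rewrite /F; have [->//|_] := eqVneq k i; have [->|] := eqVneq k j.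
Qed.

Lemma pair_law M : measurable M -> P ((fun w => (X i w, X j w)) @^-1` M) = (rho \x rho)%E M.
Proof.
move=> mM; have := @product_rule_extend _ _ _ _ _ _ _ P rho rho Z setT 1%E
  measurableT (probability_setT P) _ M mM.
rewrite setIT mule1; apply => A B mA mB.
by rewrite setIT mule1 -joint.
Qed.

Lemma ge0_integral_pair (F : E * E -> \bar R) : measurable_fun setT F ->
  (forall p, 0 <= F p)%E ->
  (\int[P]_w F (X i w, X j w) = \int[rho \x rho]_p F p)%E.
Proof.
move=> mF F0; rewrite -(ge0_integral_distribution Z)//.
by apply: eq_measure_integral => A mA _; exact: pair_law.
Qed.

Lemma integrable_pair (F : E * E -> R) : measurable_fun setT F ->
  P.-integrable setT (EFin \o (fun w => F (X i w, X j w))) <->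
  (rho \x rho)%E.-integrable setT (EFin \o F).
Proof.
move=> mF.
have mFZ : measurable_fun setT (fun w => F (X i w, X j w)) by exact: measurableT_comp mF mpair.
have E1 : (\int[P]_w `|(EFin \o (fun w => F (X i w, X j w))) w| =
    \int[rho \x rho]_p `|(EFin \o F) p|)%E.
  rewrite -ge0_integral_pair//; apply/measurable_EFinP; exact: measurableT_comp.
split=> /integrableP[_ h]; apply/integrableP; split; try exact/measurable_EFinP.
  by rewrite -E1.
by rewrite E1.
Qed.

Lemma integral_pair (F : E * E -> R) : measurable_fun setT F ->
  (rho \x rho)%E.-integrable setT (EFin \o F) ->
  \int[P]_w F (X i w, X j w) = \int[(rho \x rho)%E]_p F p.
Proof.
move=> mF iF; congr fine.
transitivity (\int[distribution P Z]_p (F p)%:E)%E; last first.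
  by apply: eq_measure_integral => A mA _; exact: pair_law.
rewrite integral_distribution//; first exact/measurable_EFinP.
exact: (integrable_pair mF).2.
Qed.

End pair_law.

(** * Conditional expectation: uniqueness, then an explicit version for pairs *)

Section conditional_expectation.
Context {R : realType} {d} {T : measurableType d} {d'} {E : measurableType d'}.
Variables (P : probability T R) (Z : {mfun T >-> E}) (Y : T -> R).

Let sigmaZ := preimage_set_system [set: T] Z measurable.

(** The event [V < W] is measurable for [Z], so [W - V] integrates to 0 over it although it is
    positive there. *)
Let cond_exp_le (V W : T -> R) : is_cond_exp P Y Z V -> is_cond_exp P Y Z W ->
  P [set w | V w < W w] = 0%E.
Proof.
move=> [mV iV EV] [mW iW EW]; set A := [set w | V w < W w].
have AE : A = \bigcup_(q : rat) (V @^-1` `]-oo, ratr q[ `&` W @^-1` `]ratr q, +oo[).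
  apply/seteqP; split => [w /= /rat_in_itvoo[q]|w [q _ /=]].
    by rewrite in_itv/= => /andP[h1 h2]; exists q => //=; rewrite !in_itv/= h1 h2.
  by rewrite !in_itv/= andbT => -[]; exact: lt_trans.
have sA : sigmaZ A.
  have HV q := mV _ (measurable_itv `]-oo, (ratr q : R)[).
  have HW q := mW _ (measurable_itv `](ratr q : R), +oo[).
  (* Sets of [E] are chosen for all rationals at once, so that their countable union witnesses
     membership of [A] in the sigma-algebra of [Z]. *)
  pose B q := projT1 (cid2 (HV q)); pose C q := projT1 (cid2 (HW q)).
  have mB q : measurable (B q) by rewrite /B; case: cid2.
  have mC q : measurable (C q) by rewrite /C; case: cid2.
  have BE q : setT `&` Z @^-1` B q = V @^-1` `]-oo, ratr q[ by rewrite /B; case: cid2.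
  have CE q : setT `&` Z @^-1` C q = W @^-1` `]ratr q, +oo[ by rewrite /C; case: cid2.
  exists (\bigcup_q (B q `&` C q)).
    by apply: bigcupT_measurable_rat => q; exact: measurableI.
  rewrite AE setTI preimage_bigcup; apply: eq_bigcupr => q _.
  by rewrite preimage_setI -BE -CE !setTI.
have mA : measurable A.
  case: sA => B mB <-; exact: measurable_funPT.
have iV' := integrableS measurableT mA (subsetT A) iV.
have iW' := integrableS measurableT mA (subsetT A) iW.
have iWV : P.-integrable A (fun w => (W w - V w)%:E) by exact: (integrableB mA iW' iV').
have E0 : (\int[P]_(w in A) `|(W w - V w)%:E| = 0)%E.
  transitivity (\int[P]_(w in A) ((W w)%:E - (V w)%:E))%E.
    by apply: eq_integral => w /[!inE] wA; rewrite gee0_abs// lee_fin subr_ge0 ltW.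
  rewrite integralB// EV// EW// -EV// subee//.
  exact: integrable_fin_num.
have /(ae_eq_integral_abs P mA (measurable_int _ iWV)) [N [mN N0 AN]] := E0.
apply: subset_measure0 N0 => // w Aw; apply: AN => /= /(_ Aw) [].
by apply/eqP; rewrite subr_eq0 gt_eqF.
Qed.

(** Makes the arbitrary version selected by [cond_exp] computable through an explicit one. *)
Lemma cond_exp_unique (V W : T -> R) : is_cond_exp P Y Z V -> is_cond_exp P Y Z W ->
  {ae P, forall w, V w = W w}.
Proof.
move=> hV hW; have VW := cond_exp_le hV hW; have WV := cond_exp_le hW hV.
have mlt (f g : T -> R) : is_cond_exp P Y Z f -> is_cond_exp P Y Z g ->
    measurable [set w | f w < g w].
  move=> [_ /(measurable_int _)/measurable_EFinP mf _].
  move=> [_ /(measurable_int _)/measurable_EFinP mg _].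
  have := measurable_fun_ltr mf mg measurableT (_ : measurable [set true]); move=> /(_ Logic.I).
  by rewrite setTI; congr measurable; apply/seteqP; split.
exists ([set w | V w < W w] `|` [set w | W w < V w]); split.
- by apply: measurableU; exact: mlt.
- by rewrite (measureU0 (mlt _ _ hV hW) (mlt _ _ hW hV) WV).
by move=> w /= /eqP; rewrite neq_lt => /orP[]; [left|right].
Qed.

End conditional_expectation.

Section fubini_real.
Context {R : realType} {d1} {T1 : measurableType d1} {d2} {T2 : measurableType d2}.
Variables (m1 : probability T1 R) (m2 : probability T2 R) (F : T1 * T2 -> R).
Hypothesis iF : (m1 \x m2)%E.-integrable setT (EFin \o F).

Let G x := (\int[m2]_y (F (x, y))%:E)%E.

Let iG : m1.-integrable setT G.
Proof. exact: (integrable_fubini_F iF). Qed.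

Lemma measurable_section_integral : measurable_fun setT (fun x => \int[m2]_y F (x, y)).
Proof.
apply: (measurableT_comp (f := @fine R)) => //.
exact: measurable_int iG.
Qed.

Lemma integrable_section_integral :
  m1.-integrable setT (EFin \o (fun x => \int[m2]_y F (x, y))).
Proof.
apply: le_integrable iG => //.
  exact/measurable_EFinP/measurable_section_integral.
by move=> x _ /=; rewrite /Rintegral -/(G x); case: (G x) => [r| |] /=; rewrite ?normr0 ?leey.
Qed.

(** The inner integral may be infinite for some [x], where its real version differs; integrability
    confines these [x] to a null set. *)
Lemma Rintegral_fubini : \int[(m1 \x m2)%E]_p F p = \int[m1]_x \int[m2]_y F (x, y).
Proof.
congr fine; rewrite -(integral12_prod_meas1 iF).
apply: ae_eq_integral => //; first exact: measurable_int iG.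
  exact/measurable_EFinP/measurable_section_integral.
have := integrable_ae measurableT iG; apply: filterS => y h _.
by rewrite /= /Rintegral fineK//; exact: h.
Qed.

End fubini_real.

Section conditional_expectation_pair.
Context {R : realType} {d} {T : measurableType d} {d'} {E : measurableType d'}.
Variables (P : probability T R) (I : finType) (X : I -> {mfun T >-> E}).
Variable rho : probability E R.
Hypothesis X_indep : independent_rvs P (fun i => X i).
Hypothesis X_law : forall i A, measurable A -> P (X i @^-1` A) = rho A.
Variables (i j : I).
Hypothesis ij : i != j.
Variable u : E * E -> R.
Hypothesis mu : measurable_fun setT u.
Hypothesis iu : (rho \x rho)%E.-integrable setT (EFin \o u).

Lemma ge0_integral_law (f : E -> \bar R) : measurable_fun setT f ->
  (forall x, 0 <= f x)%E -> (\int[P]_w f (X i w) = \int[rho]_x f x)%E.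
Proof.
move=> mf f0; rewrite -(ge0_integral_distribution (X i))//.
by apply: eq_measure_integral => A mA _; exact: X_law.
Qed.

Let g x := \int[rho]_y u (x, y).

Let mg : measurable_fun setT g.
Proof. exact: (measurable_section_integral iu). Qed.

Let ig : rho.-integrable setT (EFin \o g).
Proof. exact: (integrable_section_integral iu). Qed.

Let integrable_law (f : E -> R) : rho.-integrable setT (EFin \o f) ->
  P.-integrable setT (EFin \o (fun w => f (X i w))).
Proof.
move=> /integrableP[mf h]; have mf' : measurable_fun setT f by exact/measurable_EFinP.
apply/integrableP; split; first by apply/measurable_EFinP; exact: measurableT_comp.
rewrite (ge0_integral_law (f := fun x => `|(f x)%:E|%E))//.
exact: measurableT_comp.
Qed.

Let integral_law (f : E -> R) : rho.-integrable setT (EFin \o f) ->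
  \int[P]_w f (X i w) = \int[rho]_x f x.
Proof.
move=> fi; congr fine.
transitivity (\int[distribution P (X i)]_x (f x)%:E)%E; last first.
  by apply: eq_measure_integral => A mA _; exact: X_law.
rewrite integral_distribution//; first exact: measurable_int fi.
exact: integrable_law.
Qed.

(** By independence, conditioning on [X i] freezes that argument and integrates the other one;
    Fubini verifies this on events [X i \in B]. *)
Lemma is_cond_exp_pair :
  is_cond_exp P (fun w => u (X i w, X j w)) (X i) (fun w => \int[rho]_y u (X i w, y)).
Proof.
split.
- move=> B mB; exists (g @^-1` B); last by rewrite setTI.
  by rewrite -[_ @^-1` _]setTI; exact: mg.
- exact: (integrable_law ig).
move=> _ [B mB <-]; rewrite setTI.
have mX : measurable (X i @^-1` B) by rewrite -[_ @^-1` _]setTI; exact: measurable_funPT.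
have ind (h : T -> R) : (\int[P]_(w in X i @^-1` B) (h w)%:E =
    \int[P]_w (\1_B (X i w) * h w)%:E)%E.
  rewrite [LHS]integral_mkcond; apply: eq_integral => w _.
  rewrite patchE indicE -[w \in _]/(X i w \in B).
  by case: (X i w \in B); rewrite ?mul1r ?mul0r.
rewrite !ind.
have m1B : measurable_fun setT (\1_B : E -> R) by exact: measurable_indic.
have b1 x : `|\1_B x : R| <= 1 by rewrite indicE; case: (_ \in _); rewrite ?normr1 ?normr0.
have iBg : rho.-integrable setT (EFin \o (fun x => \1_B x * g x)).
  apply: (le_integrableR (g := fun x => `|g x|)); first exact: measurable_funM.
    by move=> x; rewrite normrM ler_piMl.
  exact: integrable_norm ig.
have iBu : (rho \x rho)%E.-integrable setT (EFin \o (fun p => \1_B p.1 * u p)).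
  apply: (le_integrableR (g := fun p => `|u p|)).
  - by apply: measurable_funM => //; exact: measurableT_comp m1B measurable_fst.
  - by move=> x; rewrite normrM ler_piMl.
  - exact: integrable_norm iu.
have mBu : measurable_fun setT (fun p : E * E => \1_B p.1 * u p : R).
  by apply/measurable_EFinP; exact: measurable_int iBu.
rewrite -(EFin_Rintegral (integrable_law iBg)).
rewrite -(EFin_Rintegral ((integrable_pair X_indep X_law ij mBu).2 iBu)).
rewrite (integral_law iBg) (integral_pair X_indep X_law ij mBu iBu) Rintegral_fubini//.
congr (_%:E); apply: eq_Rintegral => x _ /=.
rewrite indicE; case: (x \in B); last first.
  by under eq_Rintegral do rewrite mul0r; rewrite Rintegral_cstT mul0r.
by under eq_Rintegral do rewrite mul1r; rewrite mul1r.
Qed.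

End conditional_expectation_pair.

(** * Finite-rank kernels *)

Section square_integrable.
Context {R : realType} {d} {T : measurableType d} (mu : probability T R).
Implicit Types f g : T -> R.

Definition in_L2 f := measurable_fun setT f /\
  mu.-integrable setT (EFin \o (fun x => f x ^+ 2)).

Lemma in_L2_integrable f : in_L2 f -> mu.-integrable setT (EFin \o f).
Proof. by move=> [mf f2]; exact: integrable_of_sqr. Qed.

Lemma in_L2P f : measurable_fun setT f ->
  (\int[mu]_x (f x ^+ 2)%:E < +oo)%E -> in_L2 f.
Proof.
move=> mf f2; split=> //; apply/integrableP; split.
  by apply/measurable_EFinP; exact: measurable_funX.
by under eq_integral do rewrite /= ger0_norm ?sqr_ge0//.
Qed.

Lemma in_L2_cst (c : R) : in_L2 (fun=> c).
Proof. by split => //; exact: integrable_cstR. Qed.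

Lemma in_L2Z (c : R) f : in_L2 f -> in_L2 (fun x => c * f x).
Proof.
move=> [mf f2]; split; first exact: measurable_funM.
apply: (eq_integrable measurableT _ _ _ (integrableZlR (c ^+ 2) f2)) => x _ /=.
by rewrite exprMn.
Qed.

Lemma in_L2D f g : in_L2 f -> in_L2 g -> in_L2 (fun x => f x + g x).
Proof.
move=> [mf f2] [mg g2]; split; first exact: measurable_funD.
apply: (le_integrableR (g := fun x => 2 * (f x ^+ 2 + g x ^+ 2))).
- by apply: measurable_funX; exact: measurable_funD.
- by move=> x; rewrite ger0_norm ?sqr_ge0//; have := sqr_ge0 (f x - g x); nra.
- exact: (integrableZlR 2 (integrableDR f2 g2)).
Qed.

Lemma in_L2B f g : in_L2 f -> in_L2 g -> in_L2 (fun x => f x - g x).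
Proof.
move=> hf hg; have := in_L2D hf (in_L2Z (- 1) hg); congr in_L2.
by apply/funext => x; rewrite mulN1r.
Qed.

Lemma in_L2_sum (I : Type) (s : seq I) (f : I -> T -> R) :
  (forall i, in_L2 (f i)) -> in_L2 (fun x => \sum_(i <- s) f i x).
Proof.
move=> hf; elim: s => [|i s IH].
  have := in_L2_cst 0; congr in_L2; by apply/funext => x; rewrite big_nil.
have := in_L2D (hf i) IH; congr in_L2; by apply/funext => x; rewrite big_cons.
Qed.

(* [Rintegral] is arbitrary when [f] is not integrable, but then the right-hand side is
   infinite. *)
Lemma sqr_Rintegral_le f : measurable_fun setT f ->
  (((\int[mu]_x f x) ^+ 2)%:E <= \int[mu]_x (f x ^+ 2)%:E)%E.
Proof.
move=> mf; have [fy|] := ltP (\int[mu]_x (f x ^+ 2)%:E)%E +oo%E.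
  have [_ f2] := in_L2P mf fy.
  by rewrite -(EFin_Rintegral f2) lee_fin; exact: jensen_sqr.
by move=> /(le_trans _); apply; exact: leey.
Qed.

Lemma variance_le f : in_L2 f ->
  \int[mu]_x ((f x - \int[mu]_y f y) ^+ 2) <= \int[mu]_x (f x ^+ 2).
Proof.
move=> hf; have f1 := in_L2_integrable hf; have [mf f2] := hf.
set m := \int[mu]_y f y.
have i1 := integrableZlR (2 * m) f1.
have i2 := integrableBR f2 i1.
have -> : \int[mu]_x ((f x - m) ^+ 2) = \int[mu]_x (f x ^+ 2 - 2 * m * f x + m ^+ 2).
  by apply: eq_Rintegral => x _; ring.
rewrite (RintegralD measurableT i2 (integrable_cstR mu (m ^+ 2))) Rintegral_cstT.
rewrite (RintegralB measurableT f2 i1) (RintegralZl _ measurableT f1) -/m.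
by have := sqr_ge0 m; lra.
Qed.

Lemma in_L2_qtrunc (c : R) f : 0 <= c -> in_L2 f ->
  mu.-integrable setT (EFin \o (fun x => qtrunc (c * f x ^+ 2))).
Proof.
move=> c0 [mf f2]; apply: integrable_qtrunc; last exact: (integrableZlR c f2).
by move=> x; rewrite mulr_ge0 ?sqr_ge0.
Qed.

Lemma qtrunc_Rintegral_le (c : R) f : 0 <= c -> in_L2 f ->
  qtrunc (c * (\int[mu]_x f x) ^+ 2) <= \int[mu]_x qtrunc (c * f x ^+ 2).
Proof.
move=> c0 [mf f2].
have J : c * (\int[mu]_x f x) ^+ 2 <= \int[mu]_x (c * f x ^+ 2).
  by rewrite (RintegralZl _ measurableT f2) ler_wpM2l//; exact: jensen_sqr.
apply: le_trans (ler_qtrunc _ J) _; first by rewrite mulr_ge0 ?sqr_ge0.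
apply: jensen_qtrunc; last exact: (integrableZlR c f2).
by move=> x; rewrite mulr_ge0 ?sqr_ge0.
Qed.

End square_integrable.

Lemma qtrunc_scaled_sqrD {R : realType} (c x y : R) : 0 <= c ->
  qtrunc (c * (x + y) ^+ 2) <= 8 * (qtrunc (c * x ^+ 2) + qtrunc (c * y ^+ 2)).
Proof.
move=> c0; rewrite -[c](sqr_sqrtr c0) -!exprMn mulrDr; exact: qtrunc_sqrD.
Qed.

Section product_projections.
Context {R : realType} {d} {E : measurableType d} (rho : probability E R).

Lemma Rintegral_fst (f : E -> R) : measurable_fun setT f -> (forall x, 0 <= f x) ->
  \int[(rho \x rho)%E]_p f p.1 = \int[rho]_x f x.
Proof.
move=> mf f0; congr fine.
have mF : measurable_fun setT (fun p : E * E => (f p.1)%:E).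
  by apply/measurable_EFinP; exact: measurableT_comp mf measurable_fst.
rewrite (fubini_tonelli1 _ mF); last by move=> p; rewrite lee_fin.
by apply: eq_integral => x _; exact: (integral_cstT rho (f x)).
Qed.

Lemma Rintegral_snd (f : E -> R) : measurable_fun setT f -> (forall x, 0 <= f x) ->
  \int[(rho \x rho)%E]_p f p.2 = \int[rho]_x f x.
Proof.
move=> mf f0; congr fine.
have mF : measurable_fun setT (fun p : E * E => (f p.2)%:E).
  by apply/measurable_EFinP; exact: measurableT_comp mf measurable_snd.
rewrite (fubini_tonelli2 _ mF); last by move=> p; rewrite lee_fin.
by apply: eq_integral => x _; exact: (integral_cstT rho (f x)).
Qed.

Lemma in_L2_fst (f : E -> R) : in_L2 rho f -> in_L2 (rho \x rho)%E (fun p => f p.1).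
Proof.
move=> [mf f2]; apply: in_L2P; first exact: measurableT_comp mf measurable_fst.
have mF : measurable_fun setT (fun p : E * E => (f p.1 ^+ 2)%:E).
  by apply/measurable_EFinP; apply: measurable_funX; exact: measurableT_comp mf measurable_fst.
rewrite (fubini_tonelli1 _ mF); last by move=> p; rewrite lee_fin sqr_ge0.
under eq_integral do rewrite /fubini_F/= integral_cstT.
by rewrite -(EFin_Rintegral f2) ltry.
Qed.

Lemma in_L2_snd (f : E -> R) : in_L2 rho f -> in_L2 (rho \x rho)%E (fun p => f p.2).
Proof.
move=> [mf f2]; apply: in_L2P; first exact: measurableT_comp mf measurable_snd.
have mF : measurable_fun setT (fun p : E * E => (f p.2 ^+ 2)%:E).
  by apply/measurable_EFinP; apply: measurable_funX; exact: measurableT_comp mf measurable_snd.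
rewrite (fubini_tonelli2 _ mF); last by move=> p; rewrite lee_fin sqr_ge0.
under eq_integral do rewrite /fubini_G/= integral_cstT.
by rewrite -(EFin_Rintegral f2) ltry.
Qed.

End product_projections.

Section finite_rank_kernel.
Context {R : realType} {d} {E : measurableType d} (rho : probability E R).
Local Notation rho2 := (rho \x rho)%E.
Variables (K : nat) (phi : nat -> E -> R) (lam : nat -> R) (u : E * E -> R).
Hypothesis phi_L2 : forall k, in_L2 rho (phi k).
Hypothesis u_L2 : in_L2 rho2 u.

Definition finite_rank (p : E * E) : R := \sum_(k < K) lam k * phi k p.1 * phi k p.2.
Definition feature_mean k : R := \int[rho]_x phi k x.
Definition finite_rank_mean : R := \sum_(k < K) lam k * feature_mean k * feature_mean k.
(** Together with [finite_rank_degen], the Hoeffding decomposition of [finite_rank]; the degenerate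
    part is the same kernel in the centred features. *)
Definition finite_rank_proj x : R :=
  \sum_(k < K) lam k * feature_mean k * (phi k x - feature_mean k).
Definition finite_rank_degen p : R :=
  finite_rank p - finite_rank_mean - finite_rank_proj p.1 - finite_rank_proj p.2.

Hypothesis err_L2 : in_L2 rho2 (fun p => finite_rank p - u p).

Local Notation uK := finite_rank.
Local Notation mK := finite_rank_mean.
Local Notation lK := finite_rank_proj.
Let D := \int[rho2]_p u p.
Let err p := uK p - u p.
Let errm := \int[rho2]_p err p.
Let F p := err p - errm.
Let gamma x := \int[rho]_y u (x, y) - D.
Let epsK := \int[rho2]_p (err p ^+ 2).

Let uK_L2 : in_L2 rho2 uK.
Proof.
by have := in_L2D err_L2 u_L2; congr in_L2; apply/funext => p; rewrite subrK.
Qed.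

Let uKx_L2 x : in_L2 rho (fun y => uK (x, y)).
Proof. exact: (in_L2_sum _ (fun k : 'I_K => in_L2Z (lam k * phi k x) (phi_L2 k))). Qed.

Let int_uKx x : \int[rho]_y uK (x, y) = \sum_(k < K) lam k * feature_mean k * phi k x.
Proof.
have ik (k : 'I_K) := in_L2_integrable (phi_L2 k).
rewrite (Rintegral_sum _ (fun k : 'I_K => integrableZlR (lam k * phi k x) (ik k))).
by apply: eq_bigr => k _; rewrite (RintegralZl _ measurableT (ik k)) mulrAC.
Qed.

Lemma finite_rank_meanE : \int[rho2]_p uK p = mK.
Proof.
have ik (k : 'I_K) := in_L2_integrable (phi_L2 k).
rewrite (Rintegral_fubini (in_L2_integrable uK_L2)).
under eq_Rintegral do rewrite int_uKx.
rewrite (Rintegral_sum _ (fun k : 'I_K => integrableZlR (lam k * feature_mean k) (ik k))).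
by apply: eq_bigr => k _; rewrite (RintegralZl _ measurableT (ik k)).
Qed.

Let errmE : mK - D = errm.
Proof.
rewrite -finite_rank_meanE /errm /err.
by rewrite (RintegralB measurableT (in_L2_integrable uK_L2)
  (in_L2_integrable u_L2)).
Qed.

Let lKE x : lK x = \int[rho]_y (uK (x, y) - mK).
Proof.
rewrite (RintegralB measurableT (in_L2_integrable (uKx_L2 x)) (integrable_cstR rho mK)).
rewrite Rintegral_cstT int_uKx -sumrB; apply: eq_bigr => k _; ring.
Qed.

Lemma finite_rank_proj_L2 : in_L2 rho lK.
Proof.
exact: (in_L2_sum _ (fun k : 'I_K =>
  in_L2Z (lam k * feature_mean k) (in_L2B (phi_L2 k) (in_L2_cst rho (feature_mean k))))).
Qed.

Let F_L2 : in_L2 rho2 F.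
Proof. by apply: in_L2B; [exact: err_L2|exact: in_L2_cst]. Qed.

Let epsK_ge0 : 0 <= epsK.
Proof. by apply: Rintegral_ge0 => p _; exact: sqr_ge0. Qed.

Let F_le : \int[rho2]_p (F p ^+ 2) <= epsK.
Proof. exact: variance_le. Qed.

Let r x := lK x - gamma x.

Let mr : measurable_fun setT r.
Proof.
apply: measurable_funB; first by case: finite_rank_proj_L2.
apply: measurable_funB => //.
exact: (measurable_section_integral (in_L2_integrable u_L2)).
Qed.

(** Stated in [\bar R] because a section of [F] may fail to be square integrable for some [x]; the
    bound is then trivial. Otherwise [u (x, _)] is square integrable too, and the inequality is
    Jensen's. *)
Let r_le x : ((r x ^+ 2)%:E <= \int[rho]_y (F (x, y) ^+ 2)%:E)%E.
Proof.
have mF : measurable_fun setT (fun y => F (x, y)).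
  exact: (measurableT_comp F_L2.1 (measurable_pair1 x)).
have [Fy|] := ltP (\int[rho]_y (F (x, y) ^+ 2)%:E)%E +oo%E; last first.
  by move=> /(le_trans _); apply; exact: leey.
have FL := in_L2P mF Fy.
suff -> : r x = \int[rho]_y F (x, y) by exact: sqr_Rintegral_le.
have uL : in_L2 rho (fun y => u (x, y)).
  have := in_L2B (in_L2B (uKx_L2 x) FL) (in_L2_cst rho errm); congr in_L2.
  by apply/funext => y; rewrite /F /err; ring.
have iuK := in_L2_integrable (uKx_L2 x); have iu := in_L2_integrable uL.
have i1 := integrableBR iuK iu.
rewrite /F (RintegralB measurableT i1 (integrable_cstR rho errm)) Rintegral_cstT.
rewrite (RintegralB measurableT iuK iu) /r lKE.
rewrite (RintegralB measurableT iuK (integrable_cstR rho mK)) Rintegral_cstT -errmE /gamma.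
by ring.
Qed.

Let r2_le : (\int[rho]_x (r x ^+ 2)%:E <= epsK%:E)%E.
Proof.
have mF2 : measurable_fun setT (fun p => (F p ^+ 2)%:E).
  by apply/measurable_EFinP; apply: measurable_funX; case: F_L2.
have F0 p : (0 <= (F p ^+ 2)%:E)%E by rewrite lee_fin sqr_ge0.
apply: (@le_trans _ _ (\int[rho]_x \int[rho]_y (F (x, y) ^+ 2)%:E)%E).
  apply: ge0_le_integral => //.
  - by move=> x _; rewrite lee_fin sqr_ge0.
  - by apply/measurable_EFinP; exact: measurable_funX.
  - exact: (measurable_inner_integral rho mF2 F0).
rewrite -(fubini_tonelli1 _ mF2 F0) -(EFin_Rintegral F_L2.2) lee_fin; exact: F_le.
Qed.

Let r_L2 : in_L2 rho r.
Proof. by apply: in_L2P => //; apply: le_lt_trans r2_le _; exact: ltry. Qed.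

Let r2_leR : \int[rho]_x (r x ^+ 2) <= epsK.
Proof. by rewrite -lee_fin (EFin_Rintegral r_L2.2). Qed.

Lemma cond_L2 : in_L2 rho gamma.
Proof.
have := in_L2B finite_rank_proj_L2 r_L2; congr in_L2; apply/funext => x; rewrite /r; ring.
Qed.

Lemma finite_rank_proj_var : \int[rho]_x (lK x ^+ 2) <=
  2 * (\int[rho]_x (gamma x ^+ 2) + epsK).
Proof.
apply: (@le_trans _ _ (2 * (\int[rho]_x (gamma x ^+ 2) + \int[rho]_x (r x ^+ 2)))); last first.
  by rewrite ler_wpM2l// lerD2l.
have i := integrableDR cond_L2.2 r_L2.2.
rewrite -(RintegralD measurableT cond_L2.2 r_L2.2) -(RintegralZl _ measurableT i).
apply: le_Rintegral => //; [exact: finite_rank_proj_L2.2|exact: (integrableZlR 2 i)|].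
move=> x _; rewrite (_ : lK x = gamma x + r x); last by rewrite /r; ring.
by have := sqr_ge0 (gamma x - r x); nra.
Qed.

(** Only the main part [gamma] keeps its truncation. The error is bounded by its plain square, so
    its [L^2] size alone matters. *)
Lemma finite_rank_proj_qtrunc c : 0 <= c -> \int[rho]_x qtrunc (c * lK x ^+ 2) <=
  8 * (\int[rho]_x qtrunc (c * gamma x ^+ 2) + c * epsK).
Proof.
move=> c0.
have i0 := in_L2_qtrunc c0 cond_L2; have i1 := integrableZlR c r_L2.2.
have i := integrableDR i0 i1.
apply: (@le_trans _ _ (8 * (\int[rho]_x qtrunc (c * gamma x ^+ 2) + \int[rho]_x (c * r x ^+ 2)))).
  rewrite -(RintegralD measurableT i0 i1) -(RintegralZl _ measurableT i).
  apply: le_Rintegral => //; [exact: (in_L2_qtrunc c0 finite_rank_proj_L2)|exact: (integrableZlR 8 i)|].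
  move=> x _; rewrite (_ : lK x = gamma x + r x); last by rewrite /r; ring.
  apply: le_trans (qtrunc_scaled_sqrD _ _ c0) _; rewrite ler_wpM2l// lerD2l.
  by apply: qtrunc_le; rewrite mulr_ge0 ?sqr_ge0.
rewrite (RintegralZl _ measurableT r_L2.2) ler_wpM2l// lerD2l ler_wpM2l//.
Qed.

Let v0 p := uK p - mK.
Let h p := u p - D.

Let h_L2 : in_L2 rho2 h.
Proof. by apply: in_L2B => //; exact: in_L2_cst. Qed.

Let v0_L2 : in_L2 rho2 v0.
Proof. by apply: in_L2B => //; exact: in_L2_cst. Qed.

Let v0E p : v0 p = h p + F p.
Proof. by rewrite /v0 /h /F -errmE /err; ring. Qed.

Let v0_var : \int[rho2]_p (v0 p ^+ 2) <= 2 * (\int[rho2]_p (h p ^+ 2) + epsK).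
Proof.
apply: (@le_trans _ _ (2 * (\int[rho2]_x (h x ^+ 2) + \int[rho2]_x (F x ^+ 2)))); last first.
  by rewrite ler_wpM2l// lerD2l.
have i := integrableDR h_L2.2 F_L2.2.
rewrite -(RintegralD measurableT h_L2.2 F_L2.2) -(RintegralZl _ measurableT i).
apply: le_Rintegral => //; [exact: v0_L2.2|exact: (integrableZlR 2 i)|].
by move=> x _; rewrite v0E; have := sqr_ge0 (h x - F x); nra.
Qed.

Let v0_qtrunc c : 0 <= c -> \int[rho2]_p qtrunc (c * v0 p ^+ 2) <=
  8 * (\int[rho2]_p qtrunc (c * h p ^+ 2) + c * epsK).
Proof.
move=> c0.
have i0 := in_L2_qtrunc c0 h_L2; have i1 := integrableZlR c F_L2.2.
have i := integrableDR i0 i1.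
apply: (@le_trans _ _ (8 * (\int[rho2]_x qtrunc (c * h x ^+ 2) + \int[rho2]_x (c * F x ^+ 2)))).
  rewrite -(RintegralD measurableT i0 i1) -(RintegralZl _ measurableT i).
  apply: le_Rintegral => //; [exact: (in_L2_qtrunc c0 v0_L2)|exact: (integrableZlR 8 i)|].
  move=> x _; rewrite v0E.
  apply: le_trans (qtrunc_scaled_sqrD _ _ c0) _; rewrite ler_wpM2l// lerD2l.
  by apply: qtrunc_le; rewrite mulr_ge0 ?sqr_ge0.
by rewrite (RintegralZl _ measurableT F_L2.2) ler_wpM2l// lerD2l ler_wpM2l.
Qed.

Let v0x_L2 x : in_L2 rho (fun y => v0 (x, y)).
Proof. by apply: in_L2B => //; exact: in_L2_cst. Qed.

Let lK_var_le : \int[rho]_x (lK x ^+ 2) <= \int[rho2]_p (v0 p ^+ 2).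
Proof.
rewrite (Rintegral_fubini v0_L2.2); apply: le_Rintegral => //.
- exact: finite_rank_proj_L2.2.
- exact: (integrable_section_integral v0_L2.2).
- move=> x _; rewrite lKE; apply: jensen_sqr; by case: (v0x_L2 x).
Qed.

Let lK_q_le c : 0 <= c ->
  \int[rho]_x qtrunc (c * lK x ^+ 2) <= \int[rho2]_p qtrunc (c * v0 p ^+ 2).
Proof.
move=> c0; have i := in_L2_qtrunc c0 v0_L2.
rewrite (Rintegral_fubini i); apply: le_Rintegral => //.
- exact: (in_L2_qtrunc c0 finite_rank_proj_L2).
- exact: (integrable_section_integral i).
- by move=> x _; rewrite lKE; exact: (qtrunc_Rintegral_le c0 (v0x_L2 x)).
Qed.

Let l1_L2 : in_L2 rho2 (fun p => lK p.1). Proof. exact: (in_L2_fst finite_rank_proj_L2). Qed.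
Let l2_L2 : in_L2 rho2 (fun p => lK p.2). Proof. exact: (in_L2_snd finite_rank_proj_L2). Qed.

Lemma finite_rank_degen_L2 : in_L2 rho2 finite_rank_degen.
Proof. exact: in_L2B (in_L2B v0_L2 l1_L2) l2_L2. Qed.

Let mlK : measurable_fun setT lK. Proof. by case: finite_rank_proj_L2. Qed.

(** [18 = 3 * 3 * 2]: three summands squared, each with second moment at most that of the centred
    kernel, which costs a factor 2 to compare with [u]. *)
Lemma finite_rank_degen_var : \int[rho2]_p (finite_rank_degen p ^+ 2) <=
  18 * (\int[rho2]_p (h p ^+ 2) + epsK).
Proof.
have i1 := integrableDR v0_L2.2 l1_L2.2.
have i := integrableDR i1 l2_L2.2.
apply: (@le_trans _ _ (3 * (\int[rho2]_p (v0 p ^+ 2) + \int[rho]_x (lK x ^+ 2) +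
    \int[rho]_x (lK x ^+ 2)))); last by have := v0_var; have := lK_var_le; lra.
have m2 : measurable_fun setT (fun x => lK x ^+ 2) by exact: measurable_funX.
rewrite -{1}(Rintegral_fst rho m2 (fun=> sqr_ge0 _)) -(Rintegral_snd rho m2 (fun=> sqr_ge0 _)).
rewrite -(RintegralD measurableT v0_L2.2 l1_L2.2) -(RintegralD measurableT i1 l2_L2.2).
rewrite -(RintegralZl _ measurableT i).
apply: le_Rintegral => //; [exact: finite_rank_degen_L2.2|exact: (integrableZlR 3 i)|].
move=> p _; rewrite /finite_rank_degen -/(v0 p).
set a := v0 p; set b := lK p.1; set c := lK p.2.
have := sqr_ge0 (a + b); have := sqr_ge0 (a + c); have := sqr_ge0 (b - c); nra.
Qed.

(** [1088 = 8 * (1 + 8 * 2) * 8]: two splittings of the three summands, then the comparison with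
    [u]. *)
Lemma finite_rank_degen_qtrunc c : 0 <= c ->
  \int[rho2]_p qtrunc (c * finite_rank_degen p ^+ 2) <=
  1088 * (\int[rho2]_p qtrunc (c * h p ^+ 2) + c * epsK).
Proof.
move=> c0.
have q0 := in_L2_qtrunc c0 v0_L2.
have q1 := in_L2_qtrunc c0 l1_L2; have q2 := in_L2_qtrunc c0 l2_L2.
have q12 := integrableZlR 8 (integrableDR q1 q2).
have i := integrableDR q0 q12.
have m2 : measurable_fun setT (fun x => qtrunc (c * lK x ^+ 2)).
  apply: measurable_qtrunc; last by move=> x; rewrite mulr_ge0 ?sqr_ge0.
  by apply: measurable_funM => //; exact: measurable_funX.
have p2 x : 0 <= qtrunc (c * lK x ^+ 2) by rewrite qtrunc_ge0// mulr_ge0 ?sqr_ge0.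
apply: (@le_trans _ _ (8 * (\int[rho2]_p qtrunc (c * v0 p ^+ 2) + 8 *
    (\int[rho]_x qtrunc (c * lK x ^+ 2) + \int[rho]_x qtrunc (c * lK x ^+ 2))))); last first.
  have := lK_q_le c0; have := v0_qtrunc c0.
  have : 0 <= c * epsK by rewrite mulr_ge0.
  have : 0 <= \int[rho2]_p qtrunc (c * h p ^+ 2).
    by apply: Rintegral_ge0 => p _; rewrite qtrunc_ge0// mulr_ge0 ?sqr_ge0.
  lra.
rewrite -{1}(Rintegral_fst rho m2 p2) -(Rintegral_snd rho m2 p2).
rewrite -(RintegralD measurableT q1 q2) -(RintegralZl _ measurableT (integrableDR q1 q2)).
rewrite -(RintegralD measurableT q0 q12) -(RintegralZl _ measurableT i).
apply: le_Rintegral => //.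
- exact: in_L2_qtrunc c0 finite_rank_degen_L2.
- exact: (integrableZlR 8 i).
move=> p _; rewrite /finite_rank_degen -/(v0 p) -addrA.
apply: le_trans (qtrunc_scaled_sqrD _ _ c0) _; rewrite ler_wpM2l// lerD2l.
apply: le_trans (qtrunc_scaled_sqrD _ _ c0) _.
by rewrite !sqrrN.
Qed.

End finite_rank_kernel.

(** * U-statistics as folds *)

Lemma sum_offdiag_recr {R : nmodType} (g : nat -> nat -> R) n :
  (forall i j, g i j = g j i) ->
  \sum_(i < n.+1) \sum_(j < n.+1 | i != j) g i j =
  \sum_(i < n) \sum_(j < n | i != j) g i j + (\sum_(i < n) g i n) *+ 2.
Proof.
move=> gC; rewrite big_ord_recr /=.
under eq_bigr => i _.
  rewrite big_mkcond big_ord_recr/= (_ : (_ != _) = true); last first.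
    by rewrite -val_eqE/= ltn_eqF.
  rewrite -big_mkcond/=; over.
rewrite big_split/= -addrA; congr (_ + _).
rewrite mulr2n; congr (_ + _).
rewrite big_mkcond big_ord_recr/= eqxx addr0; apply: eq_bigr => i _.
by rewrite -val_eqE/= gtn_eqF// gC.
Qed.

Lemma card_ord_neq n (i : 'I_n) : #|[pred j | i != j]| = n.-1.
Proof.
by rewrite -[in RHS](card_ord n) -(cardC1 i); apply: eq_card => j; rewrite !inE eq_sym.
Qed.

Lemma sum_offdiag_cst {R : pzRingType} (c : R) n :
  \sum_(i < n) \sum_(j < n | i != j) c = (n * n.-1)%:R * c.
Proof.
under eq_bigr => i _.
  rewrite sumr_const card_ord_neq; over.
by rewrite sumr_const card_ord -mulrnA mulnC mulr_natl.
Qed.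

Lemma sum_offdiag_fst {R : pzRingType} n (f : 'I_n -> R) :
  \sum_(i < n) \sum_(j < n | i != j) f i = n.-1%:R * \sum_(i < n) f i.
Proof.
rewrite mulr_sumr; apply: eq_bigr => i _.
by rewrite sumr_const card_ord_neq mulr_natl.
Qed.

Lemma sum_offdiag_snd {R : pzRingType} n (f : 'I_n -> R) :
  \sum_(i < n) \sum_(j < n | i != j) f j = n.-1%:R * \sum_(i < n) f i.
Proof.
rewrite -sum_offdiag_fst (exchange_big_dep predT)//=.
by apply: eq_bigr => i _; apply: eq_bigl => j; rewrite eq_sym.
Qed.

Section quadratic_fold.
Context {R : realType} {K : nat} {d} {T : measurableType d}.
Local Notation V := (K.-tuple R).
Implicit Types (kappa : 'I_K -> R) (b v : V).

(** The half appears because the chain meets each unordered pair once. *)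
Lemma rfold_absorb kappa b0 (Y : nat -> T -> V) n w :
  (rfold (fun=> absorb kappa) (0, b0) Y n w).1 =
  \sum_(i < n) bilin kappa b0 (Y i w) +
  2^-1 * \sum_(i < n) \sum_(j < n | i != j) bilin kappa (Y i w) (Y j w).
Proof.
have S2 m v : bilin kappa (rfold (fun=> absorb kappa) (0, b0) Y m w).2 v =
    bilin kappa b0 v + \sum_(i < m) bilin kappa (Y i w) v.
  elim: m => [|m IH] /=; first by rewrite big_ord0 addr0.
  by rewrite bilinDl IH big_ord_recr/= addrA.
elim: n => [|n IH] /=; first by rewrite !big_ord0 mulr0 addr0.
rewrite (sum_offdiag_recr (g := fun i j => bilin kappa (Y i w) (Y j w))); last first.
  by move=> i j; exact: bilinC.
by rewrite IH S2 big_ord_recr/= -(mulr_natl _ 2); field.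
Qed.

End quadratic_fold.

Section finite_rank_fold.
Context {R : realType} {d'} {E : measurableType d'} (rho : probability E R).
Variables (K : nat) (phi : nat -> E -> R) (lam : nat -> R).
Local Notation V := (K.-tuple R).
Local Notation m := (feature_mean rho phi).

Definition centered_features (x : E) : V := [tuple phi k x - m k | k < K].
Definition mean_features (c : R) : V := [tuple c * m k | k < K].
Definition scaled_weights (a : R) : 'I_K -> R := fun k => a * lam k.

Lemma bilin_centered a x y :
  bilin (scaled_weights a) (centered_features x) (centered_features y) =
  a * finite_rank_degen rho K phi lam (x, y).
Proof.
rewrite /finite_rank_degen /finite_rank /finite_rank_mean /finite_rank_proj -!sumrB mulr_sumr.
apply: eq_bigr => k _; rewrite /weight /scaled_weights !tnth_mktuple/=; ring.
Qed.

Lemma bilin_mean a c x :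
  bilin (scaled_weights a) (mean_features c) (centered_features x) =
  a * c * finite_rank_proj rho K phi lam x.
Proof.
rewrite /finite_rank_proj mulr_sumr.
apply: eq_bigr => k _; rewrite /weight /scaled_weights !tnth_mktuple/=; ring.
Qed.

(** The weight [a = 2 s / (n (n - 1))] compensates the half in [rfold_absorb]; starting from [n - 1]
    times the mean produces the coefficient [a (n - 1) = 2 s / n] of the Hoeffding projection. *)
Lemma rfold_features {d} {T : measurableType d} (X : nat -> T -> E) (n : nat) (s : R) w :
  (1 < n)%N ->
  (rfold (fun=> absorb (scaled_weights (2 * s / (n * n.-1)%:R)))
     (0, mean_features n.-1%:R) (fun i w => centered_features (X i w)) n w).1 =
  s * (Ustat (finite_rank K phi lam) X n w - finite_rank_mean rho K phi lam).
Proof.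
move=> n1; rewrite rfold_absorb.
set a := 2 * s / _.
under eq_bigr do rewrite bilin_mean.
under [X in 2^-1 * X]eq_bigr do under eq_bigr do rewrite bilin_centered /finite_rank_degen/=.
have n0 : n%:R != 0 :> R by rewrite pnatr_eq0 -lt0n ltnW.
have n1' : n.-1%:R != 0 :> R by rewrite pnatr_eq0 -lt0n -ltnS prednK// ltnW.
rewrite -mulr_sumr /Ustat.
under [X in 2^-1 * X]eq_bigr do rewrite -mulr_sumr !sumrB.
rewrite -mulr_sumr !sumrB sum_offdiag_cst sum_offdiag_fst sum_offdiag_snd.
rewrite /a !natrM.
by field; rewrite n0 n1'.
Qed.

End finite_rank_fold.

Section gaussian_fold.
Context {R : realType} {K : nat} {d} {T : measurableType d}.
Local Notation V := (K.-tuple R).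

Definition matrix_image (A : 'M[R]_K) (v : V) : V :=
  [tuple \sum_k A l k * tnth v k | l < K].

(** The same chain and starting vector as in [rfold_features], with the features replaced by
    Gaussian images. The size [n.+2] keeps [n.+2] and [n.+1] nonzero and makes [inord] available to
    index [eta] by natural numbers. *)
Lemma rfold_gaussian (m : 'cV[R]_K) (S : 'M[R]_K) (lam : nat -> R) (D s : R) (n : nat)
    (eta : 'I_n.+2 -> T -> V) w : (psd_sqrt S)^T = psd_sqrt S ->
  (rfold (fun=> absorb (scaled_weights lam (2 * s / (n.+2 * n.+1)%:R)))
     (0, [tuple n.+1%:R * m k ord0 | k < K])
     (fun i w => matrix_image (psd_sqrt S) (eta (inord i) w)) n.+2 w).1 =
  s * (gaussU m S (Lambda lam K) D eta w - D).
Proof.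
move=> AT; rewrite rfold_absorb /gaussU; set A := psd_sqrt S.
pose z i w : 'cV[R]_K := \col_k tnth (eta i w) k.
have zE i l : tnth (matrix_image A (eta i w)) l = (A *m z i w) l ord0.
  by rewrite tnth_mktuple mxE; apply: eq_bigr => k _; rewrite mxE.
have LE (x y : 'cV[R]_K) : (x^T *m Lambda lam K *m y) ord0 ord0 =
    \sum_(k < K) lam k * x k ord0 * y k ord0.
  rewrite mxE; apply: eq_bigr => k _; rewrite /Lambda mul_mx_diag !mxE; ring.
have E1 i j : (((z i w)^T *m A *m Lambda lam K *m A *m z j w) ord0 ord0) =
    \sum_(k < K) lam k * (A *m z i w) k ord0 * (A *m z j w) k ord0.
  by rewrite -LE trmx_mul AT -!mulmxA.
have E2 i : (m^T *m Lambda lam K *m A *m z i w) ord0 ord0 =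
    \sum_(k < K) lam k * m k ord0 * (A *m z i w) k ord0.
  by rewrite -LE -!mulmxA.
under [in RHS]eq_bigr do under eq_bigr do rewrite E1.
under [X in _ / _ * X]eq_bigr do rewrite E2.
set a := 2 * s / _.
have F1 (i : 'I_n.+2) : bilin (scaled_weights lam a) [tuple n.+1%:R * m k ord0 | k < K]
    (matrix_image A (eta (inord i) w)) =
    a * n.+1%:R * \sum_(k < K) lam k * m k ord0 * (A *m z i w) k ord0.
  rewrite inord_val mulr_sumr; apply: eq_bigr => k _.
  by rewrite /weight zE tnth_mktuple /scaled_weights; ring.
have F2 (i j : 'I_n.+2) : bilin (scaled_weights lam a)
    (matrix_image A (eta (inord i) w)) (matrix_image A (eta (inord j) w)) =
    a * \sum_(k < K) lam k * (A *m z i w) k ord0 * (A *m z j w) k ord0.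
  rewrite !inord_val mulr_sumr; apply: eq_bigr => k _.
  by rewrite /weight !zE /scaled_weights; ring.
rewrite (eq_bigr _ (fun i _ => F1 i)) (eq_bigr _ (fun i _ => eq_bigr _ (fun j _ => F2 i j))).
under [X in 2^-1 * X]eq_bigr do rewrite -mulr_sumr.
rewrite -!mulr_sumr /a !natrM /=.
have n0 : n.+2%:R != 0 :> R by rewrite pnatr_eq0.
have n1' : n.+1%:R != 0 :> R by rewrite pnatr_eq0.
move: (n.+2%:R) (n.+1%:R) n0 n1' => p q p0 q0.
by field; rewrite p0 q0.
Qed.

End gaussian_fold.

Lemma in_L2M {R : realType} {d} {T : measurableType d} (mu : probability T R) (f g : T -> R) :
  in_L2 mu f -> in_L2 mu g -> mu.-integrable setT (EFin \o (fun x => f x * g x)).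
Proof.
move=> [mf f2] [mg g2]; apply: (le_integrableR (g := fun x => f x ^+ 2 + g x ^+ 2)).
- exact: measurable_funM.
- move=> x; rewrite ler_norml; apply/andP; split.
    by have := sqr_ge0 (f x + g x); have := sqr_ge0 (f x - g x); nra.
  by have := sqr_ge0 (f x - g x); have := sqr_ge0 (f x); have := sqr_ge0 (g x); nra.
- exact: (integrableDR f2 g2).
Qed.

Lemma gaussian_qconst_ge1 {R : realType} : 1 <= gaussian_qconst :> R.
Proof.
rewrite /gaussian_qconst; set I := Rintegral _ _ _.
suff : 0 <= I by lra.
by apply: Rintegral_ge0 => x _; rewrite exprn_even_ge0.
Qed.

(** * The law of the centred features and its Gaussian counterpart *)

Section feature_law.
Context {R : realType} {d'} {E : measurableType d'} (rho : probability E R).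
Variables (K' : nat) (phi : nat -> {mfun E >-> R}) (lam : nat -> R).
Local Notation K := K'.+1.
Local Notation V := (K.-tuple R).
Local Notation m := (feature_mean rho phi).
Local Notation psi := (centered_features rho K phi).
Hypothesis phi_L2 : forall k, in_L2 rho (phi k).

Lemma measurable_centered_features : measurable_fun setT psi.
Proof.
apply/measurable_fun_tnthP => k; rewrite (_ : _ \o _ = fun x => phi k x - m k).
  exact: measurable_funB.
by apply/funext => x /=; rewrite tnth_mktuple.
Qed.

HB.instance Definition _ :=
  isMeasurableFun.Build _ _ E V psi measurable_centered_features.

Definition feature_law : probability V R := distribution rho psi.

Lemma lin_centered a x : lin a (psi x) = \sum_(k < K) a k * (phi k x - m k).
Proof. by apply: eq_bigr => k _; rewrite tnth_mktuple. Qed.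

Let c_L2 k : in_L2 rho (fun x => phi k x - m k).
Proof. by apply: in_L2B => //; exact: in_L2_cst. Qed.

Let lin_L2 a : in_L2 rho (fun x => lin a (psi x)).
Proof.
have := in_L2_sum (index_enum 'I_K) (fun k => in_L2Z (a k) (c_L2 k)); congr in_L2.
by apply/funext => x; rewrite lin_centered.
Qed.

Definition feature_cov : 'M[R]_K :=
  \matrix_(k, l) \int[rho]_x ((phi k x - m k) * (phi l x - m l)).

Lemma feature_quad a : \int[rho]_x (lin a (psi x) ^+ 2) =
  \sum_(k < K) \sum_(l < K) a k * a l * feature_cov k l.
Proof.
have ikl (k l : 'I_K) := in_L2M (c_L2 k) (c_L2 l).
transitivity (\int[rho]_x (\sum_(k < K) \sum_(l < K)
    a k * a l * ((phi k x - m k) * (phi l x - m l)))).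
  apply: eq_Rintegral => x _; rewrite lin_centered expr2 mulr_suml.
  apply: eq_bigr => k _; rewrite mulr_sumr; apply: eq_bigr => l _; ring.
rewrite Rintegral_sum; last first.
  by move=> k; apply: integrable_EFin_sum => l; exact: (integrableZlR (a k * a l) (ikl k l)).
apply: eq_bigr => k _.
rewrite (Rintegral_sum _ (fun l : 'I_K => integrableZlR (a k * a l) (ikl k l))).
by apply: eq_bigr => l _; rewrite mxE (RintegralZl _ measurableT (ikl k l)).
Qed.

Lemma psd_feature_cov : psd feature_cov.
Proof.
split; first by apply/matrixP => k l; rewrite !mxE; apply: eq_Rintegral => x _; rewrite mulrC.
move=> v; rewrite (_ : _ ord0 ord0 = \int[rho]_x (lin (fun k => v k ord0) (psi x) ^+ 2)).
  by apply: Rintegral_ge0 => x _; exact: sqr_ge0.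
rewrite feature_quad mxE exchange_big/=; apply: eq_bigr => l _.
rewrite mxE mulr_suml; apply: eq_bigr => k _; rewrite mxE; ring.
Qed.

Let feature_int (f : V -> \bar R) : measurable_fun setT f -> (forall v, 0 <= f v)%E ->
  (\int[feature_law]_v f v = \int[rho]_x f (psi x))%E.
Proof. by move=> mf f0; rewrite ge0_integral_distribution. Qed.

Let feature_int2 (G : V * V -> \bar R) : measurable_fun setT G -> (forall p, 0 <= G p)%E ->
  (\int[feature_law]_v \int[feature_law]_w G (v, w) =
   \int[rho \x rho]_p G (psi p.1, psi p.2))%E.
Proof.
move=> mG G0; rewrite feature_int; first last.
- by move=> v; apply: integral_ge0.
- exact: measurable_inner_integral.
have mH : measurable_fun setT (fun p : E * E => G (psi p.1, psi p.2)).
  apply: (measurableT_comp mG); apply: measurable_fun_pair.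
    exact: measurableT_comp measurable_centered_features measurable_fst.
  exact: measurableT_comp measurable_centered_features measurable_snd.
rewrite (fubini_tonelli1 _ mH)//; apply: eq_integral => x _.
rewrite feature_int//; exact: measurableT_comp mG (measurable_pair1 _).
Qed.

Let feature_Rint (f : V -> R) : measurable_fun setT f -> (forall v, 0 <= f v) ->
  \int[feature_law]_v f v = \int[rho]_x f (psi x).
Proof.
by move=> mf f0; congr fine; rewrite feature_int//; exact/measurable_EFinP.
Qed.

Lemma feature_law_integrable a : feature_law.-integrable setT (EFin \o (fun v => lin a v ^+ 2)).
Proof.
have mf : measurable_fun setT (fun v : V => lin a v ^+ 2).
  by apply: measurable_funX; exact: measurable_lin.
apply/integrableP; split; first exact/measurable_EFinP.
under eq_integral do rewrite /= ger0_norm ?sqr_ge0//.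
rewrite feature_int; last by move=> v; rewrite lee_fin sqr_ge0.
  by rewrite -(EFin_Rintegral (lin_L2 a).2) ltry.
exact/measurable_EFinP.
Qed.

Lemma feature_law_mean a : \int[feature_law]_v lin a v = 0.
Proof.
have mlin : measurable_fun setT (fun v : V => (lin a v)%:E).
  by apply/measurable_EFinP; exact: measurable_lin.
have -> : \int[feature_law]_v lin a v = \int[rho]_x lin a (psi x).
  congr fine; rewrite integral_pushforward//.
  by rewrite preimage_setT; exact: (in_L2_integrable (lin_L2 a)).
under eq_Rintegral do rewrite lin_centered.
rewrite (Rintegral_sum _ (fun k : 'I_K => integrableZlR (a k) (in_L2_integrable (c_L2 k)))).
apply: big1 => k _; rewrite (RintegralZl _ measurableT (in_L2_integrable (c_L2 k))).
rewrite (RintegralB measurableT (in_L2_integrable (phi_L2 k)) (integrable_cstR rho (m k))).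
by rewrite Rintegral_cstT subrr mulr0.
Qed.

Lemma feature_law_variance a :
  \int[gaussian_image (psd_sqrt feature_cov)]_v (lin a v ^+ 2) =
  \int[feature_law]_v (lin a v ^+ 2).
Proof.
rewrite gaussian_image_variance feature_Rint; last by move=> v; exact: sqr_ge0.
  have [[AT _] AA] := psd_sqrtP psd_feature_cov.
  by rewrite AT AA feature_quad.
by apply: measurable_funX; exact: measurable_lin.
Qed.

(** Reverse Jensen on the Gaussian side, equality of variances, then ordinary Jensen on the side of
    the features. *)
Lemma feature_law_qtrunc a :
  \int[gaussian_image (psd_sqrt feature_cov)]_v qtrunc (lin a v ^+ 2) <=
  gaussian_qconst * \int[feature_law]_v qtrunc (lin a v ^+ 2).
Proof.
apply: le_trans (gaussian_image_qtrunc _ _) _.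
rewrite feature_law_variance ler_wpM2l//; last first.
  by apply: jensen_qtrunc; [move=> v; exact: sqr_ge0|exact: feature_law_integrable].
by apply: le_trans gaussian_qconst_ge1.
Qed.

Section swapping.
Variables (u : E * E -> R) (u_L2 : in_L2 (rho \x rho)%E u).
Hypothesis err_L2 : in_L2 (rho \x rho)%E (fun p => finite_rank K phi lam p - u p).
Local Notation lK := (finite_rank_proj rho K phi lam).
Local Notation dK := (finite_rank_degen rho K phi lam).
Local Notation D := (\int[(rho \x rho)%E]_p u p).
Local Notation gam := (fun x => \int[rho]_y u (x, y) - D).
Local Notation h := (fun p => u p - D).
Local Notation eK := (\int[(rho \x rho)%E]_p ((finite_rank K phi lam p - u p) ^+ 2)).

(** The bound involves [u] and the approximation error [eK] only: [K] enters through [eK] alone,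
    which permits [K] to tend to infinity. *)
Lemma lindeberg_features (f : R -> R) (Cf delta a b : R) (n : nat) :
  measurable_fun setT f -> (forall x, 0 <= f x <= 1) -> 0 <= Cf -> taylor2_fun f Cf ->
  0 < delta -> (0 < n)%N ->
  `|\int[fold_law (fun=> absorb (scaled_weights lam a)) feature_law
        (0, mean_features rho K phi b) n]_y f y.1 -
    \int[fold_law (fun=> absorb (scaled_weights lam a))
        (gaussian_image (psd_sqrt feature_cov)) (0, mean_features rho K phi b) n]_y f y.1|
  <= n%:R * (2 * Cf * delta *
       ((a * b) ^+ 2 * (2 * (\int[rho]_x (gam x ^+ 2) + eK)) +
        n%:R * (a ^+ 2 * (18 * (\int[(rho \x rho)%E]_p (h p ^+ 2) + eK)))) +
     Cf * (1 + delta ^- 2) * (1 + gaussian_qconst) * (50 * gaussian_qconst *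
       (8 * (\int[rho]_x qtrunc ((a * b) ^+ 2 * gam x ^+ 2) + (a * b) ^+ 2 * eK) +
        1088 * (\int[(rho \x rho)%E]_p qtrunc (n%:R * a ^+ 2 * h p ^+ 2) +
                n%:R * a ^+ 2 * eK)))).
Proof.
move=> mf fb Cf0 ft d0 n0.
set kap := scaled_weights lam a; set start := (0, _).
pose law (i : bool) := if i then gaussian_image (psd_sqrt feature_cov) else feature_law.
have mproj : measurable_fun setT lK by case: (finite_rank_proj_L2 K lam phi_L2).
have dL2 := finite_rank_degen_L2 phi_L2 u_L2 err_L2.
have mdeg : measurable_fun setT dK by case: dL2.
have mbil2 : measurable_fun setT (fun p : V * V => bilin kap p.1 p.2).
  exact: measurable_bilin.
have mb b1 : measurable_fun setT (fun v : V => bilin kap b1 v).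
  exact: measurable_bilin.
have := @lindeberg_swapping R K kap law start.2 _ _ _ gaussian_qconst gaussian_qconst_ge1
  _ f Cf mf fb Cf0 ft delta d0 n _ _ _ _ n0.
rewrite !(mixed_law_nseq kap law); apply.
- by case=> c; [exact: gaussian_image_integrable|exact: feature_law_integrable].
- by case=> c; [exact: gaussian_image_mean|exact: feature_law_mean].
- exact: feature_law_variance.
- exact: feature_law_qtrunc.
- rewrite feature_int; last by move=> v; rewrite lee_fin sqr_ge0.
    under eq_integral do rewrite bilin_mean exprMn.
    have i := integrableZlR ((a * b) ^+ 2) (finite_rank_proj_L2 K lam phi_L2).2.
    rewrite -(EFin_Rintegral i) lee_fin.
    rewrite (RintegralZl _ measurableT (finite_rank_proj_L2 K lam phi_L2).2).
    rewrite ler_wpM2l ?sqr_ge0//.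
    exact: finite_rank_proj_var.
  by apply/measurable_EFinP; exact: measurable_funX.
- rewrite (feature_int2 (G := fun p => (bilin kap p.1 p.2 ^+ 2)%:E)); last first.
  + by move=> p; rewrite lee_fin sqr_ge0.
  + by apply/measurable_EFinP; exact: measurable_funX.
  under eq_integral do rewrite /= bilin_centered exprMn.
  rewrite -(EFin_Rintegral (integrableZlR (a ^+ 2) dL2.2)) lee_fin.
  rewrite (RintegralZl _ measurableT dL2.2) ler_wpM2l ?sqr_ge0//.
  exact: finite_rank_degen_var.
- rewrite feature_int; last by move=> v; rewrite lee_fin qtrunc_ge0 ?sqr_ge0.
    under eq_integral do rewrite bilin_mean exprMn.
    have i := in_L2_qtrunc (sqr_ge0 (a * b)) (finite_rank_proj_L2 K lam phi_L2).
    rewrite -(EFin_Rintegral i) lee_fin.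
    by apply: finite_rank_proj_qtrunc; rewrite ?sqr_ge0.
  apply/measurable_EFinP; apply: measurable_qtrunc; first exact: measurable_funX.
  by move=> v; exact: sqr_ge0.
- rewrite (feature_int2 (G := fun p => (qtrunc (n%:R * bilin kap p.1 p.2 ^+ 2))%:E)); last first.
  + by move=> p; rewrite lee_fin qtrunc_ge0// mulr_ge0 ?sqr_ge0.
  + apply/measurable_EFinP; apply: measurable_qtrunc; last first.
      by move=> p; rewrite mulr_ge0 ?sqr_ge0.
    by apply: measurable_funM => //; exact: measurable_funX.
  under eq_integral do rewrite /= bilin_centered exprMn mulrA.
  have c0 : 0 <= n%:R * a ^+ 2 by rewrite mulr_ge0 ?sqr_ge0.
  rewrite -(EFin_Rintegral (in_L2_qtrunc c0 dL2)) lee_fin.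
  exact: finite_rank_degen_qtrunc.
Qed.
End swapping.
End feature_law.

Lemma independent_rvs_comp {R : realType} {d} {T : measurableType d} (P : probability T R)
    {I : finType} {d1} {E : measurableType d1} {d2} {F : measurableType d2}
    (X : I -> T -> E) (g : {mfun E >-> F}) :
  independent_rvs P X -> independent_rvs P (fun i w => g (X i w)).
Proof.
move=> iX A mA; have := iX (fun i => g @^-1` A i); apply => i.
by rewrite -[_ @^-1` _]setTI; exact: measurable_funPT.
Qed.

(** * Passing from the statistics to laws of chains *)

Section transfer.
Context {R : realType} {d'} {E : measurableType d'} (rho : probability E R).
Variables (K' : nat) (phi : nat -> {mfun E >-> R}) (lam : nat -> R).
Local Notation K := K'.+1.
Local Notation V := (K.-tuple R).
Local Notation psi := (centered_features rho K phi).
Hypothesis phi_L2 : forall k, in_L2 rho (phi k).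
Variables (f : R -> R) (s : R).
Hypotheses (mf : measurable_fun setT f) (fb : forall x, 0 <= f x <= 1).

Let mF : measurable_fun setT (fun y : R * V => (f y.1)%:E).
Proof. by apply/measurable_EFinP; exact: measurableT_comp mf measurable_fst. Qed.

Let F0 (y : R * V) : (0 <= (f y.1)%:E)%E.
Proof. by rewrite lee_fin; case/andP: (fb y.1). Qed.

Lemma feature_transfer {d} {T : measurableType d} (P : probability T R)
    (X : nat -> {mfun T >-> E}) (n : nat) : (1 < n)%N ->
  independent_rvs P (fun i : 'I_n => X i) ->
  (forall (i : 'I_n) A, measurable A -> P (X i @^-1` A) = rho A) ->
  \int[P]_w f (s * (Ustat (finite_rank K phi lam) X n w - finite_rank_mean rho K phi lam)) =
  \int[fold_law (fun=> absorb (scaled_weights lam (2 * s / (n * n.-1)%:R)))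
     (feature_law rho K' phi) (0, mean_features rho K phi n.-1%:R) n]_y f y.1.
Proof.
move=> n1 iX lX.
pose Y i : {mfun T >-> V} := HB.pack (fun w => psi (X i w))
  (isMeasurableFun.Build _ _ T V _ (measurableT_comp (@measurable_centered_features _ _ _ rho K' phi)
    (@measurable_funPT _ _ _ _ (X i)))).
have iY : independent_rvs P (fun i : 'I_n => Y i).
  exact: (independent_rvs_comp psi iX).
have lY i A : (i < n)%N -> measurable A -> P (Y i @^-1` A) = feature_law rho K' phi A.
  move=> ni mA; have := lX (Ordinal ni) (psi @^-1` A); apply.
  rewrite -[_ @^-1` _]setTI; exact: measurable_funPT.
congr fine; rewrite -(ge0_integral_rfold _ _ iY lY mF F0).
by apply: eq_integral => w _; rewrite -(rfold_features _ _ _ _ _ _ _ n1).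
Qed.

Lemma gaussian_transfer {d} {S : measurableType d} (Q : probability S R) (n : nat)
    (eta : 'I_n.+2 -> {RV Q >-> V}) (m : 'cV[R]_K) (D : R) :
  (forall k, m k ord0 = feature_mean rho phi k) ->
  independent_rvs Q (fun i => eta i) -> (forall i, std_gaussian_vector Q (eta i)) ->
  \int[Q]_w f (s * (gaussU m (feature_cov rho K' phi) (Lambda lam K) D eta w - D)) =
  \int[fold_law (fun=> absorb (scaled_weights lam (2 * s / (n.+2 * n.+1)%:R)))
     (gaussian_image (psd_sqrt (feature_cov rho K' phi)))
     (0, mean_features rho K phi n.+1%:R) n.+2]_y f y.1.
Proof.
move=> mE ieta geta; set A := psd_sqrt _.
have AT : A^T = A by have [[]] := psd_sqrtP (psd_feature_cov K' phi_L2).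
have mA : measurable_fun setT (matrix_image A).
  apply/measurable_fun_tnthP => k.
  rewrite (_ : _ \o _ = fun v => \sum_l A k l * tnth v l); last first.
    by apply/funext => v /=; rewrite tnth_mktuple.
  by apply: measurable_sum => l; apply: measurable_funM => //; exact: measurable_tnth.
pose g : {mfun V >-> V} := HB.pack (matrix_image A) (isMeasurableFun.Build _ _ V V _ mA).
pose Y i : {mfun S >-> V} := HB.pack (fun w => g (eta (inord i) w))
  (isMeasurableFun.Build _ _ S V _ (measurableT_comp mA
    (@measurable_funPT _ _ _ _ (eta (inord i))))).
have iY : independent_rvs Q (fun i : 'I_n.+2 => Y i).
  have := independent_rvs_comp g ieta; congr independent_rvs.
  by apply/funext => i; apply/funext => w; rewrite /Y/= inord_val.
have lY i B : (i < n.+2)%N -> measurable B -> Q (Y i @^-1` B) = gaussian_image A B.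
  by move=> ni mB; exact: gaussian_image_law (geta (inord i)) _ mB.
congr fine; rewrite -(ge0_integral_rfold _ _ iY lY mF F0).
have -> : mean_features rho K phi n.+1%:R = [tuple n.+1%:R * m k ord0 | k < K].
  by apply: eq_from_tnth => k; rewrite !tnth_mktuple mE.
by apply: eq_integral => w _; rewrite -(rfold_gaussian _ _ _ _ _ _ AT).
Qed.

End transfer.

Section Ustat_comparison.
Context {R : realType} {d'} {E : measurableType d'} (rho : probability E R).
Context {d} {T : measurableType d} (P : probability T R) (X : nat -> {mfun T >-> E}).
Variable n : nat.
Hypothesis n1 : (1 < n)%N.
Hypothesis X_indep : independent_rvs P (fun i : 'I_n => X i).
Hypothesis X_law : forall (i : 'I_n) A, measurable A -> P (X i @^-1` A) = rho A.
Local Notation rho2 := (rho \x rho)%E.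

Let nn0 : (n * n.-1)%:R != 0 :> R.
Proof. by case: n n1 => [|[]]// k _; rewrite pnatr_eq0. Qed.

Lemma Ustat_integral (F : E * E -> R) : measurable_fun setT F ->
  rho2.-integrable setT (EFin \o F) ->
  P.-integrable setT (EFin \o Ustat F X n) /\ \int[P]_w Ustat F X n w = \int[rho2]_p F p.
Proof.
move=> mF iF; pose g (i j : 'I_n) w := if i != j then F (X i w, X j w) else 0.
have ig i j : P.-integrable setT (EFin \o g i j).
  rewrite /g; have [_|ij] := eqVneq i j; first exact: integrable_cstR.
  exact/(integrable_pair X_indep X_law ij mF).
have isum i : P.-integrable setT (EFin \o (fun w => \sum_j g i j w)).
  exact: integrable_EFin_sum.
have iall : P.-integrable setT (EFin \o (fun w => \sum_i \sum_j g i j w)).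
  exact: integrable_EFin_sum.
have UE : Ustat F X n = fun w => (n * n.-1)%:R^-1 * \sum_i \sum_j g i j w.
  apply/funext => w; rewrite /Ustat; congr (_ * _); apply: eq_bigr => i _.
  by rewrite big_mkcond.
rewrite UE; split; first exact: (integrableZlR _ iall).
rewrite (RintegralZl _ measurableT iall) (Rintegral_sum _ isum).
under eq_bigr do rewrite (Rintegral_sum _ (ig _)).
have E1 i j : \int[P]_w g i j w = if i != j then \int[rho2]_p F p else 0.
  rewrite /g; have [_|ij] := eqVneq i j; first by rewrite Rintegral_cstT.
  exact: (integral_pair X_indep X_law ij mF iF).
under eq_bigr => i _.
  rewrite (eq_bigr _ (fun j _ => E1 i j)) -big_mkcond; over.
by rewrite sum_offdiag_cst mulrA mulVf// mul1r.
Qed.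

Variables (f : R -> R) (s Lf : R).
Hypotheses (mf : measurable_fun setT f) (fb : forall x, 0 <= f x <= 1).
Hypotheses (Lf0 : 0 <= Lf) (fL : forall x y, `|f x - f y| <= Lf * `|x - y|).

(** The difference of the two centred statistics is dominated by the U-statistic of [|F|], whose
    mean is that of [|F|]. The factor [|s|] is harmless because the kernels approach each other
    while [n], and so [s], is fixed. *)
Lemma Ustat_comparison (v1 v2 : E * E -> R) : in_L2 rho2 v1 -> in_L2 rho2 v2 ->
  `|\int[P]_w f (s * (Ustat v1 X n w - \int[rho2]_p v1 p)) -
    \int[P]_w f (s * (Ustat v2 X n w - \int[rho2]_p v2 p))| <=
  Lf * `|s| * Num.sqrt (\int[rho2]_p ((v1 p - v2 p) ^+ 2)).
Proof.
move=> h1 h2; set M1 := \int[rho2]_p v1 p; set M2 := \int[rho2]_p v2 p.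
have h12 := in_L2B h1 h2.
have M12 : \int[rho2]_p (v1 p - v2 p) = M1 - M2.
  exact: (RintegralB measurableT (in_L2_integrable h1) (in_L2_integrable h2)).
pose F p := v1 p - v2 p - (M1 - M2).
have FL2 : in_L2 rho2 F := in_L2B h12 (in_L2_cst _ (M1 - M2)).
have UF w : Ustat F X n w = Ustat v1 X n w - M1 - (Ustat v2 X n w - M2).
  rewrite /Ustat /F; under eq_bigr do rewrite !sumrB.
  rewrite !sumrB !sum_offdiag_cst; move: nn0; move: ((n * n.-1)%:R) => N N0.
  by field.
have mabs : measurable_fun setT (fun p => `|F p|).
  by apply: measurableT_comp => //; case: FL2.
have absL2 : in_L2 rho2 (fun p => `|F p|).
  split => //; apply: (eq_integrable measurableT _ _ _ FL2.2) => p _ /=.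
  by rewrite real_normK ?num_real.
have [iU EU] := Ustat_integral mabs (in_L2_integrable absL2).
have Uabs w : `|Ustat F X n w| <= Ustat (fun p => `|F p|) X n w.
  rewrite /Ustat normrM ger0_norm ?invr_ge0// ler_wpM2l ?invr_ge0//.
  apply: le_trans (ler_norm_sum _ _ _) _; apply: ler_sum => i _.
  exact: ler_norm_sum.
have mU v : in_L2 rho2 v -> measurable_fun setT (Ustat v X n).
  by move=> hv; have [iv _] := Ustat_integral hv.1 (in_L2_integrable hv);
    apply/measurable_EFinP; exact: measurable_int iv.
have ifU v M : in_L2 rho2 v -> P.-integrable setT (EFin \o (fun w => f (s * (Ustat v X n w - M)))).
  move=> hv; apply: (@bounded_integrable _ _ _ _ _ 1).
    apply: (measurableT_comp mf); apply: measurable_funM => //.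
    by apply: measurable_funB => //; exact: mU.
  by move=> w; have /andP[a b] := fb (s * (Ustat v X n w - M)); rewrite ger0_norm.
rewrite -(RintegralB measurableT (ifU _ M1 h1) (ifU _ M2 h2)).
apply: le_trans (le_normr_Rintegral measurableT (integrableBR (ifU _ M1 h1) (ifU _ M2 h2))) _.
apply: (@le_trans _ _ (\int[P]_w (Lf * `|s| * Ustat (fun p => `|F p|) X n w))).
  apply: le_Rintegral => //.
  - exact: integrable_abse (integrableBR (ifU _ M1 h1) (ifU _ M2 h2)).
  - exact: (integrableZlR _ iU).
  move=> w _; apply: le_trans (fL _ _) _.
  by rewrite -mulrBr normrM -UF mulrA ler_wpM2l// mulr_ge0.
rewrite (RintegralZl _ measurableT iU) EU ler_wpM2l ?mulr_ge0//.
rewrite -(ler_pXn2r (_ : 0 < 2)%N) ?nnegrE ?sqrtr_ge0//; last by apply: Rintegral_ge0.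
rewrite sqr_sqrtr; last by apply: Rintegral_ge0 => p _; exact: sqr_ge0.
apply: le_trans (jensen_sqr absL2.1 absL2.2) _.
under eq_Rintegral do rewrite real_normK ?num_real//.
by rewrite /F -M12; exact: variance_le.
Qed.

End Ustat_comparison.

(** * Moments of the kernel *)

Section Lnorm_tools.
Context {R : realType} {d} {T : measurableType d} (mu : probability T R).
Implicit Types (f : T -> R) (p r : R).

Lemma integral_powR_Lnorm f p : p != 0 ->
  (\int[mu]_x (`|f x| `^ p)%:E = 'N[mu]_(p%:E)[EFin \o f] `^ p)%E.
Proof. by move=> p0; rewrite powR_Lnorm//; apply: eq_integral => x _. Qed.

Lemma integral_powR_le f p r : 0 < p -> 0 <= r -> ('N[mu]_(p%:E)[EFin \o f] <= r%:E)%E ->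
  (\int[mu]_x (`|f x| `^ p)%:E <= (r `^ p)%:E)%E.
Proof.
move=> p0 r0 fr; rewrite integral_powR_Lnorm ?gt_eqF// -poweR_EFin.
by apply: (gt0_ler_poweR (ltW p0)) => //; rewrite in_itv/= leey ?Lnorm_ge0 ?lee_fin ?r0.
Qed.

Lemma Lnorm2_lty f : measurable_fun setT f ->
  ('N[mu]_(2%:E)[EFin \o f] < +oo)%E -> in_L2 mu f.
Proof.
move=> mf fy; apply: in_L2P => //.
rewrite (_ : (\int[mu]_x (f x ^+ 2)%:E = \int[mu]_x (`|f x| `^ 2)%:E)%E).
  by rewrite integral_powR_Lnorm// poweR_lty.
by apply: eq_integral => x _; rewrite powR_mulrn// real_normK ?num_real.
Qed.

Lemma Lnorm2_sqrt f : in_L2 mu f ->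
  ('N[mu]_(2%:E)[EFin \o f] = (Num.sqrt (\int[mu]_x (f x ^+ 2)))%:E)%E.
Proof.
move=> [mf f2]; rewrite unlock (_ : (\int[mu]_x _ = (\int[mu]_x (f x ^+ 2))%:E)%E).
  by rewrite poweR_EFin powR12_sqrt//; apply: Rintegral_ge0 => x _; exact: sqr_ge0.
rewrite EFin_Rintegral//; apply: eq_integral => x _.
by rewrite /= powR_mulrn// real_normK ?num_real.
Qed.

(* Pointwise, [x ^+ 2 <= r ^+ 2 + r `^ (2 - p) * |x| `^ p], according to whether [|x| <= r]. *)
Lemma integral_sqr_le f p r : measurable_fun setT f -> 2 <= p -> 0 < r ->
  ('N[mu]_(p%:E)[EFin \o f] <= r%:E)%E ->
  (\int[mu]_x (f x ^+ 2)%:E <= (2 * r ^+ 2)%:E)%E.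
Proof.
move=> mf p2 r0 fr; have p0 : 0 < p by lra.
have mp : measurable_fun setT (fun x => `|f x| `^ p).
  by apply: (measurableT_comp (measurable_powR _)) => //; exact: measurableT_comp.
have c0 : 0 <= r `^ (2 - p) by exact: powR_ge0.
apply: (@le_trans _ _ (\int[mu]_x ((r ^+ 2)%:E + (r `^ (2 - p))%:E * (`|f x| `^ p)%:E))%E).
  apply: ge0_le_integral => //.
  - by move=> x _; rewrite lee_fin sqr_ge0.
  - by apply/measurable_EFinP; exact: measurable_funX.
  - apply: emeasurable_funD => //; apply: emeasurable_funM => //.
    exact/measurable_EFinP.
  move=> x _; rewrite -EFinM -EFinD lee_fin -(real_normK (num_real (f x))).
  have [xr|rx] := leP `|f x| r.
    apply: ler_wpDr; first by rewrite mulr_ge0 ?powR_ge0.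
    by rewrite lerXn2r// nnegrE ltW.
  apply: ler_wpDl; first exact: sqr_ge0.
  have x0 : 0 < `|f x| by exact: lt_trans rx.
  rewrite -(powR_mulrn 2 (normr_ge0 _)) -{1}(subrK p 2) powRD; last first.
    by apply/implyP => _; rewrite gt_eqF.
  rewrite ler_wpM2r ?powR_ge0// -[2 - p]opprB !powRN lef_pV2 ?posrE ?powR_gt0//.
  by apply: ge0_ler_powR; rewrite ?nnegrE ?subr_ge0// ltW.
rewrite ge0_integralD//; last 3 first.
- by move=> x _; rewrite lee_fin sqr_ge0.
- by move=> x _; rewrite -EFinM lee_fin mulr_ge0 ?powR_ge0.
- by apply: emeasurable_funM => //; exact/measurable_EFinP.
rewrite integral_cstT ge0_integralZl//; last exact/measurable_EFinP.
apply: (@le_trans _ _ ((r ^+ 2)%:E + (r `^ (2 - p))%:E * (r `^ p)%:E)%E).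
  by rewrite leeD2l// lee_wpmul2l// integral_powR_le// ltW.
have -> : ((r `^ (2 - p))%:E * (r `^ p)%:E = (r ^+ 2)%:E)%E.
  by rewrite -EFinM -powRD; [rewrite subrK powR_mulrn// ltW|apply/implyP => _; rewrite gt_eqF].
by rewrite -EFinD lee_fin mulr2n mulrDl !mul1r.
Qed.

Lemma ae_eq_Lnorm (f g : T -> R) p : measurable_fun setT f -> measurable_fun setT g ->
  {ae mu, forall x, f x = g x} -> ('N[mu]_(p%:E)[EFin \o f] = 'N[mu]_(p%:E)[EFin \o g])%E.
Proof.
move=> mf mg fg; rewrite unlock; apply: (congr1 (fun z => z `^ p^-1)%E).
have mp (h : T -> R) : measurable_fun setT h ->
    measurable_fun setT (fun x => `|(EFin \o h) x| `^ p)%E.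
  move=> mh; apply/measurable_EFinP.
  by apply: (measurableT_comp (measurable_powR _)) => //; exact: measurableT_comp.
apply: ae_eq_integral => //; [exact: mp|exact: mp|].
by apply: filterS fg => x /= -> _.
Qed.

End Lnorm_tools.

Lemma Lnorm_law {R : realType} {d} {T : measurableType d} {d'} {E : measurableType d'}
    (P : probability T R) (I : finType) (X : I -> {mfun T >-> E}) (rho : probability E R)
    (X_law : forall i A, measurable A -> P (X i @^-1` A) = rho A) i (f : E -> R) (p : R) :
  measurable_fun setT f ->
  ('N[P]_(p%:E)[EFin \o (fun w => f (X i w))] = 'N[rho]_(p%:E)[EFin \o f])%E.
Proof.
move=> mf; rewrite unlock; apply: (congr1 (fun z => z `^ p^-1)%E).
rewrite -(ge0_integral_law X_law i (f := fun x => `|(EFin \o f) x| `^ p)%E)//.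
  apply/measurable_EFinP.
  by apply: (measurableT_comp (measurable_powR _)) => //; exact: measurableT_comp.
by move=> x; rewrite poweR_ge0.
Qed.

Lemma Lnorm_pair {R : realType} {d} {T : measurableType d} {d'} {E : measurableType d'}
    (P : probability T R) (I : finType) (X : I -> {mfun T >-> E}) (rho : probability E R)
    (X_indep : independent_rvs P (fun i => X i))
    (X_law : forall i A, measurable A -> P (X i @^-1` A) = rho A) i j (f : E * E -> R) (p : R) :
  i != j -> measurable_fun setT f ->
  ('N[P]_(p%:E)[EFin \o (fun w => f (X i w, X j w))] = 'N[(rho \x rho)%E]_(p%:E)[EFin \o f])%E.
Proof.
move=> ij mf; rewrite unlock; apply: (congr1 (fun z => z `^ p^-1)%E).
rewrite -(ge0_integral_pair X_indep X_law ij (F := fun x => `|(EFin \o f) x| `^ p)%E)//.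
  apply/measurable_EFinP.
  by apply: (measurableT_comp (measurable_powR _)) => //; exact: measurableT_comp.
by move=> x; rewrite poweR_ge0.
Qed.

(** For [s = 0] the quotient is [x] times [+oo], and a finite bound forces [x = 0]; the degenerate
    case is thus covered. *)
Lemma mule_inve_le {R : realType} (x : \bar R) (s C : R) : (0 <= x)%E -> 0 <= s ->
  (x / s%:E <= C%:E)%E -> 0 <= C /\ (x <= (C * s)%:E)%E.
Proof.
move=> x0 s0 h; have C0 : 0 <= C.
  rewrite -lee_fin; apply: le_trans h; apply: mule_ge0 => //.
  by rewrite inver; case: ifP => _; rewrite ?leey// lee_fin invr_ge0.
split => //; have [s_eq0|sN0] := eqVneq s 0.
  move: h; rewrite s_eq0 inve0 mulr0.
  have [->//|xN0] := eqVneq x 0%E.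
  by rewrite gt0_muley ?leye_eq// lt0e xN0.
have sp : 0 < s by rewrite lt0r sN0.
by move: h; rewrite inver (negbTE sN0) lee_pdivrMr// EFinM.
Qed.

Section moments.
Context {R : realType} {d'} {E : measurableType d'} (rho : probability E R).
Variable u : {mfun (E * E)%type >-> R}.
Context {d} {T : measurableType d} (P : probability T R) (X : nat -> {mfun T >-> E}).
Variable n : nat.
Hypothesis X_iid : iid_with_law P (fun i : 'I_n.+2 => X i) rho.
Hypothesis u_sym : forall x y, u (x, y) = u (y, x).
Local Notation rho2 := (rho \x rho)%E.
Local Notation smax := (sigma_max P u X n.+2).
Hypothesis smax_gt0 : (0 < smax)%E.
Hypothesis smax_lty : (smax < +oo)%E.

Let i0 : 'I_n.+2 := ord0.
Let i1 : 'I_n.+2 := Ordinal (isT : 1 < n.+2)%N.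
Let i01 : i0 != i1. Proof. by []. Qed.
Let i10 : i1 != i0. Proof. by []. Qed.
Let X_indep := X_iid.1.
Let X_law := X_iid.2.

Local Notation D := (\int[rho2]_p u p).
Local Notation gam := (fun x => \int[rho]_y u (x, y) - D).
Local Notation h := (fun p => u p - D).

Let Mfull_norm p : Mfull P u X p = ('N[rho2]_(p%:E)[EFin \o (fun q => u q - Dmean P u X)%R])%E.
Proof.
by rewrite /Mfull -(Lnorm_pair X_indep X_law _ i01)//; exact: measurable_funB.
Qed.

(** At this stage [Dmean] is merely some real number, as integrability of [u] is not yet known;
    square integrability around any constant suffices. *)
Lemma kernel_L2 : in_L2 rho2 u.
Proof.
have fy : (sigma_full P u X < +oo)%E.
  by apply: le_lt_trans smax_lty; rewrite /sigma_max le_max lexx.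
have h2 : in_L2 rho2 (fun q => u q - Dmean P u X).
  apply: Lnorm2_lty; first exact: measurable_funB.
  by rewrite -Mfull_norm.
have := in_L2D h2 (in_L2_cst rho2 (Dmean P u X)); congr in_L2.
by apply/funext => q; rewrite subrK.
Qed.

Let u_L2 := kernel_L2.

Lemma DmeanE : Dmean P u X = D.
Proof.
rewrite /Dmean unlock.
exact: (integral_pair X_indep X_law i01 u_L2.1 (in_L2_integrable u_L2)).
Qed.

Let h_L2 : in_L2 rho2 h.
Proof. exact: in_L2B u_L2 (in_L2_cst _ _). Qed.

Lemma MfullE p : Mfull P u X p = 'N[rho2]_(p%:E)[EFin \o h]%E.
Proof. by rewrite Mfull_norm DmeanE. Qed.

Let measurable_gam : measurable_fun setT gam.
Proof.
apply: measurable_funB => //.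
exact: (measurable_section_integral (in_L2_integrable u_L2)).
Qed.

(** [Mcond] conditions on the second argument and [is_cond_exp_pair] on the first; [u_sym] bridges
    the two, and uniqueness replaces the chosen version. *)
Lemma McondE p : Mcond P u X p = 'N[rho]_(p%:E)[EFin \o gam]%E.
Proof.
pose Y w := u (X 0%N w, X 1%N w); pose V := cond_exp P Y (X 1%N).
transitivity ('N[P]_(p%:E)[EFin \o (fun w => V w - Dmean P u X)%R])%E => //.
have hW := is_cond_exp_pair X_indep X_law i10 u_L2.1 (in_L2_integrable u_L2).
have {}hW : is_cond_exp P Y (X 1%N) (fun w => \int[rho]_y u (X 1%N w, y)).
  by move: hW; congr is_cond_exp; apply/funext => w; exact: u_sym.
have hV : is_cond_exp P Y (X 1%N) V.
  exact: (@xgetPex _ (cst 0) [set V | is_cond_exp P Y (X 1%N) V] (ex_intro _ _ hW)).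
have VW := cond_exp_unique hV hW.
have mV : measurable_fun setT V.
  by case: hV => _ iV _; apply/measurable_EFinP; exact: measurable_int iV.
rewrite DmeanE -(Lnorm_law X_law i1 _ measurable_gam).
apply: ae_eq_Lnorm.
- exact: measurable_funB.
- exact: measurableT_comp measurable_gam _.
- by apply: filterS VW => w ->.
Qed.

Let smax_full : (sigma_full P u X <= smax)%E.
Proof. by rewrite /sigma_max le_max lexx. Qed.

Let smax_cond : ((Num.sqrt n.+1%:R)%:E * sigma_cond P u X <= smax)%E.
Proof. by rewrite /sigma_max le_max lexx orbT. Qed.

Lemma kernel_cond_L2 : in_L2 rho gam.
Proof.
apply: Lnorm2_lty => //; rewrite -McondE -/(sigma_cond P u X).
have s0 : 0 < Num.sqrt n.+1%:R :> R by rewrite sqrtr_gt0 ltr0n.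
have := le_lt_trans smax_cond smax_lty.
by case: (sigma_cond P u X) => [r _| |_]; [exact: ltry|rewrite gt0_muley ?lte_fin|].
Qed.

Lemma sigma_maxE : exists2 M : R, smax = M%:E & [/\ 0 < M,
  \int[rho2]_p (h p ^+ 2) <= M ^+ 2 & n.+1%:R * \int[rho]_x (gam x ^+ 2) <= M ^+ 2].
Proof.
have mfin : smax \is a fin_num by rewrite gt0_fin_numE.
exists (fine smax); first by rewrite fineK.
have M0 : 0 < fine smax by rewrite fine_gt0// smax_gt0.
have i0_ge (g : R) : 0 <= g -> Num.sqrt g <= fine smax -> g <= fine smax ^+ 2.
  by move=> g0; rewrite -{2}(sqr_sqrtr g0) => gM; rewrite lerXn2r// nnegrE ?sqrtr_ge0// ltW.
split => //; apply: i0_ge.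
- by apply: Rintegral_ge0 => p _; exact: sqr_ge0.
- by rewrite -lee_fin fineK// -(Lnorm2_sqrt h_L2) -MfullE.
- by rewrite mulr_ge0//; apply: Rintegral_ge0 => p _; exact: sqr_ge0.
- rewrite -lee_fin fineK// sqrtrM// EFinM -(Lnorm2_sqrt kernel_cond_L2) -McondE.
  exact: smax_cond.
Qed.

Variables (nu C : R).
Hypothesis nu_gt0 : 0 < nu.
Hypothesis Mfull_le : (Mfull P u X nu / sigma_full P u X <= C%:E)%E.
Hypothesis Mcond_le : (Mcond P u X nu / sigma_cond P u X <= C%:E)%E.

Lemma kernel_moments : [/\ 0 <= C,
  (\int[rho2]_p (`|h p| `^ nu)%:E <= ((C * Num.sqrt (\int[rho2]_p (h p ^+ 2))) `^ nu)%:E)%E &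
  (\int[rho]_x (`|gam x| `^ nu)%:E <= ((C * Num.sqrt (\int[rho]_x (gam x ^+ 2))) `^ nu)%:E)%E].
Proof.
move: Mfull_le; rewrite /sigma_full !MfullE (Lnorm2_sqrt h_L2).
move=> /(mule_inve_le (Lnorm_ge0 _ _ _) (sqrtr_ge0 _)) [C0 hC].
move: Mcond_le; rewrite /sigma_cond !McondE (Lnorm2_sqrt kernel_cond_L2).
move=> /(mule_inve_le (Lnorm_ge0 _ _ _) (sqrtr_ge0 _)) [_ gC].
by split => //; apply: integral_powR_le; rewrite ?mulr_ge0 ?sqrtr_ge0.
Qed.

End moments.

Lemma integral_law {R : realType} {d} {T : measurableType d} {d'} {E : measurableType d'}
    (P : probability T R) (I : finType) (X : I -> {mfun T >-> E}) (rho : probability E R)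
    (X_law : forall i A, measurable A -> P (X i @^-1` A) = rho A) i (f : E -> \bar R) :
  measurable_fun setT f -> (\int[P]_w f (X i w) = \int[rho]_x f x)%E.
Proof.
move=> mf; rewrite integralE [RHS]integralE.
rewrite -(ge0_integral_law X_law i (measurable_funepos mf))//.
rewrite -(ge0_integral_law X_law i (measurable_funeneg mf))//.
by congr (_ - _)%E; apply: eq_integral => w _; rewrite ?funeposE ?funenegE.
Qed.

Section feature_moments.
Context {R : realType} {d'} {E : measurableType d'} (rho : probability E R).
Variables (u : {mfun (E * E)%type >-> R}) (phi : nat -> {mfun E >-> R}) (lam : nat -> R).
Context {d} {T : measurableType d} (P : probability T R) (X : nat -> {mfun T >-> E}).
Variable n : nat.
Hypothesis X_iid : iid_with_law P (fun i : 'I_n.+2 => X i) rho.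
Local Notation rho2 := (rho \x rho)%E.

Let i0 : 'I_n.+2 := ord0.
Let i1 : 'I_n.+2 := Ordinal (isT : 1 < n.+2)%N.
Let i01 : i0 != i1. Proof. by []. Qed.
Let X_indep := X_iid.1.
Let X_law := X_iid.2.

Lemma feature_L2 k : ('E_P[(fun w => phi k (X 0%N w) ^+ 2)%R] < +oo)%E -> in_L2 rho (phi k).
Proof.
rewrite unlock => h; apply: in_L2P => //.
rewrite -(integral_law X_law i0 (f := fun x => (phi k x ^+ 2)%:E))//.
by apply/measurable_EFinP; exact: measurable_funX.
Qed.

Let EphiE k : fine 'E_P[phi k \o X 0%N] = feature_mean rho phi k.
Proof.
rewrite unlock /feature_mean; congr fine.
by rewrite -(integral_law X_law i0 (f := fun x => (phi k x)%:E))//; exact/measurable_EFinP.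
Qed.

Lemma muKE K k : muK P X phi K k ord0 = feature_mean rho phi k.
Proof. by rewrite mxE EphiE. Qed.

Lemma SigmaKE K' : SigmaK P X phi K'.+1 = feature_cov rho K' phi.
Proof.
apply/matrixP => k l; rewrite !mxE covariance.unlock !EphiE expectation.unlock.
congr fine.
rewrite -(integral_law X_law i0 (f := fun x =>
  ((phi k x - feature_mean rho phi k) * (phi l x - feature_mean rho phi l))%:E))//.
by apply/measurable_EFinP; apply: measurable_funM; exact: measurable_funB.
Qed.

Variable nu : R.
Hypothesis nu_ge2 : 2 <= nu.
Hypothesis eps_cvg0 : eps P u X phi lam K nu @[K --> \oo] --> 0%E.

Lemma eps_small (e : R) : 0 < e -> \forall K \near \oo,
  in_L2 rho2 (fun p => finite_rank K phi lam p - u p) /\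
  \int[rho2]_p ((finite_rank K phi lam p - u p) ^+ 2) <= e.
Proof.
(* [integral_sqr_le] costs a factor 2. *)
move=> e0; pose r := Num.sqrt (e / 2).
have r0 : 0 < r by rewrite sqrtr_gt0 divr_gt0.
have h : nbhs 0%E [set x : \bar R | (x < r%:E)%E].
  by apply: open_nbhs_nbhs; split; [exact: open_ereal_lt_ereal|rewrite /= lte_fin].
have {}h : \forall K \near \oo, (eps P u X phi lam K nu < r%:E)%E by move/eps_cvg0: h.
apply: filterS h => K /ltW.
have mer : measurable_fun setT (fun p => finite_rank K phi lam p - u p).
  apply: measurable_funB => //; apply: measurable_sum => k.
  apply: measurable_funM; last exact: measurableT_comp measurable_snd.
  by apply: measurable_funM => //; exact: measurableT_comp measurable_fst.
rewrite /eps (Lnorm_pair X_indep X_law _ i01 mer) => /(integral_sqr_le mer nu_ge2 r0) H.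
have eL2 := in_L2P mer (le_lt_trans H (ltry _)).
split => //; rewrite -lee_fin (EFin_Rintegral eL2.2); apply: le_trans H _.
by rewrite lee_fin /r sqr_sqrtr; lra.
Qed.

End feature_moments.

(** * Comparison with the Gaussian polynomial *)

Section gaussian_gap.
Context {R : realType} {d'} {E : measurableType d'} (rho : probability E R).
Variables (u : {mfun (E * E)%type >-> R}) (phi : nat -> {mfun E >-> R}) (lam : nat -> R).
Context {d} {T : measurableType d} (P : probability T R) (X : nat -> {mfun T >-> E}).
Variable n : nat.
Local Notation N := n.+2.
Local Notation rho2 := (rho \x rho)%E.
Hypothesis X_iid : iid_with_law P (fun i : 'I_N => X i) rho.
Hypothesis u_L2 : in_L2 rho2 u.
Hypothesis phi_L2 : forall k, in_L2 rho (phi k).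
Variables (dS : nat -> measure_display) (S : forall K, measurableType (dS K)).
Variables (Q : forall K, probability (S K) R).
Variable eta : forall K, 'I_N -> {RV (Q K) >-> K.-tuple R}.
Hypothesis eta_gaussian : forall K, independent_rvs (Q K) (fun i => eta K i) /\
  forall i, std_gaussian_vector (Q K) (eta K i).
Variable nu : R.
Hypothesis nu_ge2 : 2 <= nu.
Hypothesis eps_cvg0 : eps P u X phi lam K nu @[K --> \oo] --> 0%E.
Variables (s : R) (L : probability R R).
Local Notation D := (\int[rho2]_p u p).
Local Notation G K := (gaussU (muK P X phi K) (SigmaK P X phi K) (Lambda lam K)
  (Dmean P u X) (eta K)).
Hypothesis L_lim : cvg_in_law
  (fun K => distribution (Q K) (affine_rv s (Dmean P u X) (G K))) L.
Hypothesis DE : Dmean P u X = D.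
Variables (f : R -> R) (Cf Lf delta : R).
Hypotheses (cf : continuous f) (fb : forall x, 0 <= f x <= 1).
Hypotheses (Cf0 : 0 <= Cf) (ft : taylor2_fun f Cf).
Hypotheses (Lf0 : 0 <= Lf) (fL : forall x y, `|f x - f y| <= Lf * `|x - y|).
Hypothesis delta0 : 0 < delta.

Local Notation a := (2 * s / (N * n.+1)%:R).
Local Notation b := (n.+1%:R).
Local Notation gam := (fun x => \int[rho]_y u (x, y) - D).
Local Notation h := (fun p => u p - D).

(** Linear in its four moment arguments, so that the approximation error adds exactly a multiple
    [R1] of itself. *)
Definition gap_bound (V1 V2 I1 I2 : R) : R :=
  N%:R * (2 * Cf * delta * ((a * b) ^+ 2 * (2 * V1) + N%:R * (a ^+ 2 * (18 * V2))) +
    Cf * (1 + delta ^- 2) * (1 + gaussian_qconst) *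
      (50 * gaussian_qconst * (8 * I1 + 1088 * I2))).

Local Notation V1 := (\int[rho]_x (gam x ^+ 2)).
Local Notation V2 := (\int[rho2]_p (h p ^+ 2)).
Local Notation I1 := (\int[rho]_x qtrunc ((a * b) ^+ 2 * gam x ^+ 2)).
Local Notation I2 := (\int[rho2]_p qtrunc (N%:R * a ^+ 2 * h p ^+ 2)).
Local Notation err2 K := (\int[rho2]_p ((finite_rank K phi lam p - u p) ^+ 2)).
Let R1 := gap_bound 1 1 ((a * b) ^+ 2) (N%:R * a ^+ 2).

Let mf : measurable_fun setT f.
Proof. exact: continuous_measurable_fun. Qed.

Let gap_boundD e : gap_bound (V1 + e) (V2 + e) (I1 + (a * b) ^+ 2 * e) (I2 + N%:R * a ^+ 2 * e) =
  gap_bound V1 V2 I1 I2 + e * R1.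
Proof. by rewrite /R1 /gap_bound; ring. Qed.

(** The finite-rank U-statistic is the intermediate term: the comparison with [u] is Lipschitz, the
    one with the Gaussian polynomial is Lindeberg's. *)
Let gap_at K' : in_L2 rho2 (fun p => finite_rank K'.+1 phi lam p - u p) ->
  `|\int[P]_w f (s * (Ustat u X N w - Dmean P u X)) -
    \int[Q K'.+1]_w f (s * (G K'.+1 w - Dmean P u X))| <=
  Lf * `|s| * Num.sqrt (err2 K'.+1) + (gap_bound V1 V2 I1 I2 + err2 K'.+1 * R1).
Proof.
move=> err; rewrite -gap_boundD.
have uK_L2 : in_L2 rho2 (finite_rank K'.+1 phi lam).
  by have := in_L2D err u_L2; congr in_L2; apply/funext => p; rewrite subrK.
set x := \int[P]_w _; set z := \int[Q _]_w _.
pose y := \int[P]_w f (s * (Ustat (finite_rank K'.+1 phi lam) X N w -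
  finite_rank_mean rho K'.+1 phi lam)).
have -> : x - z = (x - y) + (y - z) by ring.
apply: le_trans (ler_normD _ _) _; apply: lerD.
  rewrite /x /y DE -(finite_rank_meanE phi_L2 u_L2 err).
  apply: le_trans (Ustat_comparison _ X_iid.1 X_iid.2 s mf fb Lf0 fL u_L2 uK_L2) _ => //.
  under eq_Rintegral do rewrite -opprB sqrrN; exact: lexx.
rewrite /y /z (SigmaKE phi X_iid K').
have [ieta geta] := eta_gaussian K'.+1.
rewrite (feature_transfer K' phi lam s mf fb (isT : (1 < n.+2)%N) X_iid.1 X_iid.2).
rewrite (gaussian_transfer lam phi_L2 s mf fb (Dmean P u X) (muKE phi X_iid (K := K'.+1)) ieta geta).
exact: (lindeberg_features phi_L2 u_L2 err a b mf fb Cf0 ft delta0 (isT : (0 < n.+2)%N)).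
Qed.

Lemma gaussian_gap :
  `|\int[distribution P (affine_rv s (Dmean P u X) (Ustat u X N))]_x f x - \int[L]_x f x| <=
  gap_bound V1 V2 I1 I2.
Proof.
have int_affine d1 (T1 : measurableType d1) (P1 : probability T1 R) (Y : {mfun T1 >-> R}) b' :
    \int[distribution P1 (affine_rv s b' Y)]_x f x = \int[P1]_w f (s * (Y w - b')).
  congr fine; rewrite ge0_integral_distribution//; first exact/measurable_EFinP.
  by move=> x; rewrite lee_fin; case/andP: (fb x).
have fbd : bounded_fun f.
  exists 1; split => [|M M1 x _ /=]; first exact: num_real.
  by have /andP[f0 f1] := fb x; rewrite ger0_norm//; exact: le_trans f1 (ltW M1).
have intf (M : probability R R) : M.-integrable setT (EFin \o f).
  apply: (@bounded_integrable _ _ _ _ _ 1) => // x.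
  by have /andP[f0 f1] := fb x; rewrite ger0_norm.
have cvg : (\int[Q K]_w f (s * (G K w - Dmean P u X))) @[K --> \oo] --> \int[L]_x f x.
  have := L_lim cf fbd; rewrite -(EFin_Rintegral (intf L)) => /fine_cvgP[_].
  by apply: cvg_trans; apply: near_eq_cvg; apply: nearW => K /=; rewrite -int_affine.
rewrite int_affine; apply/ler_addgt0Pr => e e0.
(* With [err2 <= t^2] and [t <= 1], both the square root and [err2] itself are at most [t], and
   their joint contribution is at most [e / 2]. *)
pose t := Num.min 1 (e / 2 / (Lf * `|s| + `|R1| + 1)).
have B0 : 0 < Lf * `|s| + `|R1| + 1 by rewrite ltr_wpDl// addr_ge0// mulr_ge0.
have t0 : 0 < t by rewrite lt_min ltr01 !divr_gt0.
have t1 : t <= 1 by rewrite ge_min lexx.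
have tB : t * (Lf * `|s| + `|R1|) <= e / 2.
  have : t * (Lf * `|s| + `|R1| + 1) <= e / 2 by rewrite -ler_pdivlMr// ge_min lexx orbT.
  by have := t0; nra.
have t2 : 0 < t ^+ 2 by rewrite exprn_gt0.
have e2 : 0 < e / 2 by rewrite divr_gt0.
(* One [K] serves both limits; it is taken positive because the feature and Gaussian laws are built
   in dimension [K'.+1]. *)
have [K [K0 [err eK] Kcvg]] : exists K, [/\ (0 < K)%N,
    in_L2 rho2 (fun p => finite_rank K phi lam p - u p) /\ err2 K <= t ^+ 2 &
    `|\int[L]_x f x - \int[Q K]_w f (s * (G K w - Dmean P u X))| < e / 2].
  near \oo => K; exists K; split.
  - near: K; exact: nbhs_infty_gt.
  - near: K; exact: (eps_small X_iid nu_ge2 eps_cvg0 t2).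
  - near: K; exact: ((cvgrPdist_lt _ _).1 cvg _ e2).
case: K K0 err eK Kcvg => [//|K'] _ err eK Kcvg.
have gK := gap_at err.
set x := \int[P]_w _ in gK *; set z := \int[Q _]_w _ in gK Kcvg *.
have -> : x - \int[L]_x f x = (x - z) - (\int[L]_x f x - z) by ring.
apply: le_trans (ler_normB _ _) _.
have st : Num.sqrt (err2 K'.+1) <= t.
  by rewrite -(ger0_norm (ltW t0)) -sqrtr_sqr ler_wsqrtr.
have h1 : Lf * `|s| * Num.sqrt (err2 K'.+1) <=
    Lf * `|s| * t by rewrite ler_wpM2l// mulr_ge0.
have h2 : err2 K'.+1 * R1 <= t * `|R1|.
  apply: le_trans (ler_wpM2l _ (ler_norm R1)) _.
    by apply: Rintegral_ge0 => p _; exact: sqr_ge0.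
  by rewrite ler_wpM2r//; apply: le_trans eK _; rewrite expr2 ler_piMl// ltW.
have h3 := ltW Kcvg.
apply: le_trans (lerD gK h3) _.
move: tB h1 h2; move: (gap_bound _ _ _ _) `|R1| => G0 r1; lra.
Unshelve. all: by end_near.
Qed.

End gaussian_gap.

(** [qtrunc (c * f^2)] is at most [|sqrt c * f|^nu], and the moment hypothesis is homogeneous, so
    only the standard deviation at scale [sqrt c] remains. *)
Lemma integral_qtrunc_le {R : realType} {d} {T : measurableType d} (mu : probability T R)
    (f : T -> R) (nu C c t : R) : 2 <= nu -> nu <= 4 -> in_L2 mu f -> 0 <= C -> 0 <= c ->
  (\int[mu]_x (`|f x| `^ nu)%:E <= ((C * Num.sqrt (\int[mu]_x (f x ^+ 2))) `^ nu)%:E)%E ->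
  Num.sqrt (c * \int[mu]_x (f x ^+ 2)) <= t ->
  \int[mu]_x qtrunc (c * f x ^+ 2) <= (C * t) `^ nu.
Proof.
move=> nu2 nu4 fL2 C0 c0 fnu cVt; set V := \int[mu]_x (f x ^+ 2) in fnu cVt.
have nu0 : 0 <= nu by lra.
have V0 : 0 <= V by apply: Rintegral_ge0 => x _; exact: sqr_ge0.
have mp : measurable_fun setT (fun x => `|f x| `^ nu).
  apply: (measurableT_comp (measurable_powR _)) => //.
  by apply: measurableT_comp => //; case: fL2.
have sE : (Num.sqrt c `^ nu) * (C * Num.sqrt V) `^ nu = (C * Num.sqrt (c * V)) `^ nu.
  by rewrite -powRM ?mulr_ge0 ?sqrtr_ge0// sqrtrM// mulrCA.
have step : (\int[mu]_x qtrunc (c * f x ^+ 2) <= (C * Num.sqrt (c * V)) `^ nu)%R.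
  rewrite -lee_fin (EFin_Rintegral (in_L2_qtrunc c0 fL2)) -sE EFinM.
  apply: (@le_trans _ _ (\int[mu]_x ((Num.sqrt c `^ nu)%:E * (`|f x| `^ nu)%:E))%E).
    apply: ge0_le_integral => //.
    - by move=> x _; rewrite lee_fin qtrunc_ge0// mulr_ge0 ?sqr_ge0.
    - by case/integrableP: (in_L2_qtrunc c0 fL2).
    - by apply: emeasurable_funM => //; exact/measurable_EFinP.
    move=> x _; rewrite -EFinM lee_fin -powRM ?sqrtr_ge0//.
    rewrite -{1}[Num.sqrt c](ger0_norm (sqrtr_ge0 c)) -normrM.
    by apply: le_trans (qtrunc_le_powR _ nu2 nu4); rewrite exprMn sqr_sqrtr.
  rewrite ge0_integralZl//; first by rewrite lee_wpmul2l ?lee_fin ?powR_ge0.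
  exact/measurable_EFinP.
apply: le_trans step _; apply: ge0_ler_powR => //.
- by rewrite nnegrE mulr_ge0 ?sqrtr_ge0.
- by rewrite nnegrE mulr_ge0//; apply: le_trans cVt; exact: sqrtr_ge0.
- by rewrite ler_wpM2l.
Qed.

(** * Sizes of the coefficients in terms of [n] *)

Section numeric_bound.
Context {R : realType}.
Variables (n : nat) (M V1 V2 : R).
Local Notation N := (n.+2%:R : R).
Local Notation k := (n.+1%:R : R).
Local Notation s := (Num.sqrt (n.+2 * n.+1)%:R / M).
Local Notation a := (2 * s / (n.+2 * n.+1)%:R).
Hypotheses (M0 : 0 < M) (V1_le : k * V1 <= M ^+ 2) (V1_ge0 : 0 <= V1) (V2_le : V2 <= M ^+ 2).

Let N0 : 0 < N. Proof. by rewrite ltr0n. Qed.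
Let k0 : 0 < k. Proof. by rewrite ltr0n. Qed.
Let s2 : s ^+ 2 = N * k / M ^+ 2.
Proof. by rewrite exprMn sqr_sqrtr ?ler0n// natrM exprVn. Qed.

Let a2 : a ^+ 2 = 4 / (N * k * M ^+ 2).
Proof.
have E (x y : R) : (2 * x / y) ^+ 2 = 4 * x ^+ 2 / y ^+ 2 by rewrite !exprMn exprVn -natrX.
by rewrite E s2 natrM; field; rewrite !gt_eqF.
Qed.

Let ak2 : (a * k) ^+ 2 = 4 * k / (N * M ^+ 2).
Proof. by rewrite exprMn a2; field; rewrite !gt_eqF. Qed.

Lemma scaled_cond_le : N * (a * k) ^+ 2 * V1 <= 4.
Proof.
rewrite ak2 (_ : _ * V1 = 4 * (k * V1) / M ^+ 2); last by field; rewrite !gt_eqF.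
by rewrite ler_pdivrMr ?exprn_gt0// ler_wpM2l.
Qed.

Lemma scaled_full_le : N * (k * (a ^+ 2 * V2)) <= 4.
Proof.
rewrite a2 (_ : N * _ = 4 * V2 / M ^+ 2); last by field; rewrite !gt_eqF.
by rewrite ler_pdivrMr ?exprn_gt0// ler_wpM2l.
Qed.

(** One observation contributes a standard deviation of order [n^(-1/2)]; this is where the factor
    [sqrt (n - 1)] of [sigma_max] is used. *)
Lemma sqrt_cond_le : Num.sqrt ((a * k) ^+ 2 * V1) <= 2 / Num.sqrt k.
Proof.
rewrite (_ : 2 / _ = Num.sqrt (4 / k)); last first.
  by rewrite sqrtrM// sqrtrV ?ler0n// (_ : 4 = 2 ^+ 2 :> R) ?sqrtr_sqr ?ger0_norm//; ring.
rewrite ler_wsqrtr// ler_pdivlMr//; apply: le_trans scaled_cond_le.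
rewrite [leLHS]mulrC -[leRHS]mulrA.
by apply: ler_wpM2r; [exact: mulr_ge0 (sqr_ge0 _) V1_ge0|rewrite ler_nat].
Qed.

Lemma sqrt_full_le : Num.sqrt (N * a ^+ 2 * V2) <= 2 / Num.sqrt k.
Proof.
rewrite (_ : 2 / _ = Num.sqrt (4 / k)); last first.
  by rewrite sqrtrM// sqrtrV ?ler0n// (_ : 4 = 2 ^+ 2 :> R) ?sqrtr_sqr ?ger0_norm//; ring.
rewrite ler_wsqrtr// ler_pdivlMr// (_ : _ * k = N * (k * (a ^+ 2 * V2))); last by ring.
exact: scaled_full_le.
Qed.

End numeric_bound.

(** [304 = 2 * (8 + 144)], with [8 = 2 * 4] from the projection and [144 = 18 * 2 * 4] from the
    degenerate part, where [n.+2 <= 2 * n.+1]; and [1096 = 8 + 1088]. *)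
Lemma gap_bound_le {R : realType} (n : nat) (M V1 V2 I1 I2 Cf delta e : R) :
  0 < M -> 0 <= V1 -> n.+1%:R * V1 <= M ^+ 2 -> 0 <= V2 -> V2 <= M ^+ 2 -> 0 <= Cf -> 0 < delta ->
  I1 <= e -> I2 <= e ->
  gap_bound n (Num.sqrt (n.+2 * n.+1)%:R / M) Cf delta V1 V2 I1 I2 <=
  304 * Cf * delta + Cf * (1 + delta ^- 2) * (1 + gaussian_qconst) *
    (50 * gaussian_qconst * (1096 * (n.+2%:R * e))).
Proof.
move=> M0 V10 V1M V20 V2M Cf0 d0 Ie1 Ie2; rewrite /gap_bound.
have q1 := @gaussian_qconst_ge1 R.
have hc := scaled_cond_le M0 V1M.
have hf := scaled_full_le n M0 V2M.
set a := 2 * _ / _ in hc hf *.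
have N2k : n.+2%:R <= 2 * n.+1%:R :> R.
  by rewrite -natrM ler_nat mul2n -addnn addSn addnS !ltnS leq_addr.
have N0 : 0 <= n.+2%:R :> R by exact: ler0n.
have d2 : 0 <= delta ^- 2 by rewrite invr_ge0 exprn_ge0// ltW.
move: (gaussian_qconst) (delta ^- 2) q1 d2 => q dd q1 dd0.
have P1 : 0 <= Cf * (1 + dd) * (1 + q) * (50 * q).
  have c50 : 0 <= 50 :> R by exact: ler0n.
  have d1 : 0 <= 1 + dd by lra.
  have qq : 0 <= 1 + q by lra.
  have q0 : 0 <= q by lra.
  exact: mulr_ge0 (mulr_ge0 (mulr_ge0 Cf0 d1) qq) (mulr_ge0 c50 q0).
have P2 : 0 <= 2 * Cf * delta.
  have c2 : 0 <= 2 :> R by exact: ler0n.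
  exact: mulr_ge0 (mulr_ge0 c2 Cf0) (ltW d0).
have a2 : 0 <= a ^+ 2 by exact: sqr_ge0.
move: N2k N0 hc hf; move: (n.+2%:R : R) (n.+1%:R : R) => N k N2k N0 hc hf.
have h1 : N * ((a * k) ^+ 2 * (2 * V1)) <= 8.
  by rewrite (_ : N * _ = 2 * (N * (a * k) ^+ 2 * V1)); [lra|ring].
have X0 : 0 <= N * (a ^+ 2 * V2) := mulr_ge0 N0 (mulr_ge0 a2 V20).
have h2 : N * (N * (a ^+ 2 * (18 * V2))) <= 144.
  rewrite (_ : N * _ = 18 * (N * (N * (a ^+ 2 * V2)))); last by ring.
  have := ler_wpM2r X0 N2k.
  rewrite (_ : 2 * k * _ = 2 * (N * (k * (a ^+ 2 * V2)))); last by ring.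
  lra.
have h3 : N * (8 * I1 + 1088 * I2) <= 1096 * (N * e).
  rewrite (_ : 1096 * _ = N * (8 * e + 1088 * e)); last by ring.
  by apply: ler_wpM2l => //; lra.
rewrite (_ : N * _ = 2 * Cf * delta * (N * ((a * k) ^+ 2 * (2 * V1)) +
    N * (N * (a ^+ 2 * (18 * V2)))) +
  Cf * (1 + dd) * (1 + q) * (50 * q) * (N * (8 * I1 + 1088 * I2))); last by ring.
apply: lerD.
  rewrite (_ : 304 * Cf * delta = 2 * Cf * delta * 152); last by ring.
  by apply: ler_wpM2l => //; lra.
rewrite (_ : _ * (50 * q * _) = Cf * (1 + dd) * (1 + q) * (50 * q) * (1096 * (N * e))); last by ring.
exact: ler_wpM2l P1 _ _ h3.
Qed.

(** With [x = 1 / n.+1] the power equals [(2 C)^nu * x * x^p], and [n.+2 * x <= 2]; what remains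
    tends to 0 because [p = nu / 2 - 1] is positive. *)
Lemma gap_tail_small {R : realType} (C nu e : R) : 0 <= C -> 2 < nu -> 0 < e ->
  \forall n \near \oo, n.+2%:R * (C * (2 / Num.sqrt n.+1%:R)) `^ nu <= e.
Proof.
move=> C0 nu2 e0; pose p := nu / 2 - 1; have p0 : 0 < p by rewrite /p; lra.
pose B := 2 * (C * 2) `^ nu; have B0 : 0 <= B by rewrite mulr_ge0 ?powR_ge0.
have eB : 0 < e / (B + 1) by rewrite divr_gt0// ltr_wpDl.
have r0 : 0 < (e / (B + 1)) `^ p^-1 by rewrite powR_gt0.
apply: filterS (near_infty_natSinv_lt (PosNum r0)) => n /=.
set x := n.+1%:R^-1 => xr.
have x0 : 0 < x by rewrite invr_gt0 ltr0n.
have xp : x `^ p <= e / (B + 1).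
  have -> : e / (B + 1) = ((e / (B + 1)) `^ p^-1) `^ p.
    by rewrite -powRrM mulVf ?gt_eqF// powRr1// ltW.
  by apply: ge0_ler_powR; rewrite ?nnegrE ?ltW.
have sE : (C * (2 / Num.sqrt n.+1%:R)) `^ nu = (C * 2) `^ nu * (x * x `^ p).
  rewrite mulrA powRM ?mulr_ge0 ?invr_ge0 ?sqrtr_ge0//; congr (_ * _).
  rewrite -sqrtrV ?ler0n// -/x -powR12_sqrt ?ltW// -powRrM.
  rewrite -{2}(powRr1 (ltW x0)) -powRD; last by apply/implyP => _; rewrite gt_eqF.
  by congr (_ `^ _); rewrite /p; lra.
have Nx : n.+2%:R * x <= 2.
  rewrite ler_pdivrMr ?ltr0n// -natrM ler_nat mul2n -addnn addSn addnS !ltnS.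
  exact: leq_addr.
rewrite sE mulrCA (mulrA n.+2%:R) mulrCA.
apply: (@le_trans _ _ (B * (e / (B + 1)))).
  rewrite {1}/B -[leRHS]mulrA; apply: (ler_pM _ _ Nx).
  - exact: mulr_ge0 (ler0n _ _) (ltW x0).
  - exact: mulr_ge0 (powR_ge0 _ _) (powR_ge0 _ _).
  - by rewrite ler_wpM2l ?powR_ge0.
rewrite mulrA ler_pdivrMr ?ltr_wpDl//; nra.
Qed.

(** It blows up as [delta] tends to 0, whereas [gap_slope] is free of [delta]; hence [delta] must be
    fixed before [n] grows. *)
Definition gap_constant {R : realType} (Cf delta : R) : R :=
  Cf * (1 + delta ^- 2) * (1 + gaussian_qconst) * (50 * gaussian_qconst * 1096).

Definition gap_slope {R : realType} (Cf : R) : R := 304 * Cf.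

Lemma gap_slope_ge0 {R : realType} (Cf : R) : 0 <= Cf -> 0 <= gap_slope Cf.
Proof. exact: mulr_ge0 (ler0n _ _). Qed.

Section Ustat_gaussian_gap.
Context {R : realType} {d'} {E : measurableType d'} (rho : probability E R).
Variables (u : {mfun (E * E)%type >-> R}) (phi : nat -> {mfun E >-> R}) (lam : nat -> R).
Context {d} {T : measurableType d} (P : probability T R) (X : nat -> {mfun T >-> E}).
Variable n : nat.
Local Notation N := n.+2.
Local Notation rho2 := (rho \x rho)%E.
Hypothesis X_iid : iid_with_law P (fun i : 'I_N => X i) rho.
Hypothesis u_sym : forall x y, u (x, y) = u (y, x).
Hypothesis smax_gt0 : (0 < sigma_max P u X N)%E.
Hypothesis smax_lty : (sigma_max P u X N < +oo)%E.
Hypothesis phi_L2 : forall k, ('E_P[(fun w => phi k (X 0%N w) ^+ 2)%R] < +oo)%E.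
Variables (dS : nat -> measure_display) (S : forall K, measurableType (dS K)).
Variables (Q : forall K, probability (S K) R).
Variable eta : forall K, 'I_N -> {RV (Q K) >-> K.-tuple R}.
Hypothesis eta_gaussian : forall K, independent_rvs (Q K) (fun i => eta K i) /\
  forall i, std_gaussian_vector (Q K) (eta K i).
Variables (nu C : R).
Hypotheses (nu_gt2 : 2 < nu) (nu_le3 : nu <= 3).
Hypothesis Mfull_le : (Mfull P u X nu / sigma_full P u X <= C%:E)%E.
Hypothesis Mcond_le : (Mcond P u X nu / sigma_cond P u X <= C%:E)%E.
Hypothesis eps_cvg0 : eps P u X phi lam K nu @[K --> \oo] --> 0%E.
Variable L : probability R R.
Hypothesis L_lim : cvg_in_law (fun K => distribution (Q K)
  (affine_rv (scaling P u X N) (Dmean P u X)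
    (gaussU (muK P X phi K) (SigmaK P X phi K) (Lambda lam K) (Dmean P u X) (eta K)))) L.
Variables (f : R -> R) (Cf Lf delta : R).
Hypotheses (cf : continuous f) (fb : forall x, 0 <= f x <= 1).
Hypotheses (Cf0 : 0 <= Cf) (ft : taylor2_fun f Cf).
Hypotheses (Lf0 : 0 <= Lf) (fL : forall x y, `|f x - f y| <= Lf * `|x - y|).
Hypothesis delta0 : 0 < delta.

Lemma Ustat_gaussian_gap : 0 <= C /\
  `|\int[distribution P (affine_rv (scaling P u X N) (Dmean P u X) (Ustat u X N))]_x f x -
    \int[L]_x f x| <=
  gap_slope Cf * delta +
  gap_constant Cf delta * (n.+2%:R * (C * (2 / Num.sqrt n.+1%:R)) `^ nu).
Proof.
have u_L2 := kernel_L2 X_iid smax_lty.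
have DE := DmeanE X_iid smax_lty.
have [M ME [M0 V2M V1M]] := sigma_maxE X_iid u_sym smax_gt0 smax_lty.
have nu0 : 0 < nu by apply: lt_trans nu_gt2; rewrite ltr0n.
have [C0 hnu gnu] := kernel_moments X_iid u_sym smax_lty nu0 Mfull_le Mcond_le.
have sE : scaling P u X N = Num.sqrt (n.+2 * n.+1)%:R / M by rewrite /scaling ME.
split => //; have L_lim' := L_lim; rewrite sE in L_lim' *.
have nu2 : 2 <= nu by exact: ltW.
have nu4 : nu <= 4 by apply: le_trans nu_le3 _; rewrite ler_nat.
have gam_L2 := kernel_cond_L2 X_iid u_sym smax_lty.
have h_L2 := in_L2B u_L2 (in_L2_cst (rho \x rho)%E (\int[rho2]_p u p)).
have V1_ge0 : 0 <= \int[rho]_x ((\int[rho]_y u (x, y) - \int[rho2]_p u p) ^+ 2).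
  by apply: Rintegral_ge0 => x _; exact: sqr_ge0.
have V2_ge0 : 0 <= \int[rho2]_p ((u p - \int[rho2]_p u p) ^+ 2).
  by apply: Rintegral_ge0 => x _; exact: sqr_ge0.
apply: le_trans (gaussian_gap X_iid u_L2 (fun k => feature_L2 X_iid (phi_L2 k)) eta_gaussian
  nu2 eps_cvg0 L_lim' DE cf fb Cf0 ft Lf0 fL delta0) _.
apply: le_trans (gap_bound_le M0 V1_ge0 V1M V2_ge0 V2M Cf0 delta0 _ _) _.
- apply: (integral_qtrunc_le nu2 nu4 gam_L2 C0 (sqr_ge0 _) gnu).
  exact: (sqrt_cond_le M0 V1M V1_ge0).
- apply: (integral_qtrunc_le nu2 nu4 h_L2 C0 (mulr_ge0 (ler0n _ _) (sqr_ge0 _)) hnu).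
  exact: (sqrt_full_le n M0 V2M).
by rewrite /gap_slope /gap_constant !mulrA.
Qed.
End Ustat_gaussian_gap.

Theorem corollary5 (R : realType)
    (dim : nat -> nat)
    (Rlaw : forall n, probability ((dim n).-tuple R) R)
    (u : forall n, {mfun ((dim n).-tuple R * (dim n).-tuple R)%type >-> R})
    (dT : nat -> measure_display)
    (T : forall n, measurableType (dT n))
    (P : forall n, probability (T n) R)
    (X : forall n, nat -> {RV (P n) >-> (dim n).-tuple R})
    (phi : forall n, nat -> {mfun (dim n).-tuple R >-> R})
    (lambda : nat -> nat -> R)
    (dS : nat -> nat -> measure_display)
    (S : forall n K, measurableType (dS n K))
    (Q : forall n K, probability (S n K) R)
    (eta : forall n K, 'I_n -> {RV (Q n K) >-> K.-tuple R})
    (nu C : R)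
    (L : nat -> probability R R)
    (Ubar : probability R R)
    (X_iid : forall n, (2 <= n)%N ->
       iid_with_law (P n) (fun i : 'I_n => X n i) (Rlaw n))
    (u_sym : forall n, (2 <= n)%N -> forall x y, u n (x, y) = u n (y, x))
    (sigma_max_gt0 : forall n, (2 <= n)%N ->
       (0 < sigma_max (P n) (u n) (X n) n)%E)
    (sigma_max_lty : forall n, (2 <= n)%N ->
       (sigma_max (P n) (u n) (X n) n < +oo)%E)
    (phi_L2 : forall n, (2 <= n)%N -> forall k,
       ('E_(P n)[(fun w => phi n k (X n 0%N w) ^+ 2)%R] < +oo)%E)
    (eta_gaussian : forall n, (2 <= n)%N -> forall K,
       independent_rvs (Q n K) (fun i : 'I_n => eta n K i) /\
       forall i : 'I_n, std_gaussian_vector (Q n K) (eta n K i))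
    (nu_gt2 : 2 < nu) (nu_le3 : nu <= 3)
    (Mfull_le : forall n, (2 <= n)%N ->
       (Mfull (P n) (u n) (X n) nu / sigma_full (P n) (u n) (X n) <= C%:E)%E)
    (Mcond_le : forall n, (2 <= n)%N ->
       (Mcond (P n) (u n) (X n) nu / sigma_cond (P n) (u n) (X n) <= C%:E)%E)
    (eps_cvg0 : forall n, (2 <= n)%N ->
       eps (P n) (u n) (X n) (phi n) (lambda n) K nu @[K --> \oo] --> 0%E)
    (L_lim : forall n, (2 <= n)%N ->
       cvg_in_law
         (fun K => distribution (Q n K)
            (affine_rv (scaling (P n) (u n) (X n) n)
                       (Dmean (P n) (u n) (X n))
                       (gaussU (muK (P n) (X n) (phi n) K)
                               (SigmaK (P n) (X n) (phi n) K)
                               (Lambda (lambda n) K)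
                               (Dmean (P n) (u n) (X n))
                               (eta n K))))
         (L n))
    (Ubar_lim : cvg_in_law L Ubar) :
  cvg_in_law
    (fun n => distribution (P n)
       (affine_rv (scaling (P n) (u n) (X n) n)
                  (Dmean (P n) (u n) (X n))
                  (Ustat (u n) (X n) n)))
    Ubar.
Proof.
apply: cvg_in_law_step_at => a h h0.
set f := step_at a h.
have cf : continuous f by exact: continuous_step_at.
have fb x : 0 <= f x <= 1 by exact: step_at_bounds.
pose Cf : R := 4 * (h ^- 2 + h ^- 3).
have hi0 : 0 <= h^-1 by rewrite invr_ge0 ltW.
have Cf0 : 0 <= Cf by rewrite /Cf mulr_ge0// addr_ge0// -exprVn exprn_ge0.
have ft : taylor2_fun f Cf by exact: step_at_taylor2.
pose Lf : R := 6 / h.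
have Lf0 : 0 <= Lf by rewrite /Lf mulr_ge0.
have fL x y : `|f x - f y| <= Lf * `|x - y| by exact: step_at_lip.
have gap n delta : 0 < delta -> 0 <= C /\
    `|\int[distribution (P n.+2) (affine_rv (scaling (P n.+2) (u n.+2) (X n.+2) n.+2)
        (Dmean (P n.+2) (u n.+2) (X n.+2)) (Ustat (u n.+2) (X n.+2) n.+2))]_x f x -
      \int[L n.+2]_x f x| <=
    gap_slope Cf * delta +
    gap_constant Cf delta * (n.+2%:R * (C * (2 / Num.sqrt n.+1%:R)) `^ nu).
  move=> d0; have n2 : (2 <= n.+2)%N by [].
  exact: (Ustat_gaussian_gap (X_iid _ n2) (u_sym _ n2) (sigma_max_gt0 _ n2) (sigma_max_lty _ n2)
    (phi_L2 _ n2) (eta_gaussian _ n2) nu_gt2 nu_le3 (Mfull_le _ n2) (Mcond_le _ n2) (eps_cvg0 _ n2)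
    (L_lim _ n2) cf fb Cf0 ft Lf0 fL d0).
have C0 : 0 <= C by have [] := gap 0%N 1 ltr01.
have fbd : bounded_fun f.
  exists 1; split => [|M M1 x _ /=]; first exact: num_real.
  by have /andP[f0 f1] := fb x; rewrite ger0_norm//; exact: le_trans f1 (ltW M1).
have intf (M : probability R R) : M.-integrable setT (EFin \o f).
  apply: (@bounded_integrable _ _ _ _ _ 1) => [|x]; first exact: measurable_step_at.
  by have /andP[f0 f1] := fb x; rewrite ger0_norm.
have cvg : (\int[L n]_x f x) @[n --> \oo] --> \int[Ubar]_x f x.
  by have := Ubar_lim f cf fbd; rewrite -(EFin_Rintegral (intf Ubar)) => /fine_cvgP[_].
apply/cvgrPdist_le => e e0.
(* Half of [e] goes to the convergence of [L n], a quarter to the term linear in [delta], and a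
   quarter to the tail. The added 1 keeps the denominator positive. *)
pose delta := e / 4 / (gap_slope Cf + 1).
have B0 : 0 < gap_slope Cf + 1 by apply: ltr_wpDl => //; exact: gap_slope_ge0.
have d0 : 0 < delta by rewrite !divr_gt0.
have dB : gap_slope Cf * delta <= e / 4.
  by rewrite /delta mulrCA ger_pMr ?divr_gt0// ler_pdivrMr// mul1r lerDl.
have G0 : 0 < `|gap_constant Cf delta| + 1 by rewrite ltr_wpDl.
have e4 : 0 < e / 4 / (`|gap_constant Cf delta| + 1) by rewrite !divr_gt0.
have e2 : 0 < e / 2 by rewrite divr_gt0.
have [m1 _ H1] := gap_tail_small C0 nu_gt2 e4.
have [m2 _ H2] := (cvgrPdist_le _ _).1 cvg _ e2.
(* The tail estimate is indexed by the sample size minus 2, hence the shift. *)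
exists (maxn m1 m2).+2 => // -[//|[//|n]] /=.
rewrite !ltnS geq_max => /andP[n1 n2].
have {}H1 := H1 n n1.
have {}H2 := H2 n.+2 (leq_trans n2 (ltnW (leqnSn n.+1))).
have [_ H3] := gap n delta d0.
have t0 := powR_ge0 (C * (2 / Num.sqrt n.+1%:R)) nu.
move: H1 H2 H3 t0; move: (_ `^ nu) => tau.
set g := gap_constant _ _; set i := \int[L _]_x _; set j := \int[Ubar]_x _.
set k := \int[distribution _ _]_x _ => H1 H2 H3 t0.
have -> : j - k = (j - i) - (k - i) by ring.
apply: le_trans (ler_normB _ _) _.
have H4 : g * (n.+2%:R * tau) <= e / 4.
  apply: (@le_trans _ _ ((`|g| + 1) * (n.+2%:R * tau))).
    apply: ler_wpM2r; first exact: mulr_ge0 (ler0n _ _) t0.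
    by apply: le_trans (ler_norm g) _; rewrite lerDl.
  by move: H1; rewrite ler_pdivlMr// mulrC.
apply: le_trans (lerD H2 (le_trans H3 (lerD dB H4))) _.
by rewrite (_ : e / 2 + (e / 4 + e / 4) = e)//; field.
Qed.
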